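(* Assume that $h$ has an integrable lower bound (there is an integrable function $m$ with $h(x,\omega)\ge m(\omega)$ for every $x$ and $\omega$) and that $N_t$ is linear-valued for $t=T,\ldots,0$. The functions $h_t$ are then well-defined normal integrands and we have for every $x\in\mathcal{N}$ that \[ Eh_t(x^t(\omega),\omega)\ \ge\ \inf_{x'\in\mathcal{N}}Eh(x'(\omega),\omega),\qquad t=0,\ldots,T. \qquad ( * ) \] Optimal solutions $x\in\mathcal{N}$ of the problem of minimizing $Eh(x(\omega),\omega)$ over $x\in\mathcal{N}$ exist and they are characterized by the condition \[ x_t(\omega)\in\mathop{\mathrm{argmin}}_{x_t\in\mathbb{R}^{n_t}}h_t(x^{t-1}(\omega),x_t,\omega)\quad P\text{-a.s.}\quad t=0,\ldots,T, \] which is equivalent to having equalities in $( * )$. Moreover, there is an optimal solution $x\in\mathcal{N}$ such that $x_t\perp N_t$ (i.e. $x_t(\omega)\perp N_t(\omega)$ almost surely) for every $t=0,\ldots,T$.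
   Context: $(\Omega,\mathcal{F},P)$ is a probability space with a filtration $(\mathcal{F}_t)_{t=0}^T$ (increasing sub-sigma-algebras of $\mathcal{F}$); $\mathcal{F}$ and all $\mathcal{F}_t$ are $P$-complete. $n_0,\ldots,n_T$ are given integers, $n=n_0+\cdots+n_T$, $L^0(\Omega,\mathcal{G},P;\mathbb{R}^k)$ is the space of ($P$-a.s. equivalence classes of) $\mathcal{G}$-measurable $\mathbb{R}^k$-valued functions, and $\mathcal{N}=\{(x_t)_{t=0}^T\,|\,x_t\in L^0(\Omega,\mathcal{F}_t,P;\mathbb{R}^{n_t})\}$. Write $x^t=(x_0,\ldots,x_t)$. For a sigma-algebra $\mathcal{G}\subseteq\mathcal{F}$, a $\mathcal{G}$-normal integrand on $\mathbb{R}^k$ is a function $h:\mathbb{R}^k\times\Omega\to[-\infty,\infty]$ such that $\omega\mapsto\{(x,\alpha)\in\mathbb{R}^k\times\mathbb{R}\,|\,h(x,\omega)\le\alpha\}$ is closed-valued and $\mathcal{G}$-measurable. Given is a convex $\mathcal{F}$-normal integrand $h$ on $\mathbb{R}^n$ (convex means that $h(\cdot,\omega)$ is convex for every $\omega$). The expectation $E$ of a measurable function is set equal to $+\infty$ unless its positive part is integrable. For an $\mathcal{F}$-measurable extended real-valued $X$, $E^{\mathcal{G}}X:=E^{\mathcal{G}}X_+-E^{\mathcal{G}}X_-$ with the convention $\infty-\infty=\infty$, where conditional expectations of nonnegative functions are the usual ones. The $\mathcal{G}$-conditional expectation of a normal integrand $h$ is a $\mathcal{G}$-measurable normal integrand $E^{\mathcal{G}}h$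 such that $(E^{\mathcal{G}}h)(x(\omega),\omega)=E^{\mathcal{G}}[h(x(\cdot),\cdot)](\omega)$ $P$-a.s. for all $\mathcal{G}$-measurable $x$. (It exists and is unique up to $P$-null sets when $h$ has an integrable lower bound.) Write $E_t=E^{\mathcal{F}_t}$. The functions $h_t,\tilde h_t:\mathbb{R}^{n_0+\cdots+n_t}\times\Omega\to[-\infty,\infty]$ are defined recursively for $t=T,\ldots,0$ by \[ \tilde h_T=h,\qquad h_t=E_t\tilde h_t,\qquad \tilde h_{t-1}(x^{t-1},\omega)=\inf_{x_t\in\mathbb{R}^{n_t}}h_t(x^{t-1},x_t,\omega), \] and \[ N_t(\omega)=\{x_t\in\mathbb{R}^{n_t}\,|\,h_t^\infty(x^t,\omega)\le 0,\ x^{t-1}=0\}. \] The assumption on $N_t$ is understood successively for $t=T,\ldots,0$ along the recursion; linear-valued means that the values are linear subspaces. For a convex lower semicontinuous function $h(\cdot,\omega)$ with nonempty domain $\mathrm{dom}\,h(\cdot,\omega)=\{x\,|\,h(x,\omega)<\infty\}$, the recession function is $h^\infty(x,\omega)=\sup_{\lambda>0}\frac{h(\lambda x+\bar x,\omega)-h(\bar x,\omega)}{\lambda}$, independent of the choice of $\bar x\in\mathrm{dom}\,h(\cdot,\omega)$; if the domain is empty, $h^\infty(\cdot,\omega)$ is $0$ at the origin and $+\infty$ elsewhere.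
   Formalization: That optimal solutions (or equalities in ( * )) satisfy the argmin condition is claimed only if the optimal value is < +∞; otherwise it fails, e.g. T=0, F_0=F, h=|x|²+ξ, ξ≥0, Eξ=+∞, where every x is optimal. *)

(* Defs.v *)
From HB Require Import structures.
From mathcomp Require Import all_boot all_order all_algebra.
From mathcomp Require Import all_classical all_reals all_analysis.
From mathcomp Require Import measurable_realfun.

Set Implicit Arguments.
Unset Strict Implicit.
Unset Printing Implicit Defensive.

Import Order.TTheory GRing.Theory Num.Theory.
Import numFieldNormedType.Exports.

Local Open Scope classical_set_scope.
Local Open Scope ring_scope.
Local Open Scope ereal_scope.

(* Sub-sigma-algebras of the sigma-algebra of [Omega] are sets of sets
   [G : set (set Omega)].  The ambient one is [@measurable d Omega]. *)

(* For [G = @measurable d Omega] this is [measure_is_complete P]; for a smaller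
   [G] it is the completeness of the restriction of [P] to [G], which in
   particular holds when [G] contains all [P]-negligible sets. *)
Definition complete_wrt d (Omega : measurableType d) (R : realType)
    (P : probability Omega R) (G : set (set Omega)) : Prop :=
  forall A B, G B -> P B = 0 -> A `<=` B -> G A.

Record is_filtration d (Omega : measurableType d) (T : nat)
    (F : nat -> set (set Omega)) : Prop := {
  filtration_sigma : forall t, (t <= T)%N -> sigma_algebra setT (F t) ;
  filtration_sub : forall t, (t <= T)%N -> F t `<=` @measurable d Omega ;
  filtration_le : forall s t, (s <= t)%N -> (t <= T)%N -> F s `<=` F t }.

(* Borel measurability with respect to the sigma-algebra [G] *)
Definition measurable_wrt (Omega : Type) (G : set (set Omega))
    (X : topologicalType) (f : Omega -> X) : Prop :=
  forall U : set X, open U -> G (f @^-1` U).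

Section expectation.
Context d (Omega : measurableType d) (R : realType) (P : probability Omega R).
Implicit Types (G : set (set Omega)) (X Y Z : Omega -> \bar R).

Definition extended_expectation X : \bar R :=
  if `[< P.-integrable setT X^\+ >] then \int[P]_w X w else +oo.

(* [Y] is a version of the conditional expectation of the nonnegative [X] *)
Definition is_condexp_ge0 G X Y : Prop :=
  [/\ forall w, 0 <= Y w,
      measurable_wrt G Y &
      forall A, G A -> \int[P]_(w in A) Y w = \int[P]_(w in A) X w].

(* [Z] is almost surely equal to [E^G X = E^G X_+ - E^G X_-]; in the dual
   addition [%dE] of the extended reals, [+oo - +oo = +oo]. *)
Definition is_condexp G X Z : Prop :=
  measurable_fun setT X /\
  exists Yp Ym : Omega -> \bar R,
    [/\ is_condexp_ge0 G X^\+ Yp,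
        is_condexp_ge0 G X^\- Ym &
        \forall w \ae P, Z w = (Yp w - Ym w)%dE].

End expectation.

Section convex_analysis.
Context (R : realType) (k : nat).
Implicit Types (f : 'rV[R]_k -> \bar R) (x y : 'rV[R]_k).

Definition epigraph f : set ('rV[R]_k * R^o)%type :=
  [set p | f p.1 <= (p.2)%:E].

Definition effective_domain f : set 'rV[R]_k := [set x | f x < +oo].

(* The base point is an arbitrarily chosen element of the domain: for convex
   lower semicontinuous [f] the value does not depend on it. *)
Definition recession f x : \bar R :=
  if `[< effective_domain f !=set0 >] then
    let xbar := xget 0%R (effective_domain f) in
    ereal_sup [set (f (l *: x + xbar)%R - f xbar) * (l^-1)%:E
              | l in [set l : R | (0 < l)%R]]
  else if x == 0%R then 0 else +oo.

Definition linear_subspace (A : set 'rV[R]_k) : Prop :=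
  A 0%R /\ forall (a : R) x y, A x -> A y -> A (a *: x + y)%R.

Definition argmin f : set 'rV[R]_k := [set x | forall y, f x <= f y].

Definition orthogonal_to x (A : set 'rV[R]_k) : Prop :=
  forall y, A y -> (x *m y^T)%R = 0%R.

End convex_analysis.

Section normal_integrands.
Context d (Omega : measurableType d) (R : realType) (k : nat).
Implicit Types (G : set (set Omega)) (h g : 'rV[R]_k -> Omega -> \bar R).

Definition normal_integrand G h : Prop :=
  (forall w, closed (epigraph (h^~ w))) /\
  (forall U : set ('rV[R]_k * R^o)%type, open U ->
     G [set w | epigraph (h^~ w) `&` U !=set0]).

Definition convex_integrand h : Prop :=
  forall w, convex_set (epigraph (h^~ w)).

Definition integrable_lower_bound (P : probability Omega R) h : Prop :=
  exists m : Omega -> \bar R,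
    P.-integrable setT m /\ forall x w, m w <= h x w.

(* [g] is a version of the [G]-conditional expectation [E^G h] *)
Definition is_condexp_integrand (P : probability Omega R) G h g : Prop :=
  normal_integrand G g /\
  forall x : Omega -> 'rV[R]_k, measurable_wrt G x ->
    is_condexp P G (fun w => h (x w) w) (fun w => g (x w) w).

End normal_integrands.

(* [dims n t = n 0 + ... + n t.-1], so that [x^{t-1}] lives in
   ['rV_(dims n t)] and [x^t] in ['rV_(dims n t.+1)], which is
   ['rV_(dims n t + n t)] by computation. *)
Fixpoint dims (n : nat -> nat) (t : nat) : nat :=
  if t is t'.+1 then (dims n t' + n t')%N else 0%N.

Section dynamic_programming.
Context d (Omega : measurableType d) (R : realType) (P : probability Omega R).
Variables (T : nat) (F : nat -> set (set Omega)) (n : nat -> nat).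
Variable h : 'rV[R]_(dims n T.+1) -> Omega -> \bar R.

Definition append t (x : 'rV[R]_(dims n t)) (y : 'rV[R]_(n t)) :
  'rV[R]_(dims n t.+1) := row_mx x y.

(* Families indexed by [t]; only the components with [t <= T] matter. *)
Definition process := forall t : nat, Omega -> 'rV[R]_(n t).
Definition integrand_family :=
  forall t : nat, 'rV[R]_(dims n t.+1) -> Omega -> \bar R.

(* [adapted] is the space of decisions [N] *)
Definition adapted (x : process) : Prop :=
  forall t, (t <= T)%N -> measurable_wrt (F t) (x t).

(* [before x t] is [x^{t-1}], hence [before x t.+1] is [x^t] and
   [before x T.+1] is the whole of [x] *)
Fixpoint before (x : process) (t : nat) (w : Omega) : 'rV[R]_(dims n t) :=
  if t is t'.+1 then append (before x t' w) (x t' w) else 0%R.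

Definition inf_last t (g : 'rV[R]_(dims n t.+1) -> Omega -> \bar R)
    (x : 'rV[R]_(dims n t)) (w : Omega) : \bar R :=
  ereal_inf (range (fun y : 'rV[R]_(n t) => g (append x y) w)).

(* [H T, ..., H s] are versions of the functions produced by the recursion
   [h_T = E_T h], [h_t = E_t (inf over x_{t+1} of h_{t+1})] run from [T] down
   to [s]. *)
Definition recursion_down_to (s : nat) (H : integrand_family) : Prop :=
  is_condexp_integrand P (F T) h (H T) /\
  forall t, (s <= t)%N -> (t < T)%N ->
    is_condexp_integrand P (F t) (inf_last (H t.+1)) (H t).

Definition null_directions (H : integrand_family) (t : nat) (w : Omega) :
    set 'rV[R]_(n t) :=
  [set y | recession ((H t)^~ w) (append 0%R y) <= 0].
Arguments null_directions : clear implicits.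

(* The recursion determines [h_s] only up to null sets, and it can be continued
   below [s] once [N_T, ..., N_s] are linear-valued. *)
Definition linear_valued_along_recursion : Prop :=
  forall (s : nat) (H : integrand_family), (s <= T)%N ->
    recursion_down_to s H ->
    \forall w \ae P, linear_subspace (null_directions H s w).

Definition objective (x : process) : \bar R :=
  extended_expectation P (fun w => h (before x T.+1 w) w).

Definition stage_objective (H : integrand_family) (t : nat) (x : process) :
    \bar R :=
  extended_expectation P (fun w => H t (before x t.+1 w) w).

Definition optimal_value : \bar R := ereal_inf [set objective x | x in adapted].

Definition optimal (x : process) : Prop :=
  adapted x /\ objective x = optimal_value.

Definition stagewise_argmin (H : integrand_family) (x : process) : Prop :=
  forall t, (t <= T)%N ->
    \forall w \ae P, argmin (fun y => H t (append (before x t w) y) w) (x t w).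

End dynamic_programming.

Arguments null_directions {d Omega R n} H t w _.

(* Main.v *)
Require Import Defs.
From HB Require Import structures.
From mathcomp Require Import all_boot all_order all_algebra.
From mathcomp Require Import all_classical all_reals all_analysis.
From mathcomp Require Import measurable_realfun.
From mathcomp Require Import ring lra.

Set Implicit Arguments.
Unset Strict Implicit.
Unset Printing Implicit Defensive.

Import Order.TTheory GRing.Theory Num.Theory.
Import numFieldNormedType.Exports.

Local Open Scope classical_set_scope.
Local Open Scope ring_scope.
Local Open Scope ereal_scope.

(** The dynamic programming principle holds because two operations on convex
    normal integrands, conditional expectation and minimisation over the last
    block of variables, both stay within that class, and because minima can be
    selected measurably.

    Conditional expectations of integrands ([condexp_normal_ge0]).  For a
    nonnegative normal integrand [h] and a ball [B] of a countable base, let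
    [J B] be a conditional expectation of the infimum of [h] over [B].  The
    supremum of [J B w] over the balls [B] that contain [x] is lower
    semicontinuous in [x] by its very form, and compactness makes it a normal
    integrand.  It dominates [E^G h(x)] by Fatou's lemma along a
    countably-valued choice of shrinking balls around [x(w)], and it is
    dominated by it since the infimum over a ball around [x(w)] is at most
    [h(x(w), w)].  An integrable lower bound [- mu] reduces the general case to
    this one: add [mu] before, subtract [E^G mu] afterwards
    ([condexp_posneg_shift], [is_condexp_shift]).  An inequality that holds
    along every measurable selection holds almost surely at every point, since
    a normal integrand has a countable family of measurable selections that is
    dense in its sublevel sets ([dense_selections]).  This gives uniqueness,
    convexity and the lower bound of the conditional expectation
    ([condexp_integrand_unique], [condexp_integrand_regular]).

    Minimisation over the last block ([partial_minimum_regular]).  When the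
    directions [y] with recession at most [0] at [(0, y)] form a linear space
    [L], the function is constant along [L] in its last block, so that one may
    minimise over the orthogonal complement of [L].  There the sublevel sets
    are bounded uniformly for bounded first block
    ([orthogonal_sublevel_bounded]), because an unbounded sequence would
    produce a unit direction of recession orthogonal to [L].  Hence minima are
    attained and the minimum function is closed; it is convex in any case.

    Optimality.  Taking expectations in [h_t = E_t (inf h_{t+1})] gives
    [E h_t(x^t) = E inf h_{t+1}(x^t, .) <= E h_{t+1}(x^{t+1})], with equality
    when [x_{t+1}] is a minimiser, and only then if the values are finite
    ([extended_expectation_eq_ae]).  Continuing an arbitrary [x^t] by measurable
    minimisers ([greedy]) yields an adapted process with cost [E h_t(x^t)], hence
    the lower bound, and starting the continuation at time [0] yields an optimal
    process.  Choosing each time the minimiser of least Euclidean norm makes it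
    orthogonal to the directions along which the function is constant
    ([min_sqnorm_orthogonal]). *)

(** * Sigma-algebras as sets of sets, and rational balls *)

Section sigma_algebra_predicates.
Context (Omega : Type) (G : set (set Omega)).
Hypothesis sG : sigma_algebra setT G.

Lemma sa_not (A : Omega -> Prop) : G [set w | A w] -> G [set w | ~ A w].
Proof. by case: sG => _ + _ => /[apply]; rewrite setTD. Qed.

(** Measurability of a set described by a formula is proved along the
    formula: this and the lemmas around it treat each connective, quantifiers
    being allowed over countable types. *)
Lemma sa_exists (I : countType) (A : I -> Omega -> Prop) :
  (forall i, G [set w | A i w]) -> G [set w | exists i, A i w].
Proof.
move=> GA; case: sG => G0 _ GU.
have -> : [set w | exists i, A i w] =
    \bigcup_n (if unpickle n is Some i then [set w | A i w] else set0).
  apply/seteqP; split=> [w [i Aiw]|w [n _]].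
    by exists (pickle i) => //; rewrite pickleK.
  by case: unpickle => [i|] // Aiw; exists i.
by apply: GU => n; case: unpickle.
Qed.

Lemma sa_forall (I : countType) (A : I -> Omega -> Prop) :
  (forall i, G [set w | A i w]) -> G [set w | forall i, A i w].
Proof.
move=> GA.
have -> : [set w | forall i, A i w] = [set w | ~ exists i, ~ A i w].
  apply/seteqP; split=> [w Aw [i]|w nAw i]; first exact.
  by apply: contrapT => nA; apply: nAw; exists i.
by apply/sa_not/sa_exists => i; exact: sa_not.
Qed.

Lemma sa_or (A B : Omega -> Prop) : G [set w | A w] -> G [set w | B w] ->
  G [set w | A w \/ B w].
Proof.
move=> GA GB.
have -> : [set w | A w \/ B w] =
    [set w | exists b : bool, (if b then A else B) w].
  apply/seteqP; split=> [w [?|?]|w [[]]]; by [exists true|exists false|left|right].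
by apply: sa_exists => -[].
Qed.

Lemma sa_and (A B : Omega -> Prop) : G [set w | A w] -> G [set w | B w] ->
  G [set w | A w /\ B w].
Proof.
move=> GA GB.
have -> : [set w | A w /\ B w] =
    [set w | forall b : bool, (if b then A else B) w].
  by apply/seteqP; split=> [w [? ?] []|w AB] //; split; [exact: (AB true)|exact: (AB false)].
by apply: sa_forall => -[].
Qed.

Lemma sa_imp (A B : Omega -> Prop) : G [set w | A w] -> G [set w | B w] ->
  G [set w | A w -> B w].
Proof.
move=> GA GB.
have -> : [set w | A w -> B w] = [set w | ~ A w \/ B w].
  apply/seteqP; split=> w /=; last by case.
  by have [Aw|] := pselect (A w); [right; exact: H|left].
by apply: sa_or => //; exact: sa_not.
Qed.

Lemma sa_cst (A : Prop) : G [set w | A].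
Proof.
have [a|na] := pselect A.
  have -> : [set w : Omega | A] = [set w | ~ set0 w].
    by apply/seteqP; split=> w // _ [].
  by apply: sa_not; case: sG.
by have -> : [set w : Omega | A] = set0 by [apply/seteqP; split]; case: sG.
Qed.

End sigma_algebra_predicates.

Section sub_sigma_algebra.
Context d (Omega : measurableType d) (R : realType) (G : set (set Omega)).
Hypothesis sG : sigma_algebra setT G.
Local Notation OmegaG := (g_sigma_algebraType G).

Lemma measurable_subE : @measurable _ OmegaG = G.
Proof. exact: measurable_g_measurableTypeE. Qed.

Lemma emeasurable_open (U : set (\bar R)) : open U -> measurable U.
Proof.
move=> oU.
have -> : U = (EFin @` (EFin @^-1` U)) `|`
    ((U `&` [set +oo]) `|` (U `&` [set -oo])).
  apply/seteqP; split=> [[r||] Ux /=|_ [[r Ur <-]|[[]|[]]]] //.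
  - by left; exists r.
  - by right; left.
  - by right; right.
have m1 (x : \bar R) : measurable (U `&` [set x]).
  have [Ux|nUx] := pselect (U x).
    by rewrite setIC setIidl// => _ ->.
  by rewrite (_ : _ `&` _ = set0) //; apply/seteqP; split=> y // -[+ yx]; rewrite yx.
apply: measurableU; last exact: measurableU.
apply: measurable_image_EFin; apply: open_measurable.
by move: oU; apply: open_comp => // r _.
Qed.

(** The sub-sigma-algebra [G] is also the sigma-algebra of the type
    [g_sigma_algebraType G]; this equivalence makes the closure properties of
    measurable functions available for measurability with respect to [G]. *)
Lemma measurable_wrtE (f : Omega -> \bar R) :
  measurable_wrt G f <-> measurable_fun [set: OmegaG] (f : OmegaG -> \bar R).
Proof.
split=> [Gf|mf U oU].
  apply: (measurability _ (ErealGenOInfty.measurableE R)) => // _ [_ [x ->] <-].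
  rewrite measurable_subE setTI; apply: Gf.
  by rewrite set_itvE; exact: open_ereal_gt_ereal.
rewrite -measurable_subE -[X in measurable X]setTI.
by apply: mf => //; exact: emeasurable_open.
Qed.

Lemma measurable_wrt_lt (f : Omega -> \bar R) :
  (forall a : R, G [set w | f w < a%:E]) -> measurable_wrt G f.
Proof.
move=> Gf; apply/measurable_wrtE.
apply: (measurability _ (ErealGenInftyO.measurableE R)) => // _ [_ [x ->] <-].
by rewrite measurable_subE setTI; have := Gf x; rewrite set_itvE.
Qed.

Lemma measurable_wrt_set (f : Omega -> \bar R) (B : set (\bar R)) :
  measurable_wrt G f -> measurable B -> G (f @^-1` B).
Proof.
move=> /measurable_wrtE mf mB; have := mf measurableT B mB.
by rewrite measurable_subE setTI.
Qed.

Lemma measurable_wrt_measurable (f : Omega -> \bar R) :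
  G `<=` @measurable d Omega -> measurable_wrt G f -> measurable_fun setT f.
Proof.
by move=> GM mf _ B mB; rewrite setTI; apply: GM; exact: measurable_wrt_set.
Qed.

End sub_sigma_algebra.

Lemma measurable_ambientE d (Omega : measurableType d) (R : realType)
    (f : Omega -> \bar R) :
  measurable_wrt (@measurable d Omega) f <-> measurable_fun setT f.
Proof.
split; first by apply: measurable_wrt_measurable => //; exact: sigma_algebra_measurable.
by move=> mf U oU; rewrite -[X in measurable X]setTI; apply: mf => //; exact: emeasurable_open.
Qed.

Section rational_balls.
Context (R : realType) (k : nat).
Implicit Types (x y : 'rV[R]_k) (i : 'rV[rat]_k * nat).

(** The balls with rational centre and radius [1 / (m + 1)] form a countable
    base of the topology, and their closures are compact. *)
Definition rational_point (c : 'rV[rat]_k) : 'rV[R]_k := map_mx ratr c.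
Definition rational_ball i : set 'rV[R]_k :=
  [set y | (`|rational_point i.1 - y| < i.2.+1%:R^-1)%R].
Definition rational_cball i : set 'rV[R]_k :=
  [set y | (`|rational_point i.1 - y| <= i.2.+1%:R^-1)%R].

Lemma rational_ball_open i : open (rational_ball i).
Proof.
have -> : rational_ball i = ball (rational_point i.1) (i.2.+1%:R^-1).
  by rewrite -ball_normE.
by apply: ball_open.
Qed.

Lemma rational_ball_cball i : rational_ball i `<=` rational_cball i.
Proof. by move=> y; exact: ltW. Qed.

Lemma rational_cball_compact i : compact (rational_cball i).
Proof.
have -> : rational_cball i = closed_ball_ Num.norm (rational_point i.1) (i.2.+1%:R^-1) by [].
apply: bounded_closed_compact; last exact: closed_closed_ball_.
exists (`|rational_point i.1| + i.2.+1%:R^-1)%R; split; first by rewrite num_real.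
move=> M ltM y /= ye; apply: le_trans (ltW ltM).
by rewrite -(subKr (rational_point i.1) y); apply: le_trans (ler_normB _ _) _; rewrite lerD2l.
Qed.

Lemma rational_point_dense x (e : R) : (0 < e)%R ->
  exists c, (`|rational_point c - x| < e)%R.
Proof.
move=> e0.
have H (j : 'I_k) : exists q : rat, (`|ratr q - x ord0 j| < e)%R.
  have /rat_in_itvoo[q] : (x ord0 j - e < x ord0 j + e)%R by lra.
  rewrite in_itv/= => /andP[? ?]; exists q.
  by rewrite ltr_norml; apply/andP; split; lra.
have [q Hq] := choice H; exists (\row_j q j).
rewrite [ltLHS]/Num.norm/= mx_normrE; apply/bigmax_ltP; split => //= -[i j] _.
by rewrite !mxE (ord1 i).
Qed.

Lemma rational_ball_cover x (m : nat) :
  exists c, rational_ball (c, m) x.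
Proof.
have [|c ?] := @rational_point_dense x (m.+1%:R^-1); last by exists c.
by rewrite invr_gt0 ltr0n.
Qed.

Lemma rational_ball_small (m : nat) x (e : R) (c : 'rV[rat]_k) : 
  (2 * m.+1%:R^-1 < e)%R -> rational_ball (c, m) x ->
  rational_cball (c, m) `<=` [set y | `|x - y| < e]%R.
Proof.
rewrite /rational_ball /rational_cball /= => me cx y /= cy.
have -> : (x - y = (rational_point c - y) - (rational_point c - x))%R.
  by rewrite opprB [RHS]addrC addrA subrK.
apply: le_lt_trans (ler_normB _ _) _; move: me cx cy; set u := (m.+1%:R^-1)%R; lra.
Qed.

Lemma small_radius (e : R) : (0 < e)%R -> exists m : nat, (2 * m.+1%:R^-1 < e)%R.
Proof.
move=> e0.
have e2 : (0 < e / 2)%R by lra.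
have [m me] := ltr_add_invr e2.
exists m; move: me; rewrite add0r; set u := (m.+1%:R^-1)%R; lra.
Qed.

Lemma rational_ball_basis x (e : R) : (0 < e)%R ->
  exists2 i, rational_ball i x & rational_cball i `<=` [set y | `|x - y| < e]%R.
Proof.
move=> /small_radius[m me]; have [c cx] := rational_ball_cover x m.
by exists (c, m) => //; exact: rational_ball_small.
Qed.

End rational_balls.

(** * Normal integrands: infima over balls and sublevel sets *)

(** Measurability of a closed-valued map, tested on compact sets.  Open
    sets being countable unions of compact balls, the test on open sets follows.
    The compact test is the one that is plainly preserved when the values are
    intersected with a fixed closed set. *)
Definition closed_measurable (Omega : Type) (R : realType) (k : nat)
    (G : set (set Omega)) (S : Omega -> set 'rV[R]_k) : Prop :=
  (forall w, closed (S w)) /\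
  (forall K : set 'rV[R]_k, compact K ->
     G [set w | exists x, S w x /\ K x]).

Definition inf_over (Omega : Type) (R : realType) (k : nat)
    (g : 'rV[R]_k -> Omega -> \bar R) (B : set 'rV[R]_k) (w : Omega) : \bar R :=
  ereal_inf [set g x w | x in B].

Lemma inf_over_lt (Omega : Type) (R : realType) (k : nat)
    (g : 'rV[R]_k -> Omega -> \bar R) B w (a : \bar R) :
  inf_over g B w < a <-> exists x, B x /\ g x w < a.
Proof.
split=> [/ereal_inf_lt[_ [x Bx <-] gxa]|[x [Bx gxa]]]; first by exists x.
by apply: le_lt_trans gxa; apply: ereal_inf_lbound; exists x.
Qed.

Lemma near_norm (R : realType) (k : nat) (x : 'rV[R]_k) (V : set 'rV[R]_k) :
  nbhs x V <-> exists2 e : R, (0 < e)%R & [set y | `|x - y| < e]%R `<=` V.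
Proof.
split=> [/nbhs_ballP[e /= e0 sub]|[e e0 sub]].
  by exists e => //; move: sub; rewrite -ball_normE.
by apply/nbhs_ballP; exists e => //=; rewrite -ball_normE.
Qed.

(** Lower semicontinuity at [x] in quantitative form: near [x], the values stay
    above all levels near [c]. *)
Lemma epigraph_separation (R : realType) (k : nat) (f : 'rV[R]_k -> \bar R)
    (x : 'rV[R]_k) (c : R) :
  closed (epigraph f) -> c%:E < f x -> exists2 e : R, (0 < e)%R &
    forall y b, (`|x - y| < e)%R -> (`|c - b| < e)%R -> b%:E < f y.
Proof.
move=> cf cx.
have : nbhs ((x, c) : 'rV[R]_k * R^o) (~` epigraph f).
  by apply: open_nbhs_nbhs; split; [rewrite openC|rewrite /= /epigraph /= leNgt cx].
move=> [[V1 V2] [/= /near_norm[e e0 V1x] V2c] sub].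
have /nbhs_ballP[e' /= e'0 V2c'] := V2c.
exists (Num.min e e'); first by rewrite lt_min e0.
move=> y b; rewrite !lt_min => /andP[xy _] /andP[_ cb]; rewrite ltNge; apply/negP.
by apply: (sub (y, b)); split => /=; [exact: V1x|exact: V2c'].
Qed.

Lemma epigraph_sublevel_closed (R : realType) (k : nat) (f : 'rV[R]_k -> \bar R)
    (c : R) : closed (epigraph f) -> closed [set x | f x <= c%:E].
Proof.
move=> cf.
have -> : [set x | f x <= c%:E] =
    (fun x => (x, c) : 'rV[R]_k * R^o) @^-1` epigraph f by [].
apply: preimage_closed cf => x _.
apply: (@cvg_pair _ _ _ (nbhs x) (nbhs x) (nbhs (c : R^o)) _ _ _ idfun
  (cst (c : R^o))) => //=; exact: cvg_cst.
Qed.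

Section normal_integrands.
Context d (Omega : measurableType d) (R : realType) (G : set (set Omega)).
Hypothesis sG : sigma_algebra setT G.

Section characterisations.
Context (k : nat).
Implicit Types (g : 'rV[R]_k -> Omega -> \bar R) (K B : set 'rV[R]_k).

(** The infimum over [B] is below [a] iff the epigraph meets the open cylinder
    over [B] below the level [a]. *)
Lemma normal_inf_over g B : normal_integrand G g -> open B ->
  measurable_wrt G (inf_over g B).
Proof.
move=> [_ Gg] oB; apply: measurable_wrt_lt => // a.
have -> : [set w | inf_over g B w < a%:E] =
    [set w | epigraph (g^~ w) `&` [set p : 'rV[R]_k * R^o | B p.1 /\ (p.2 < a)%R] !=set0].
  apply/seteqP; split=> w /=.
    move=> /inf_over_lt[x [Bx gxa]].
    have : exists b : R, g x w <= b%:E /\ (b < a)%R.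
      move: gxa; case: (g x w) => [r|//|_]; first by rewrite lte_fin => ?; exists r.
      by exists (a - 1)%R; rewrite leNye; split => //; lra.
    by move=> [b [? ?]]; exists (x, b).
  move=> [[x b] /= [gxb [Bx ba]]]; apply/inf_over_lt; exists x; split => //.
  by apply: le_lt_trans gxb _; rewrite lte_fin.
apply: Gg.
have -> : [set p : 'rV[R]_k * R^o | B p.1 /\ (p.2 < a)%R] =
    (fst @^-1` B) `&` (snd @^-1` [set b : R^o | (b < a)%R]) by [].
apply: openI.
  by apply: open_comp oB => p _; exact: cvg_fst.
apply: open_comp; first by move=> p _; exact: cvg_snd.
exact: open_lt.
Qed.

(** The practical criterion for normality.  Since epigraphs are closed upwards, an
    open set meets one iff it contains the product of a rational ball and a
    rational level above the infimum over that ball. *)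
Lemma normal_of_inf_over g : (forall w, closed (epigraph (g^~ w))) ->
  (forall i, measurable_wrt G (inf_over g (rational_ball i))) ->
  normal_integrand G g.
Proof.
move=> cg Gg; split=> // U oU.
have -> : [set w | epigraph (g^~ w) `&` U !=set0] = [set w |
    exists iq : ('rV[rat]_k * nat) * rat,
      (forall y, rational_ball iq.1 y -> U (y, ratr iq.2)) /\
      inf_over g (rational_ball iq.1) w < (ratr iq.2)%:E].
  apply/seteqP; split=> w /=.
    move=> [[x a] [/= gxa Uxa]].
    have : nbhs ((x, a) : 'rV[R]_k * R^o) U by exact: open_nbhs_nbhs.
    move=> [[V1 V2] [/= /near_norm[e e0 V1x] V2a] sub].
    have /nbhs_ballP[e' /= e'0 V2a'] := V2a.
    have [i xi iB] := rational_ball_basis x e0.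
    have /rat_in_itvoo[q] : (a < a + e')%R by lra.
    rewrite in_itv/= => /andP[aq qa].
    exists (i, q); split => /=.
      move=> y iy; apply: sub; split => /=; first exact/V1x/iB/rational_ball_cball.
      by apply: V2a'; rewrite /ball /= distrC ltr_norml; apply/andP; split; lra.
    by apply/inf_over_lt; exists x; split => //; apply: le_lt_trans gxa _; rewrite lte_fin.
  move=> [[i q] [/= iU /inf_over_lt[x [ix gxq]]]].
  by exists (x, ratr q); split; [exact: ltW|exact: iU].
apply: sa_exists => // -[i q]/=; apply: sa_and => //; first exact: sa_cst.
exact: (Gg i _ (@open_ereal_lt_ereal _ (ratr q)%:E)).
Qed.

(** By compactness, [K] meets the sublevel set at [a] iff for every [n] the
    open [1 / (n + 1)]-neighbourhood of [K] carries values below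
    [a + 1 / (n + 1)]. *)
Lemma normal_sublevel g (a : R) : normal_integrand G g ->
  closed_measurable G (fun w => [set x | g x w <= a%:E]).
Proof.
move=> ng; have cg := ng.1; split.
  by move=> w; exact: epigraph_sublevel_closed.
move=> K cK; pose Ke (e : R) : set 'rV[R]_k := [set y | exists x, K x /\ (`|x - y| < e)%R].
have oK e : open (Ke e).
  have -> : Ke e = \bigcup_(x in K) ball x e.
    by rewrite -ball_normE; apply/seteqP; split=> y [x]; [move=> [? ?]|move=> ? ?]; exists x.
  by apply: bigcup_open => x _; exact: ball_open.
have -> : [set w | exists x, g x w <= a%:E /\ K x] =
    [set w | forall n : nat, inf_over g (Ke n.+1%:R^-1%R) w < (a + n.+1%:R^-1)%:E].
  apply/seteqP; split=> w /=.
    move=> [x [gxa Kx]] n; apply/inf_over_lt; exists x; split.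
      by exists x; rewrite subrr normr0 invr_gt0 ltr0n.
    by apply: le_lt_trans gxa _; rewrite lte_fin ltrDl invr_gt0 ltr0n.
  move=> H; apply: contrapT => nK.
  have : \forall e \near (0:R)^'+, K `<=`
      (fun x => forall y, (`|x - y| < e)%R -> ~ g y w < (a + e)%:E).
    apply: (compact_near_coveringP K).1 => // x Kx.
    have agx : a%:E < g x w by rewrite ltNge; apply/negP => gxa; apply: nK; exists x.
    have [r r0 sep] := epigraph_separation (cg w) agx.
    exists ([set x' | (`|x - x'| < r / 2)%R], [set e | (0 < e < r / 2)%R]).
      split => /=.
        by apply/near_norm; exists (r / 2)%R => //; lra.
      near=> e; apply/andP; split; first by near: e; exact: nbhs_right_gt.
      by near: e; apply: nbhs_right_lt; lra.
    move=> [x' e] /= [xx' /andP[e0 er]] y x'y; apply/negP; rewrite -leNgt; apply/ltW/sep.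
      by rewrite -(subrKA x'); apply: le_lt_trans (ler_normD _ _) _; lra.
    by rewrite opprD addrA subrr sub0r normrN gtr0_norm //; lra.
  move=> [r /= r0 Hr]; have [n nr] := small_radius r0.
  have n0 : (0 < n.+1%:R^-1 :> R)%R by rewrite invr_gt0 ltr0n.
  have /inf_over_lt[y [[x [Kx xy]] gy]] := H n.
  apply: (Hr n.+1%:R^-1%R) xy gy => //=.
  by rewrite sub0r normrN gtr0_norm //; move: nr n0; set u := (n.+1%:R^-1)%R; lra.
apply: sa_forall => // n.
exact: (normal_inf_over ng (oK _) (@open_ereal_lt_ereal _ (a + _)%:E)).
Unshelve. all: by end_near.
Qed.
End characterisations.
End normal_integrands.

(** * Compositions with measurable maps *)

(** The finite intersection property for a chain of closed sets. *)
Lemma compact_chain (T : topologicalType) (I : Type) (J : set I) (D : I -> set T)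
    (K : set T) :
  compact K -> K !=set0 -> (forall i, J i -> closed (D i)) ->
  (forall i, J i -> exists x, D i x /\ K x) ->
  (forall i j, J i -> J j -> D i `<=` D j \/ D j `<=` D i) ->
  exists x, K x /\ forall i, J i -> D i x.
Proof.
move=> cK [x0 Kx0] cD DK tD.
have [[i0 Ji0]|J0] := pselect (exists i, J i); last first.
  by exists x0; split => // i Ji; exfalso; apply: J0; exists i.
pose F := filter_from J (fun i => K `&` D i).
have FF : ProperFilter F.
  apply: filter_from_proper; last by move=> i /DK[x [? ?]]; exists x.
  apply: filter_from_filter; first by exists i0.
  move=> i j Ji Jj; have [ij|ji] := tD _ _ Ji Jj.
    by exists i => // x [Kx Dx]; split; split => //; exact: ij.
  by exists j => // x [Kx Dx]; split; split => //; exact: ji.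
have [|x [Kx clx]] := cK F FF; first by exists i0 => // x [].
exists x; split=> // i Ji; apply: (cD i Ji) => B xB.
have [|y [[Ky Dy] By]] := clx (K `&` D i) B _ xB; first by exists i.
by exists y.
Qed.

Lemma row_norm_lt (R : realType) (k : nat) (x : 'rV[R]_k) (e : R) : (0 < e)%R ->
  (`|x| < e)%R <-> forall j, (`|x ord0 j| < e)%R.
Proof.
move=> e0; rewrite [ltLHS]/Num.norm/= mx_normrE; split.
  by move=> /bigmax_ltP[_ xe] j; exact: (xe (ord0, j)).
by move=> xe; apply/bigmax_ltP; split => //= -[i j] _ /=; rewrite (ord1 i).
Qed.

Lemma norm_row_mx_lt (R : realType) (k m : nat) (x : 'rV[R]_k) (y : 'rV[R]_m)
    (e : R) : (0 < e)%R ->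
  (`|row_mx x y| < e)%R <-> (`|x| < e)%R /\ (`|y| < e)%R.
Proof.
move=> e0; rewrite !row_norm_lt //; split=> [H|[xe ye] j].
  by split=> j; [have := H (lshift m j); rewrite row_mxEl|
    have := H (rshift k j); rewrite row_mxEr].
by rewrite -(splitK j); case: (fintype.split j) => i /=; rewrite ?row_mxEl ?row_mxEr.
Qed.

Lemma row_mx_continuous (R : realType) (k m : nat) :
  continuous (fun p : 'rV[R]_k * 'rV[R]_m => row_mx p.1 p.2).
Proof.
move=> [x y] V /= /near_norm[e e0 sub].
exists ([set x' | `|x - x'| < e]%R, [set y' | `|y - y'| < e]%R).
  by split; apply/near_norm; exists e.
move=> [x' y'] [/= xx yy]; apply: sub => /=.
by rewrite opp_row_mx add_row_mx; apply/norm_row_mx_lt.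
Qed.

Section composition.
Context d (Omega : measurableType d) (R : realType) (G : set (set Omega)).
Hypothesis sG : sigma_algebra setT G.

Lemma epigraph_closed (k : nat) (f : 'rV[R]_k -> \bar R) :
  (forall a : R, closed [set x | f x <= a%:E]) -> closed (epigraph f).
Proof.
move=> cf [x a] cl /=; apply/lee_addgt0Pr => e e0.
rewrite /= -EFinD; apply: (cf (a + e)%R) => V xV.
have [|[y b] [/= fyb [Vy ab]]] := cl (V `*` [set b : R^o | `|a - b| < e]%R).
  exists (V, [set b : R^o | `|a - b| < e]%R) => //; split => //=.
  by apply/nbhs_ballP; exists e.
exists y; split => //=; apply: le_trans fyb _; rewrite lee_fin.
by move: ab; rewrite /= ltr_norml => /andP[? ?]; lra.
Qed.

Lemma normal_of_sublevel (k : nat) (g : 'rV[R]_k -> Omega -> \bar R) :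
  (forall a : R, closed_measurable G (fun w => [set x | g x w <= a%:E])) ->
  normal_integrand G g.
Proof.
move=> sg; apply: normal_of_inf_over => //.
  by move=> w; apply: epigraph_closed => a; exact: (sg a).1.
move=> i; apply: measurable_wrt_lt => // a.
have -> : [set w | inf_over g (rational_ball i) w < a%:E] = [set w |
    exists jq : ('rV[rat]_k * nat) * rat,
      (rational_cball jq.1 `<=` @rational_ball R k i /\ ratr jq.2 < a)%R /\
      exists x, g x w <= (ratr jq.2)%:E /\ rational_cball jq.1 x].
  apply/seteqP; split=> w /=.
    move=> /inf_over_lt[x [xi gxa]].
    have /near_norm[e e0 sub] : nbhs x (@rational_ball R k i).
      by apply: open_nbhs_nbhs; split => //; exact: rational_ball_open.
    have [j xj jsub] := rational_ball_basis x e0.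
    have [q gq qa] : exists2 q : rat, g x w <= (ratr q)%:E & (ratr q < a)%R.
      move: gxa; case: (g x w) => [r|//|_].
        rewrite lte_fin => /rat_in_itvoo[q]; rewrite in_itv /= => /andP[rq qa].
        by exists q => //; rewrite lee_fin ltW.
      have /rat_in_itvoo[q] : (a - 1 < a)%R by lra.
      by rewrite in_itv /= => /andP[_ qa]; exists q => //; rewrite leNye.
    exists (j, q); split; first by split => //=; exact: subset_trans jsub sub.
    by exists x; split => //=; exact: rational_ball_cball.
  move=> [[j q] [/= [ji qa] [x [gxq jx]]]]; apply/inf_over_lt; exists x; split.
    exact: ji.
  by apply: le_lt_trans gxq _; rewrite lte_fin.
apply: sa_exists => // -[j q]/=; apply: sa_and => //; first exact: sa_cst.
exact: ((sg (ratr q)).2 _ (@rational_cball_compact R k j)).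
Qed.

(** For compact [K], the value at [w] of the new map meets [K] iff for every [n]
    the value of [S] meets the compact image under [phi] of [K] times a closed
    rational ball of radius [1 / (n + 1)] around [x w]. *)
Lemma closed_measurable_comp (k m j : nat) (S : Omega -> set 'rV[R]_k)
    (x : Omega -> 'rV[R]_j) (phi : 'rV[R]_j * 'rV[R]_m -> 'rV[R]_k) :
  closed_measurable G S -> measurable_wrt G x -> continuous phi ->
  closed_measurable G (fun w => [set y | S w (phi (x w, y))]).
Proof.
move=> [cS GS] Gx cphi; split.
  move=> w.
  apply: (@preimage_closed _ _ (fun y => phi (x w, y)) (S w)) (cS w) => y _.
  have xy : (x w, z) @[z --> y] --> (x w, y).
    apply: (@cvg_pair _ _ _ (nbhs y) (nbhs (x w)) (nbhs y) _ _ _ (cst (x w)) idfun) => //.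
    exact: cvg_cst.
  exact: (cvg_comp _ _ xy (cphi (x w, y))).
move=> K cK.
have -> : [set w | exists y, S w (phi (x w, y)) /\ K y] =
    [set w | forall n : nat, exists c, rational_ball (c, n) (x w) /\
      exists z, S w z /\ (phi @` (rational_cball (c, n) `*` K)) z].
  apply/seteqP; split=> w /=.
    move=> [y [Sy Ky]] n; have [c xc] := rational_ball_cover (x w) n.
    exists c; split => //; exists (phi (x w, y)); split => //; exists (x w, y) => //.
    by split => //=; exact: rational_ball_cball.
  move=> H; apply: contrapT => nK.
  have : \forall x' \near x w, K `<=` (fun y => ~ S w (phi (x', y))).
    apply: ((compact_near_coveringP K).1 cK _ (nbhs (x w))
      (fun x' y => ~ S w (phi (x', y)))) => y Ky.
    have : nbhs (phi (x w, y)) (~` S w).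
      apply: open_nbhs_nbhs; split; first by rewrite openC.
      by move=> Sy; apply: nK; exists y.
    move=> /(cphi (x w, y))[[V1 V2] /= [V1x V2y] sub].
    exists (V2, V1) => //= -[y' x'] /= [? ?].
    exact: (sub (x', y')).
  move=> /near_norm[e /small_radius[n ne] He].
  have [c [xc [z [Sz [[x' y] [/= x'c Ky] xyz]]]]] := H n.
  apply: (He x' _ y Ky); last by rewrite xyz.
  exact: (rational_ball_small ne xc).
apply: sa_forall => // n; apply: sa_exists => // c; apply: sa_and => //.
  by apply: Gx; exact: rational_ball_open.
apply: GS; apply: continuous_compact; first exact: continuous_subspaceT.
by apply: compact_setX => //; exact: rational_cball_compact.
Qed.

Lemma measurable_wrt_rational_cball (k : nat) (x : Omega -> 'rV[R]_k) :
  (forall i, G [set w | rational_cball i (x w)]) -> measurable_wrt G x.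
Proof.
move=> Gx U oU.
have -> : x @^-1` U = [set w | exists i,
    rational_cball i `<=` U /\ rational_cball i (x w)].
  apply/seteqP; split=> w /=.
    move=> Uxw; have /near_norm[e e0 sub] : nbhs (x w) U by exact: open_nbhs_nbhs.
    have [i xi isub] := rational_ball_basis (x w) e0.
    by exists i; split; [exact: subset_trans sub|exact: rational_ball_cball].
  by move=> [i [sub]]; exact: sub.
by apply: sa_exists => // i; apply: sa_and => //; exact: sa_cst.
Qed.

(** The case of [closed_measurable_comp] in which the second variable ranges
    over the zero-dimensional space. *)
Lemma normal_measurable (k : nat) (g : 'rV[R]_k -> Omega -> \bar R)
    (x : Omega -> 'rV[R]_k) :
  normal_integrand G g -> measurable_wrt G x ->
  measurable_wrt G (fun w => g (x w) w).
Proof.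
move=> ng Gx; apply: measurable_wrt_lt => // a.
have -> : [set w | g (x w) w < a%:E] = [set w | exists q : rat,
    (ratr q < a)%R /\ g (x w) w <= (ratr q)%:E].
  apply/seteqP; split=> w /=; last first.
    by move=> [q [qa]] /le_lt_trans; apply; rewrite lte_fin.
  case: (g (x w) w) => [r|//|_].
    rewrite lte_fin => /rat_in_itvoo[q]; rewrite in_itv /= => /andP[rq qa].
    by exists q; rewrite lee_fin ltW.
  have /rat_in_itvoo[q] : (a - 1 < a)%R by lra.
  by rewrite in_itv /= => /andP[_ qa]; exists q; rewrite leNye.
apply: sa_exists => // q; apply: sa_and => //; first exact: sa_cst.
have cfst : continuous (fst : 'rV[R]_k * 'rV[R]_0 -> 'rV[R]_k).
  by move=> p; exact: cvg_fst.
have [_ /(_ setT)] := closed_measurable_comp (normal_sublevel sG (ratr q) ng) Gx cfst.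
rewrite (_ : [set w | _] = [set w | g (x w) w <= (ratr q)%:E]).
  apply; apply: bounded_closed_compact; last exact: closedT.
  by exists 0%R; split => // M M0 y _; have -> : y = 0%R by [exact: thinmx0]; rewrite /= normr0 ltW.
apply/seteqP; split=> w /=; first by move=> [y []].
by exists 0%R.
Qed.

Lemma normal_partial (k m : nat) (g : 'rV[R]_(k + m) -> Omega -> \bar R)
    (x : Omega -> 'rV[R]_k) :
  normal_integrand G g -> measurable_wrt G x ->
  normal_integrand G (fun (y : 'rV[R]_m) w => g (row_mx (x w) y) w).
Proof.
move=> ng Gx; apply: normal_of_sublevel => a.
exact: (closed_measurable_comp (normal_sublevel sG a ng) Gx
  (@row_mx_continuous R k m)).
Qed.
End composition.

(** * Measurable selections and minimisers of least norm *)

Lemma sum_continuous (R : realType) (T : topologicalType) (I : finType)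
    (u : I -> T -> R) :
  (forall i, continuous (u i)) -> continuous (fun x => \sum_i u i x)%R.
Proof.
move=> cu; elim: (index_enum _) => [|i s IH] x.
  rewrite (_ : (fun _ => _) = cst 0%R); first by move=> V; exact: cst_continuous.
  by apply/funext => y; rewrite big_nil.
rewrite (_ : (fun _ => _) = (fun y => u i y + \sum_(j <- s) u j y)%R); last first.
  by apply/funext => y; rewrite big_cons.
exact: (continuousD (cu i x) (IH x)).
Qed.

Section selection.
Context d (Omega : measurableType d) (R : realType) (G : set (set Omega)).
Hypothesis sG : sigma_algebra setT G.
Context (k : nat).
Implicit Types S : Omega -> set 'rV[R]_k.

Definition enum_cball (n : nat) : set 'rV[R]_k :=
  rational_cball (odflt (0%R, 0%N) (unpickle n)).

Lemma enum_cball_pickle i : enum_cball (pickle i) = rational_cball i.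
Proof. by rewrite /enum_cball pickleK. Qed.

(** Successive intersection with the closed balls of an enumeration, skipping
    the balls that would make the value empty.  Every small ball around a
    surviving point is eventually used, so the intersection of all stages is a
    single point if [S w] is nonempty; no choice is involved, and so this point
    depends measurably on [w]. *)
Fixpoint refine S (n : nat) (w : Omega) : set 'rV[R]_k :=
  if n is n'.+1 then
    if `[< exists x, refine S n' w x /\ enum_cball n' x >]
    then refine S n' w `&` enum_cball n' else refine S n' w
  else S w.

Lemma closed_measurable_setI S (C : set 'rV[R]_k) : closed C ->
  closed_measurable G S -> closed_measurable G (fun w => S w `&` C).
Proof.
move=> cC [cS GS]; split; first by move=> w; exact: closedI.
move=> K cK.
have -> : [set w | exists x, (S w `&` C) x /\ K x] =
    [set w | exists x, S w x /\ (C `&` K) x].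
  by apply/seteqP; split=> w /= [x]; [move=> [[]]|move=> [? []]]; exists x.
by apply: GS; rewrite setIC; exact: compact_closedI.
Qed.

Lemma enum_cball_compact n : compact (enum_cball n).
Proof. exact: rational_cball_compact. Qed.

Lemma enum_cball_closed n : closed (enum_cball n).
Proof. by apply: compact_closed; [exact: norm_hausdorff|exact: enum_cball_compact]. Qed.

Lemma refine_measurable S n : closed_measurable G S ->
  closed_measurable G (refine S n).
Proof.
move=> mS; elim: n => [//|n [cS GS]].
split.
  by move=> w /=; case: asboolP => _ //; apply: closedI => //; exact: enum_cball_closed.
move=> K cK; have [_ GSC] := closed_measurable_setI (@enum_cball_closed n) (conj cS GS).
pose hit w := exists x, refine S n w x /\ enum_cball n x.
have -> : [set w | exists x, refine S n.+1 w x /\ K x] = [set w |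
    (hit w /\ exists x, (refine S n w `&` enum_cball n) x /\ K x) \/
    (~ hit w /\ exists x, refine S n w x /\ K x)].
  apply/seteqP; split=> w /=; case: asboolP => h.
  - by left.
  - by right.
  - by case=> [[]|[]].
  - by case=> [[]|[]].
have Ghit : G [set w | hit w] by apply: GS; exact: enum_cball_compact.
by apply: sa_or => //; apply: sa_and => //; [exact: GSC|exact: sa_not|exact: GS].
Qed.

Lemma refineS S n w : refine S n.+1 w `<=` refine S n w.
Proof. by move=> x /=; case: asboolP => // _ []. Qed.

Lemma refine_le S m n w : (m <= n)%N -> refine S n w `<=` refine S m w.
Proof.
elim: n => [|n IH]; first by rewrite leqn0 => /eqP ->.
rewrite leq_eqVlt => /orP[/eqP -> //|/IH{}IH].
exact: subset_trans (@refineS _ _ _) IH.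
Qed.

Lemma refine_hit S n w x : refine S n w x -> enum_cball n x ->
  refine S n.+1 w `<=` enum_cball n.
Proof.
by move=> Sx Cx y /=; case: asboolP => [_ []//|nh]; exfalso; apply: nh; exists x.
Qed.

Lemma refine_nonempty S n w : S w !=set0 -> refine S n w !=set0.
Proof.
by move=> S0; elim: n => [//|n IH] /=; case: asboolP.
Qed.

Definition refined S w : set 'rV[R]_k := [set x | forall n, refine S n w x].

Lemma refined_hit S w (K : set 'rV[R]_k) : (forall n, closed (refine S n w)) ->
  compact K -> (exists x, refined S w x /\ K x) <->
  (forall n, exists x, refine S n w x /\ K x).
Proof.
move=> cS cK; split=> [[x [Sx Kx]] n|H]; first by exists x.
have K0 : K !=set0 by have [x []] := H 0%N; exists x.
have [|x [Kx Sx]] :=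
    @compact_chain _ _ setT (fun n => refine S n w) K cK K0 (fun n _ => cS n) (fun n _ => H n).
  move=> m n _ _; have [/(@refine_le S)|/ltnW/(@refine_le S)] := leqP m n; by [right|left].
by exists x; split => // n; exact: Sx.
Qed.

Lemma refined_unique S w x y : refined S w x -> refined S w y -> x = y.
Proof.
move=> Sx Sy; apply: contrapT => /eqP; rewrite -subr_eq0 -normr_gt0 => e0.
have [i xi isub] := rational_ball_basis x e0.
suff : rational_cball i y by move=> /isub /=; rewrite ltxx.
rewrite -enum_cball_pickle.
apply: (refine_hit (Sx (pickle i))) (Sy (pickle i).+1).
by rewrite enum_cball_pickle; exact: rational_ball_cball.
Qed.

(** Some ball of the enumeration is hit at some stage, since otherwise nothing
    would ever be removed; from then on the values are compact. *)
Lemma refined_nonempty S w : closed_measurable G S -> S w !=set0 ->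
  refined S w !=set0.
Proof.
move=> mS S0.
have [m [x [Sx Cx]]] : exists n, exists x, refine S n w x /\ enum_cball n x.
  apply: contrapT => nh.
  have SE n : refine S n w = S w.
    by elim: n => [//|n IH] /=; case: asboolP => // h; exfalso; apply: nh; exists n.
  have [x Sx] := S0; have [i xi _] := rational_ball_basis x ltr01.
  apply: nh; exists (pickle i); exists x; rewrite SE enum_cball_pickle; split => //.
  exact: rational_ball_cball.
suff [y [Sy _]] : exists y, refined S w y /\ enum_cball m y by exists y.
apply/refined_hit; first by move=> n; exact: (refine_measurable n mS).1.
  exact: enum_cball_compact.
move=> n; have [mn|nm] := leqP m.+1 n; last first.
  have [y Sy] := refine_nonempty m.+1 S0.
  exists y; split; first by apply: refine_le Sy; exact: ltnW.
  exact: refine_hit Sx Cx _ Sy.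
have [y Sy] := refine_nonempty n S0; exists y; split => //.
exact: refine_hit Sx Cx _ (refine_le mn Sy).
Qed.

Lemma measurable_selection S : closed_measurable G S ->
  exists x : Omega -> 'rV[R]_k, measurable_wrt G x /\
    forall w, S w !=set0 -> S w (x w).
Proof.
(* The set [refined S w] has at most one element; it is empty when [S w] is, and
   then the value is the default [0]. *)
move=> mS; exists (fun w => xget 0%R (refined S w)); split; last first.
  move=> w /(refined_nonempty mS) [y Sy].
  by have /(_ 0%N) := xgetPex 0%R (ex_intro _ y Sy : exists y, refined S w y).
apply: measurable_wrt_rational_cball => // i.
have cR w n : closed (refine S n w) by exact: (refine_measurable n mS).1.
have -> : [set w | rational_cball i (xget 0%R (refined S w))] = [set w |
    (forall n, exists x, refine S n w x /\ rational_cball i x) \/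
    ((~ exists j, exists x, S w x /\ rational_cball j x) /\ @rational_cball R k i 0%R)].
  have ci := @rational_cball_compact R k i.
  apply/seteqP; split=> w /=.
    case: xgetP => [x _ Sx|S0] ix.
      by left; apply/(refined_hit (cR w)) => //; exists x.
    right; split => // -[j [x [Sx _]]].
    by have [] := @refined_nonempty S w mS; [exists x|exact: S0].
  move=> [/(refined_hit (cR w) ci)[x [Sx ix]]|[nS i0]].
    by have <- : x = xget 0%R (refined S w) by apply: (refined_unique Sx); exact: (xgetPex 0%R (ex_intro _ x Sx)).
  case: xgetP => [x _ Sx|//]; exfalso; apply: nS.
  have [j xj _] := rational_ball_basis x ltr01.
  by exists j, x; split; [exact: (Sx 0%N)|exact: rational_ball_cball].
apply: sa_or => //.
  by apply: sa_forall => // n; apply: (refine_measurable n mS).2; exact: rational_cball_compact.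
apply: sa_and => //; last exact: sa_cst.
apply: sa_not => //; apply: sa_exists => // j.
by apply: mS.2; exact: rational_cball_compact.
Qed.

Lemma closed_sublevel_ereal (f : 'rV[R]_k -> \bar R) (c : \bar R) :
  (forall a : R, closed [set x | f x <= a%:E]) -> closed [set x | f x <= c].
Proof.
move=> cf; case: c => [r| |] //.
  by rewrite (_ : [set _ | _] = setT); [exact: closedT|apply/seteqP; split=> x //= _; rewrite leey].
have -> : [set x | f x <= -oo] = \bigcap_(r in [set: R]) [set x | f x <= r%:E].
  apply/seteqP; split=> x /=; first by rewrite leeNy_eq => /eqP fx r _ /=; rewrite fx leNye.
  move=> H; have {}H (r : R) : f x <= r%:E by exact: H.
  move: H; case: (f x) => [r|/(_ 0%R)|//]; last by rewrite leye_eq.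
  by move=> /(_ (r - 1)%R); rewrite lee_fin => h; exfalso; lra.
by apply: closed_bigI => r _; exact: cf.
Qed.

(** A compact [K] contains a minimiser iff it meets every nonempty sublevel set
    at a rational level. *)
Lemma argmin_measurable (g : 'rV[R]_k -> Omega -> \bar R) :
  (forall a : R, closed_measurable G (fun w => [set x | g x w <= a%:E])) ->
  closed_measurable G (fun w => argmin (g^~ w)).
Proof.
move=> mg; have cg w c : closed [set x | g x w <= c].
  by apply: closed_sublevel_ereal => a; exact: (mg a).1.
split.
  move=> w; have -> : argmin (g^~ w) = \bigcap_(z in setT) [set x | g x w <= g z w].
    by apply/seteqP; split=> x H z; [move=> _|]; exact: H.
  by apply: closed_bigI => z _; exact: cg.
move=> K cK.
have -> : [set w | exists x, argmin (g^~ w) x /\ K x] = [set w |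
    (exists x, K x) /\ forall q : rat,
      (exists i x, g x w <= (ratr q)%:E /\ rational_cball i x) ->
      exists x, g x w <= (ratr q)%:E /\ K x].
  apply/seteqP; split=> w /=.
    move=> [x [mx Kx]]; split; first by exists x.
    by move=> q [_ [z [zq _]]]; exists x; split => //; exact: le_trans (mx z) zq.
  move=> [K0 H].
  pose J := [set q : rat | exists z, g z w <= (ratr q)%:E].
  have [|||x [Kx xq]] := @compact_chain _ _ J (fun q => [set x | g x w <= (ratr q)%:E]) K cK K0.
  - by move=> q _; exact: cg.
  - move=> q [z zq]; apply: H; have [i iz _] := rational_ball_basis z ltr01.
    by exists i, z; split => //; exact: rational_ball_cball.
  - move=> p q _ _; have [pq|/ltW qp] := leP p q; [left|right] => z /= zp;
      by apply: le_trans zp _; rewrite lee_fin ler_rat.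
  exists x; split => // z; apply: contrapT => /negP; rewrite -ltNge => zx.
  have [q zq qx] : exists2 q : rat, g z w <= (ratr q)%:E & (ratr q)%:E < g x w.
    move: zx; case: (g z w) => [r| |]; case: (g x w) => [s| |] //.
    - by rewrite lte_fin => /rat_in_itvoo[q]; rewrite in_itv/= => /andP[? ?]; exists q; rewrite ?lee_fin ?lte_fin ?ltW.
    - have /rat_in_itvoo[q] : (r < r + 1)%R by lra.
      by rewrite in_itv/= => /andP[? ?]; exists q; rewrite ?lee_fin ?ltW // ltry.
    - have /rat_in_itvoo[q] : (s - 1 < s)%R by lra.
      by rewrite in_itv/= => /andP[? ?]; exists q; rewrite ?lte_fin ?leNye.
    - by exists 0%R; rewrite ?leNye ?ltry.
  by have := xq q (ex_intro _ z zq); rewrite /= leNgt qx.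
apply: sa_and => //; first exact: sa_cst.
apply: sa_forall => // q; apply: sa_imp => //; last exact: (mg _).2.
by apply: sa_exists => // i; apply: (mg _).2; exact: rational_cball_compact.
Qed.

(** The Euclidean norm is needed for orthogonality; the norm of the library on
    row vectors is the maximum norm. *)
Definition sqnorm (x : 'rV[R]_k) : R := \sum_j (x ord0 j) ^+ 2.

Lemma sqnorm_continuous : continuous sqnorm.
Proof.
apply: sum_continuous => j x.
have cj : {for x, continuous (fun y : 'rV[R]_k => y ord0 j)} by exact: coord_continuous.
exact: (continuousM cj cj).
Qed.

Lemma sqnorm_closed (a : R) : closed [set x | (sqnorm x <= a)%R].
Proof.
apply: (@preimage_closed _ _ sqnorm [set b | (b <= a)%R]) (@closed_le _ a) => x _.
exact: sqnorm_continuous.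
Qed.

Lemma sqnorm_compact (a : R) : compact [set x | (sqnorm x <= a)%R].
Proof.
apply: bounded_closed_compact; last exact: sqnorm_closed.
exists (Num.sqrt a); split; first by rewrite num_real.
move=> M aM x /= xa.
have M0 : (0 < M)%R by apply: le_lt_trans aM; exact: sqrtr_ge0.
rewrite /Num.norm/= mx_normrE; apply/bigmax_leP; split => /=; first exact: ltW.
move=> [i j] _ /=; rewrite (ord1 i); apply: le_trans (ltW aM).
rewrite -sqrtr_sqr ler_wsqrtr//; apply: le_trans xa.
by rewrite /sqnorm (bigD1 j) //= lerDl sumr_ge0 // => l _; exact: sqr_ge0.
Qed.

Lemma closed_has_min_sqnorm (A : set 'rV[R]_k) : closed A -> A !=set0 ->
  exists x, A x /\ forall y, A y -> (sqnorm x <= sqnorm y)%R.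
Proof.
move=> cA [x0 Ax0]; pose K := A `&` [set y | (sqnorm y <= sqnorm x0)%R].
have cK : compact K.
  by rewrite /K setIC; apply: compact_closedI => //; exact: sqnorm_compact.
have [||||x [[Ax xx0] mx]] := @compact_chain _ _ K (fun y => [set z | (sqnorm z <= sqnorm y)%R]) K cK.
- by exists x0; split => //=.
- by move=> y _; exact: sqnorm_closed.
- by move=> y Ky; exists y; split => //=.
- move=> y z _ _; have [h|/ltW h] := leP (sqnorm y) (sqnorm z); [left|right] => u /= uy;
    exact: le_trans uy h.
exists x; split => // y Ay; have [h|/ltW h] := leP (sqnorm y) (sqnorm x0); first exact: mx.
exact: le_trans xx0 h.
Qed.

(** The minimisers of least norm are again the minimisers of a normal integrand:
    the squared norm, with value [+oo] outside of the set of minimisers. *)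
Lemma min_norm_argmin_selection (g : 'rV[R]_k -> Omega -> \bar R) :
  normal_integrand G g ->
  exists x : Omega -> 'rV[R]_k, measurable_wrt G x /\
    forall w, argmin (g^~ w) !=set0 -> argmin (g^~ w) (x w) /\
      forall y, argmin (g^~ w) y -> (sqnorm (x w) <= sqnorm y)%R.
Proof.
move=> ng; have mS : closed_measurable G (fun w => argmin (g^~ w)).
  by apply: argmin_measurable => a; exact: normal_sublevel.
pose f (y : 'rV[R]_k) (w : Omega) : \bar R :=
  if `[< argmin (g^~ w) y >] then (sqnorm y)%:E else +oo.
have mf a : closed_measurable G (fun w => [set x | f x w <= a%:E]).
  rewrite (_ : (fun w => _) = fun w => argmin (g^~ w) `&` [set x | (sqnorm x <= a)%R]).
    by apply: closed_measurable_setI => //; exact: sqnorm_closed.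
  apply/funext => w; apply/seteqP; split=> y /=; rewrite /f; case: asboolP => my.
  - by rewrite lee_fin.
  - by rewrite leye_eq.
  - by move=> [_]; rewrite lee_fin.
  - by case.
have [x [Gx xP]] := measurable_selection (argmin_measurable mf).
exists x; split => // w S0.
have [z [Sz zmin]] := closed_has_min_sqnorm (mS.1 w) S0.
have fz : argmin (f^~ w) z.
  move=> y; rewrite /f; case: asboolP => // _; case: asboolP => Sy; last exact: leey.
  by rewrite lee_fin; exact: zmin.
have fx := xP w (ex_intro _ z fz).
have Sx : argmin (g^~ w) (x w).
  by have := fx z; rewrite /f (asboolT Sz); case: asboolP => // _; rewrite leye_eq.
split => // y Sy; have := fx y.
by rewrite /f (asboolT Sx) (asboolT Sy) lee_fin.
Qed.

End selection.

(** * Conditional expectations of nonnegative functions *)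

Section bounded_conditional_expectation.
Context d (Omega : measurableType d) (R : realType) (P : probability Omega R).
Context (G : set (set Omega)).
Hypothesis sG : sigma_algebra setT G.
Hypothesis GM : G `<=` @measurable d Omega.
Local Notation OmegaG := (g_sigma_algebraType G).
Implicit Types X Y : Omega -> \bar R.

(** The Radon-Nikodym theorem on the measurable space [g_sigma_algebraType G],
    for the restriction of [P] and the measure with density [X]. *)
Lemma condexp_bounded X : measurable_fun setT X ->
  (forall w, 0 <= X w <= 1) -> exists Y, is_condexp_ge0 P G X Y.
Proof.
move=> mX X01; have X0 w : 0 <= X w by case/andP: (X01 w).
have mG (A : set OmegaG) : measurable A -> @measurable d Omega A.
  by rewrite (measurable_subE sG); exact: GM.
pose PG (A : set OmegaG) : \bar R := P (A : set Omega).
have PG0 : PG set0 = 0 by exact: (measure0 P).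
have PG_ge0 A : 0 <= PG A by exact: measure_ge0.
have PGs : semi_sigma_additive PG.
  move=> F mF tF mUF; apply: (@measure_semi_sigma_additive _ _ _ P) => //.
    by move=> i; apply: mG; exact: mF.
  by apply: mG; exact: mUF.
have PGf : fin_num_fun PG by move=> A mA; apply: fin_num_measure; exact: mG.
pose mu0 : {measure set OmegaG -> \bar R} :=
  HB.pack PG (isMeasure.Build _ _ _ PG PG0 PG_ge0 PGs).
pose mu : {finite_measure set OmegaG -> \bar R} :=
  HB.pack PG (isMeasure.Build _ _ _ PG PG0 PG_ge0 PGs)
    (Measure_isFinite.Build _ _ _ mu0 PGf).
pose N (A : set OmegaG) : \bar R := \int[P]_(w in (A : set Omega)) X w.
have N0 : N set0 = 0 by exact: integral_set0.
have N_ge0 A : 0 <= N A by exact: integral_ge0.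
have Ns : semi_sigma_additive N.
  move=> F mF tF mUF; apply: (@semi_sigma_additive_nng_induced _ _ _ P X) => //.
    by move=> i; apply: mG; exact: mF.
  by apply: mG; exact: mUF.
have Nf : fin_num_fun N.
  move=> A /mG mA; rewrite ge0_fin_numE //.
  apply: (@le_lt_trans _ _ (\int[P]_(w in (A : set Omega)) 1)).
    by apply: ge0_le_integral => //; [exact: measurable_funTS|move=> w _; case/andP: (X01 w)].
  rewrite integral_cst // mul1e; apply: le_lt_trans (ltry 1).
  exact: probability_le1.
pose nu0 : {measure set OmegaG -> \bar R} :=
  HB.pack N (isMeasure.Build _ _ _ N N0 N_ge0 Ns).
pose nu : {finite_measure set OmegaG -> \bar R} :=
  HB.pack N (isMeasure.Build _ _ _ N N0 N_ge0 Ns)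
    (Measure_isFinite.Build _ _ _ nu0 Nf).
have numu : nu `<< mu.
  apply/null_content_dominatesP => A mA A0.
  apply: null_set_integral => //; [exact: mG|exact: measurable_funTS].
have [f [f0 /measurable_int mf fE]] := radon_nikodym_finite numu.
exists f; split => //; first exact/(measurable_wrtE sG).
move=> A GA; have mA : @measurable _ OmegaG A by rewrite (measurable_subE sG).
have <- : nu A = \int[P]_(w in A) X w by [].
have mid : measurable_fun setT (id : Omega -> OmegaG).
  by move=> _ B mB; rewrite setTI; exact: mG.
rewrite fE //; apply/esym; apply: (ge0_integral_pushforward mid) => //.
exact: measurable_funTS.
Qed.

End bounded_conditional_expectation.

Lemma ae_forall_countable d (Omega : measurableType d) (R : realType)
    (P : {measure set Omega -> \bar R}) (I : countType) (A : I -> Omega -> Prop) :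
  (forall i, \forall w \ae P, A i w) -> \forall w \ae P, forall i, A i w.
Proof.
move=> PA.
have /ae_foralln : forall n, \forall w \ae P,
    if unpickle n is Some i then A i w else True.
  by move=> n; case: unpickle => [i|]; [exact: PA|exact: nearW].
apply: filterS => w Aw i; have := Aw (pickle i).
by rewrite pickleK.
Qed.

Section nonnegative_conditional_expectation.
Context d (Omega : measurableType d) (R : realType) (P : probability Omega R).
Context (G : set (set Omega)).
Hypothesis sG : sigma_algebra setT G.
Hypothesis GM : G `<=` @measurable d Omega.
Implicit Types X Y : Omega -> \bar R.

(** This telescoping sum writes a nonnegative function, possibly with infinite
    values or not integrable, as a series of functions with values in [0, 1]. *)
Lemma sum_truncation_increments (x : \bar R) : 0 <= x ->
  \sum_(k <oo) (mine x k.+1%:R%:E - mine x k%:R%:E) = x.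
Proof.
move=> x0; pose f (k : nat) := mine x k%:R%:E.
have f0 k : 0 <= f k by rewrite /f le_min x0 lee_fin ler0n.
have ff k : f k \is a fin_num.
  by rewrite ge0_fin_numE // /f gt_min ltry orbT.
have -> : (fun n => \sum_(0 <= k < n) (f k.+1 - f k)) = f.
  apply/funext; elim => [|n IH]; first by rewrite big_geq // /f min_r.
  by rewrite big_nat_recr //= IH addeC subeK.
have fx k : f k <= x by rewrite /f ge_min lexx.
have nf : nondecreasing_seq f.
  by move=> m n mn; rewrite /f le_min ge_min lexx /= ge_min lee_fin ler_nat mn orbT.
apply/cvg_lim => //; rewrite [X in _ --> X](_ : x = ereal_sup (range f)).
  exact: ereal_nondecreasing_cvgn.
apply/eqP; rewrite eq_le; apply/andP; split; last first.
  by apply: ge_ereal_sup => _ [n _ <-].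
case: x x0 @f {f0 ff fx nf} => [r| |//] r0 f.
  apply: ereal_sup_ubound; exists (Num.truncn r).+1 => //.
  by rewrite /f min_l // lee_fin ltW // truncnS_gt.
rewrite leye_eq; apply/eqP/eq_infty => M.
apply: (@le_trans _ _ (f (Num.truncn M).+1)).
  by rewrite /f min_r ?leey // lee_fin ltW // truncnS_gt.
by apply: ereal_sup_ubound; exists (Num.truncn M).+1.
Qed.

Lemma condexp_ge0_exists X : measurable_fun setT X -> (forall w, 0 <= X w) ->
  exists Y, is_condexp_ge0 P G X Y.
Proof.
move=> mX X0.
(* Each increment has values in [0, 1], where the bounded case applies. *)
pose D (k : nat) w := mine (X w) k.+1%:R%:E - mine (X w) k%:R%:E.
have mD k : measurable_fun setT (D k).
  by apply: emeasurable_funB; apply: measurable_mine.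
have D01 k w : 0 <= D k w <= 1.
  rewrite /D; case: (X w) (X0 w) => [r| |//] r0; last first.
    rewrite !min_r ?leey // -EFinB lee_fin -(natr1 k) [(_ + 1)%R]addrC addrK.
    by rewrite ler01 lexx.
  rewrite -!EFin_min -EFinB !lee_fin -(natr1 k).
  have [?|?] := leP r (k%:R)%R; have [?|?] := leP r (k%:R + 1)%R; apply/andP; split; lra.
have [Yk YkP] := choice (fun k => @condexp_bounded _ _ _ P _ sG GM _ (mD k) (D01 k)).
have XE w : X w = \sum_(k <oo) D k w by rewrite sum_truncation_increments.
have Yk0 k w : 0 <= Yk k w by have [+ _ _] := YkP k.
have mYk k : measurable_wrt G (Yk k) by have [_ + _] := YkP k.
exists (fun w => \sum_(k <oo) Yk k w); split.
- by move=> w; apply: nneseries_ge0.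
- apply/(measurable_wrtE sG).
  by apply: ge0_emeasurable_sum => // k _; exact/(measurable_wrtE sG).
- move=> A GA; have mA := GM GA.
  rewrite integral_nneseries //; last first.
    by move=> k; apply/measurable_funTS/(measurable_wrt_measurable sG GM)/mYk.
  under [RHS]eq_integral do rewrite XE.
  rewrite integral_nneseries //.
  + by apply: eq_eseriesr => k _; have [_ _ ->] := YkP k.
  + by move=> k; exact: measurable_funTS.
  + by move=> k w _; case/andP: (D01 k w).
Qed.

(** On the part of [B] where [Y' <= q < q' <= Y], integration gives
    [q' P <= q P]; so that part is null for all rational [q < q']. *)
Lemma condexp_ge0_le X X' Y Y' (B : set Omega) :
  measurable_fun setT X -> (forall w, 0 <= X w) ->
  measurable_fun setT X' -> (forall w, 0 <= X' w) ->
  is_condexp_ge0 P G X Y -> is_condexp_ge0 P G X' Y' -> G B ->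
  (\forall w \ae P, B w -> X w <= X' w) -> \forall w \ae P, B w -> Y w <= Y' w.
Proof.
move=> mX X0 mX' X'0 [Y0 mY YE] [Y'0 mY' Y'E] GB XX'.
pose A (q : rat * rat) := [set w | B w /\ (Y' w <= (ratr q.1)%:E /\ (ratr q.2)%:E <= Y w)].
have GA q : G (A q).
  apply: sa_and => //; apply: sa_and => //.
    apply: (measurable_wrt_set sG (B := [set x | x <= (ratr q.1)%:E]) mY').
    by rewrite -set_itvNyc; exact: emeasurable_itv.
  apply: (measurable_wrt_set sG (B := [set x | (ratr q.2)%:E <= x]) mY).
  by rewrite -set_itvcy; exact: emeasurable_itv.
have PA (q : rat * rat) : \forall w \ae P, (0 <= q.1)%R -> (q.1 < q.2)%R -> ~ A q w.
  have [q0|_] := boolP (0 <= q.1)%R; last exact: nearW.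
  have [q12|_] := boolP (q.1 < q.2)%R; last exact: nearW.
  have mA := GM (GA q).
  have mT (Z : Omega -> \bar R) : measurable_fun setT Z -> measurable_fun (A q) Z by exact: measurable_funTS.
  have mYT := measurable_wrt_measurable sG GM mY.
  have mYT' := measurable_wrt_measurable sG GM mY'.
  have : (ratr q.2)%:E * P (A q) <= (ratr q.1)%:E * P (A q).
    rewrite -!integral_cst //; apply: (@le_trans _ _ (\int[P]_(w in A q) Y w)).
      apply: ge0_le_integral => //; [|exact: mT|by move=> w [_ []]].
      by move=> w _; rewrite lee_fin ler0q (le_trans q0 (ltW q12)).
    apply: (@le_trans _ _ (\int[P]_(w in A q) Y' w)); last first.
      by apply: ge0_le_integral => //; [exact: mT|move=> w [_ []]].
    rewrite YE // Y'E //; apply: ae_ge0_le_integral => //; [exact: mT|exact: mT|].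
    by apply: filterS XX' => w H [Bw _]; exact: H.
  have fP : P (A q) \is a fin_num by exact: fin_num_measure.
  have P0 : 0 <= P (A q) by exact: measure_ge0.
  move=> PAq; have PA0 : P (A q) = 0.
    move: PAq P0; rewrite -(fineK fP) -!EFinM !lee_fin => h h0.
    congr EFin; have : (ratr q.1 < ratr q.2 :> R)%R by rewrite ltr_rat.
    by nra.
  by exists (A q); split => // w /= /not_implyP[_ /not_implyP[_ /contrapT]].
have := ae_forall_countable PA.
apply: filterS => w H Bw; apply: contrapT => /negP; rewrite -ltNge => YY.
have [q [q0 qY qY']] : exists q : rat * rat, [/\ (0 <= q.1 < q.2)%R,
    Y' w <= (ratr q.1)%:E & (ratr q.2)%:E <= Y w].
  have Y'f : Y' w \is a fin_num by rewrite ge0_fin_numE // (lt_le_trans YY) ?leey.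
  have [s sY' sY] : exists2 s : R, (fine (Y' w) < s)%R & s%:E <= Y w.
    move: YY Y'f; case: (Y' w) => [r| |] //=; case: (Y w) => [s| |] //.
      by rewrite lte_fin => rs _; exists s.
    by move=> _ _; exists (r + 1)%R; rewrite ?leey //; lra.
  have [q + qs] : exists2 q : rat, (fine (Y' w) < ratr q)%R & (ratr q < s)%R.
    by have /rat_in_itvoo[q] := sY'; rewrite in_itv /= => /andP[? ?]; exists q.
  move=> /[dup] Y'q /rat_in_itvoo[p]; rewrite in_itv /= => /andP[Y'p pq].
  exists (p, q); split => /=.
  - rewrite -(ler_rat R) -(ltr_rat R) pq andbT rmorph0.
    by apply: le_trans (ltW Y'p); exact: fine_ge0.
  - by rewrite -(fineK Y'f) lee_fin ltW.
  - by apply: le_trans sY; rewrite lee_fin ltW.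
by case/andP: q0 => ? ?; apply: (H q).
Qed.

Lemma condexp_ge0_unique X X' Y Y' :
  measurable_fun setT X -> (forall w, 0 <= X w) ->
  measurable_fun setT X' -> (forall w, 0 <= X' w) ->
  is_condexp_ge0 P G X Y -> is_condexp_ge0 P G X' Y' ->
  (\forall w \ae P, X w = X' w) -> \forall w \ae P, Y w = Y' w.
Proof.
move=> mX X0 mX' X'0 cY cY' XX'.
have GT : G setT by exact: (sa_cst sG True).
have l1 : \forall w \ae P, setT w -> Y w <= Y' w.
  by apply: condexp_ge0_le cY cY' _ _ => //; apply: filterS XX' => w ->.
have l2 : \forall w \ae P, setT w -> Y' w <= Y w.
  by apply: condexp_ge0_le cY' cY _ _ => //; apply: filterS XX' => w ->.
near=> w; apply/eqP; rewrite eq_le; apply/andP; split; near: w.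
  by apply: filterS l1 => w; exact.
by apply: filterS l2 => w; exact.
Unshelve. all: by end_near.
Qed.

Lemma condexp_ge0D X X' Y Y' :
  measurable_fun setT X -> (forall w, 0 <= X w) ->
  measurable_fun setT X' -> (forall w, 0 <= X' w) ->
  is_condexp_ge0 P G X Y -> is_condexp_ge0 P G X' Y' ->
  is_condexp_ge0 P G (fun w => X w + X' w) (fun w => Y w + Y' w).
Proof.
move=> mX X0 mX' X'0 [Y0 mY YE] [Y'0 mY' Y'E]; split.
- by move=> w; rewrite adde_ge0 ?Y0 ?Y'0.
- by apply/(measurable_wrtE sG)/emeasurable_funD; exact/(measurable_wrtE sG).
- move=> A GA; have mA := GM GA.
  have mYT := measurable_wrt_measurable sG GM mY.
  have mYT' := measurable_wrt_measurable sG GM mY'.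
  by rewrite !ge0_integralD ?YE ?Y'E //; exact: measurable_funTS.
Qed.

Lemma condexp_ge0Z X Y (a : R) : (0 <= a)%R ->
  measurable_fun setT X -> (forall w, 0 <= X w) ->
  is_condexp_ge0 P G X Y ->
  is_condexp_ge0 P G (fun w => a%:E * X w) (fun w => a%:E * Y w).
Proof.
move=> a0 mX X0 [Y0 mY YE]; split.
- by move=> w; rewrite mule_ge0 ?lee_fin.
- by apply/(measurable_wrtE sG)/measurable_funeM; exact/(measurable_wrtE sG).
- move=> A GA; have mA := GM GA.
  have mYT := measurable_wrt_measurable sG GM mY.
  by rewrite !ge0_integralZl ?YE //; exact: measurable_funTS.
Qed.

Lemma condexp_ge0_integrable X Y :
  P.-integrable setT X -> (forall w, 0 <= X w) -> is_condexp_ge0 P G X Y ->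
  P.-integrable setT Y.
Proof.
move=> /integrableP[mX Xfin] X0 [Y0 mY YE]; apply/integrableP; split.
  exact: (measurable_wrt_measurable sG GM mY).
under eq_integral do rewrite gee0_abs //.
rewrite YE; last exact: (sa_cst sG True).
by move: Xfin; under eq_integral do rewrite gee0_abs //.
Qed.

End nonnegative_conditional_expectation.

(** * Conditional expectations of nonnegative integrands *)

Lemma measurable_wrt_le (Omega : Type) (X : topologicalType)
    (G G' : set (set Omega)) (f : Omega -> X) :
  G `<=` G' -> measurable_wrt G f -> measurable_wrt G' f.
Proof. by move=> GG' mf U oU; apply: GG'; exact: mf. Qed.

Lemma limn_einf_sup_einfs (R : realType) (u : (\bar R)^nat) :
  limn_einf u = ereal_sup (range (einfs u)).
Proof. by rewrite limn_einf_lim; apply/cvg_lim => //; exact: cvg_einfs_sup. Qed.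

Section nonnegative_integrand.
Context d (Omega : measurableType d) (R : realType) (P : probability Omega R).
Context (G : set (set Omega)) (k : nat).
Hypothesis sG : sigma_algebra setT G.
Hypothesis GM : G `<=` @measurable d Omega.
Let sM : sigma_algebra setT (@measurable d Omega) := @sigma_algebra_measurable d Omega.

Section supremum_over_balls.
Variable J : ('rV[rat]_k * nat) -> Omega -> \bar R.
Hypothesis J0 : forall i w, 0 <= J i w.
Hypothesis mJ : forall i, measurable_wrt G (J i).

(** Each function that equals [J i w] on the open ball [i] and [0] elsewhere is
    lower semicontinuous because [J] is nonnegative, hence so is their
    supremum, whatever the family [J]. *)
Definition sup_over_balls (x : 'rV[R]_k) (w : Omega) : \bar R :=
  ereal_sup [set J i w | i in [set i | rational_ball i x]].

Lemma sup_over_balls_gt x w (a : \bar R) :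
  a < sup_over_balls x w <-> exists i, rational_ball i x /\ a < J i w.
Proof.
split=> [/ereal_sup_gt[_ [i ix <-] aJ]|[i [ix aJ]]]; first by exists i.
by apply: lt_le_trans aJ _; apply: ereal_sup_ubound; exists i.
Qed.

Lemma sup_over_balls_ge0 x w : 0 <= sup_over_balls x w.
Proof.
have [i ix _] := rational_ball_basis x ltr01.
by apply: le_trans (J0 i w) _; apply: ereal_sup_ubound; exists i.
Qed.

(** A compact [K] misses the sublevel set at [a] iff finitely many balls with
    [J] above [a] cover it, and there are countably many finite sets of rational
    balls. *)
Lemma sup_over_balls_normal : normal_integrand G sup_over_balls.
Proof.
apply: normal_of_sublevel => // a; split.
  move=> w; rewrite -openC.
  have -> : ~` [set x | sup_over_balls x w <= a%:E] =
      \bigcup_(i in [set i | a%:E < J i w]) rational_ball i.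
    apply/seteqP; split=> x /=.
      by move=> /negP; rewrite -ltNge => /sup_over_balls_gt[i [? ?]]; exists i.
    move=> [i /= aJ ix]; apply/negP; rewrite -ltNge.
    by apply/sup_over_balls_gt; exists i.
  by apply: bigcup_open => i _; exact: rational_ball_open.
move=> K cK.
have -> : [set w | exists x, sup_over_balls x w <= a%:E /\ K x] = [set w |
    ~ exists s : seq ('rV[rat]_k * nat),
      (K `<=` [set x | exists i, i \in s /\ rational_ball i x]) /\
      forall i, i \in s -> a%:E < J i w].
  apply/seteqP; split=> w /=.
    move=> [x [xa Kx]] [s [/(_ x Kx) [i [is_ ix]] /(_ i is_) aJ]].
    by move: xa; rewrite leNgt => /negP; apply; apply/sup_over_balls_gt; exists i.
  move=> H; apply: contrapT => nK; apply: H.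
  move: cK; rewrite compact_cover => /(_ _ [set i | a%:E < J i w]
    (fun i => @rational_ball R k i))[].
  - by move=> i _; exact: rational_ball_open.
  - move=> x Kx; have : a%:E < sup_over_balls x w.
      by rewrite ltNge; apply/negP => xa; apply: nK; exists x.
    by move=> /sup_over_balls_gt[i [ix aJ]]; exists i.
  - move=> D DJ KD; exists (finmap.enum_fset D); split.
      by move=> x /KD[i /= iD ix]; exists i.
    by move=> i iD; have := DJ i iD; rewrite inE.
apply: sa_not => //; apply: sa_exists => // s; apply: sa_and => //; first exact: sa_cst.
apply: sa_forall => // i; apply: sa_imp => //; first exact: sa_cst.
exact: (mJ i (@open_ereal_gt_ereal _ a%:E)).
Qed.

End supremum_over_balls.

Section first_ball.
Variable x : Omega -> 'rV[R]_k.
Hypothesis Gx : measurable_wrt G x.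

Definition nth_ball (n j : nat) : 'rV[rat]_k * nat := (odflt 0%R (unpickle j), n).

(** The event that [j] is the first index of a ball of radius [1 / (n + 1)] that
    contains [x w].  For fixed [n] these events partition the space, so that a
    ball around [x w] can be chosen with countably many values. *)
Definition first_ball (n j : nat) : set Omega := [set w |
  rational_ball (nth_ball n j) (x w) /\
  forall i, (i < j)%N -> ~ rational_ball (nth_ball n i) (x w)].

Lemma first_ball_measurable n j : G (first_ball n j).
Proof.
have Gi i : G [set w | rational_ball (nth_ball n i) (x w)].
  by apply: Gx; exact: rational_ball_open.
apply: sa_and => //; apply: sa_forall => // i.
by apply: sa_imp => //; [exact: sa_cst|exact: sa_not].
Qed.

Lemma first_ball_cover n w : exists j, first_ball n j w.
Proof.
have [c cx] := rational_ball_cover (x w) n.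
have ex : exists j, `[< rational_ball (nth_ball n j) (x w) >].
  by exists (pickle c); apply/asboolP; rewrite /nth_ball pickleK.
have [j /asboolP jx jmin] := ex_minnP ex.
exists j; split => // i ij ix; have /asboolP/jmin := ix.
by rewrite leqNgt ij.
Qed.

Lemma first_ball_disj n : trivIset setT (first_ball n).
Proof.
apply/trivIsetP => i j _ _ ij; rewrite -subset0 => w [[iw ni] [jw nj]].
move: ij; rewrite neq_ltn => /orP[ij|ji].
  exact: (nj _ ij).
exact: (ni _ ji).
Qed.

Lemma integral_le_of_first_ball n (X Y : Omega -> \bar R) (A : set Omega) :
  measurable A -> measurable_fun setT X -> (forall w, 0 <= X w) ->
  measurable_fun setT Y -> (forall w, 0 <= Y w) ->
  (forall j, \int[P]_(w in A `&` first_ball n j) X w <=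
             \int[P]_(w in A `&` first_ball n j) Y w) ->
  \int[P]_(w in A) X w <= \int[P]_(w in A) Y w.
Proof.
move=> mA mX X0 mY Y0 XY.
have AE : A = \bigcup_j (A `&` first_ball n j).
  apply/seteqP; split=> [w Aw|w [j _ []]//].
  by have [j jw] := first_ball_cover n w; exists j.
have mF j : measurable (A `&` first_ball n j).
  by apply: measurableI => //; apply: GM; exact: first_ball_measurable.
have tF : trivIset setT (fun j => A `&` first_ball n j).
  by apply: trivIset_setIl; exact: first_ball_disj.
have mS (Z : Omega -> \bar R) (B : set Omega) : measurable_fun setT Z -> measurable_fun B Z by exact: measurable_funTS.
rewrite AE !ge0_integral_bigcup //; [|exact: mS|exact: mS].
by apply: lee_nneseries => // j _ _; exact: integral_ge0.
Qed.

End first_ball.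

Lemma normal_lsc (f : 'rV[R]_k -> \bar R) x (c : R) :
  closed (epigraph f) -> c%:E < f x ->
  exists m, forall n b, (m <= n)%N -> rational_ball (b, n) x ->
    c%:E <= ereal_inf [set f y | y in rational_ball (b, n)].
Proof.
move=> cf cx.
have [e e0 sep] := epigraph_separation cf cx.
have [m me] := small_radius e0; exists m => n b mn bx.
apply: le_ereal_inf_tmp => _ [y yb <-]; apply/ltW/sep; last by rewrite subrr normr0.
apply: (@rational_ball_small R k n x e b) => //; last exact: rational_ball_cball.
by apply: le_lt_trans me; rewrite ler_pM2l // lef_pV2 ?posrE ?ltr0n // ler_nat.
Qed.

Theorem condexp_normal_ge0 (h : 'rV[R]_k -> Omega -> \bar R) :
  normal_integrand (@measurable d Omega) h -> (forall x w, 0 <= h x w) ->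
  exists g : 'rV[R]_k -> Omega -> \bar R,
    [/\ normal_integrand G g, forall x w, 0 <= g x w &
      forall x, measurable_wrt G x ->
        is_condexp_ge0 P G (fun w => h (x w) w) (fun w => g (x w) w)].
Proof.
move=> nh h0.
pose I (i : 'rV[rat]_k * nat) := inf_over h (rational_ball i).
have mI i : measurable_fun setT (I i).
  by apply/measurable_ambientE; exact: (normal_inf_over sM nh (@rational_ball_open R k i)).
have I0 i w : 0 <= I i w by apply: le_ereal_inf_tmp => _ [y _ <-].
have [J JP] := choice (fun i => condexp_ge0_exists P sG GM (mI i) (I0 i)).
have J0 i w : 0 <= J i w by have [] := JP i.
have GJ i : measurable_wrt G (J i) by have [] := JP i.
have mJ i : measurable_fun setT (J i) by exact: (measurable_wrt_measurable sG GM).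
have ng := sup_over_balls_normal GJ.
exists (sup_over_balls J); split => //; first by move=> *; exact: sup_over_balls_ge0.
move=> x Gx; set X := fun w => h (x w) w; set Y := fun w => sup_over_balls J (x w) w.
have X0 w : 0 <= X w by exact: h0.
have Y0 w : 0 <= Y w by exact: sup_over_balls_ge0.
have mX : measurable_fun setT X.
  apply/measurable_ambientE; apply: (normal_measurable sM nh).
  exact: measurable_wrt_le GM Gx.
have GY : measurable_wrt G Y by exact: (normal_measurable sG ng Gx).
have mY := measurable_wrt_measurable sG GM GY.
split => // A GA; have mA := GM GA.
apply/eqP; rewrite eq_le; apply/andP; split.
  have [Z cZ] := condexp_ge0_exists P sG GM mX X0.
  have [Z0 GZ ZE] := cZ; rewrite -ZE //.
  have mZ := measurable_wrt_measurable sG GM GZ.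
  apply: ae_ge0_le_integral => //; [exact: measurable_funTS|exact: measurable_funTS|].
  have /ae_forall_countable : forall i, \forall w \ae P, rational_ball i (x w) -> J i w <= Z w.
    move=> i; apply: (condexp_ge0_le sG GM (B := [set w | rational_ball i (x w)])
      (mI i) (I0 i) mX X0 (JP i) cZ).
      by apply: Gx; exact: rational_ball_open.
    by apply: nearW => w ix; apply: ereal_inf_lbound; exists (x w).
  apply: filterS => w H _; apply: ge_ereal_sup => _ [i ix <-]; exact: H.
(* [Xn n] is the infimum over the first ball of radius [1 / (n + 1)] around [x w]:
   it is at most [X], and its lower limit is at least [X] by lower
   semicontinuity. *)
pose N n w := sval (cid (first_ball_cover x n w)).
have NP n w : first_ball x n (N n w) w by rewrite /N; case: cid.
have NE n j w : first_ball x n j w -> N n w = j.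
  move=> jw; apply: contrapT => /eqP nj.
  have /trivIsetP/(_ _ _ Logic.I Logic.I nj) := @first_ball_disj x n.
  by rewrite -subset0 => /(_ w); apply; split => //; exact: NP.
pose Xn n w := I (nth_ball n (N n w)) w.
have Xn0 n w : 0 <= Xn n w by exact: I0.
have mXn n : measurable_fun setT (Xn n).
  apply/measurable_ambientE; apply: measurable_wrt_lt => // a.
  have -> : [set w | Xn n w < a%:E] =
      [set w | exists j, first_ball x n j w /\ I (nth_ball n j) w < a%:E].
    apply/seteqP; split=> w /=; first by exists (N n w).
    by move=> [j [jw]]; rewrite /Xn (NE _ _ _ jw).
  apply: sa_exists => // j; apply: sa_and => //; first by apply: GM; exact: first_ball_measurable.
  have /measurable_ambientE mIj := mI (nth_ball n j).
  exact: (mIj _ (@open_ereal_lt_ereal _ a%:E)).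
have XnY n : \int[P]_(w in A) Xn n w <= \int[P]_(w in A) Y w.
  apply: (integral_le_of_first_ball Gx (n := n)) => // j.
  have Gj : G (A `&` first_ball x n j) by apply: sa_and => //; exact: first_ball_measurable.
  have mj := GM Gj.
  rewrite (eq_integral (I (nth_ball n j))); last first.
    by move=> w; rewrite inE => -[_ jw]; rewrite /Xn (NE _ _ _ jw).
  have [_ _ <- //] := JP (nth_ball n j).
  apply: ge0_le_integral => //; [exact: measurable_funTS|exact: measurable_funTS|].
  move=> w [_ [jw _]]; apply: ereal_sup_ubound; by exists (nth_ball n j).
apply: (@le_trans _ _ (\int[P]_(w in A) limn_einf (Xn ^~ w))).
  have meinf : measurable_fun setT (fun w => limn_einf (Xn ^~ w)).
    apply: measurableT_comp => //; apply: measurable_fun_limn_esup => n.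
    exact: measurableT_comp.
  apply: ge0_le_integral => //; [exact: measurable_funTS|exact: measurable_funTS|].
  move=> w _; rewrite limn_einf_sup_einfs.
  apply: contrapT => /negP; rewrite -ltNge => sX.
  have [c sc cX] : exists2 c : R, ereal_sup (range (einfs (Xn ^~ w))) < c%:E & c%:E < X w.
    have s0 : 0 <= ereal_sup (range (einfs (Xn ^~ w))).
      apply: (@le_trans _ _ (einfs (Xn ^~ w) 0%N)); last by apply: ereal_sup_ubound; exists 0%N.
      by apply: le_ereal_inf_tmp => _ [m _ <-].
    move: sX s0; case: (ereal_sup _) => [s| |] //; case: (X w) => [r| |] //.
      by rewrite lte_fin => sr _; exists ((s + r) / 2)%R; rewrite lte_fin; lra.
    by move=> _ _; exists (s + 1)%R; rewrite ?ltry // lte_fin; lra.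
  have [m Hm] := @normal_lsc (h^~ w) (x w) c (nh.1 w) cX.
  have : c%:E <= ereal_sup (range (einfs (Xn ^~ w))).
    apply: (@le_trans _ _ (einfs (Xn ^~ w) m)); last by apply: ereal_sup_ubound; exists m.
    apply: le_ereal_inf_tmp => _ [n /= mn <-]; apply: Hm => //.
    by have [] := NP n w.
  by rewrite leNgt sc.
apply: (@le_trans _ _ (limn_einf (fun n => \int[P]_(w in A) Xn n w))).
  by apply: fatou => // n; exact: measurable_funTS.
rewrite limn_einf_sup_einfs; apply: ge_ereal_sup => _ [n _ <-].
by apply: ereal_inf_le; exists (\int[P]_(w in A) Xn n w) => //; exists n => //=.
Qed.

End nonnegative_integrand.

(** * Dense families of selections and convexity *)

Lemma measurable_wrt_comp2 (Omega : Type) (R : realType) (G : set (set Omega))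
    (a b : nat) (X : topologicalType) (x : Omega -> 'rV[R]_a) (y : Omega -> 'rV[R]_b)
    (phi : 'rV[R]_a * 'rV[R]_b -> X) :
  sigma_algebra setT G -> measurable_wrt G x -> measurable_wrt G y ->
  continuous phi -> measurable_wrt G (fun w => phi (x w, y w)).
Proof.
move=> sG Gx Gy cphi U oU.
have -> : (fun w => phi (x w, y w)) @^-1` U = [set w |
    exists ij : ('rV[rat]_a * nat) * ('rV[rat]_b * nat),
      (forall p, rational_ball ij.1 p.1 -> rational_ball ij.2 p.2 -> U (phi p)) /\
      (rational_ball ij.1 (x w) /\ rational_ball ij.2 (y w))].
  apply/seteqP; split=> w /=; last first.
    by move=> [ij [H [xi yj]]]; exact: (H (x w, y w)).
  move=> Uw; have : nbhs (phi (x w, y w)) U by exact: open_nbhs_nbhs.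
  move=> /(cphi (x w, y w))[[V1 V2] [/= /near_norm[e e0 V1x] /near_norm[e' e'0 V2y]] sub].
  have [i xi isub] := rational_ball_basis (x w) e0.
  have [j yj jsub] := rational_ball_basis (y w) e'0.
  exists (i, j); split => //= -[u v] /= iu jv; apply: (sub (u, v)); split => /=.
    exact/V1x/isub/rational_ball_cball.
  exact/V2y/jsub/rational_ball_cball.
apply: sa_exists => // -[i j] /=; apply: sa_and => //; first exact: sa_cst.
by apply: sa_and => //; [apply: Gx|apply: Gy]; exact: rational_ball_open.
Qed.

Section dense_selections.
Context d (Omega : measurableType d) (R : realType) (G : set (set Omega)) (k : nat).
Hypothesis sG : sigma_algebra setT G.
Implicit Types g : 'rV[R]_k -> Omega -> \bar R.

(** Selections of the intersections of a sublevel set at a rational level with a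
    closed rational ball, extended arbitrarily where this is empty. *)
Lemma dense_selections g : normal_integrand G g ->
  exists xi : ('rV[rat]_k * nat) * rat -> Omega -> 'rV[R]_k,
    (forall i, measurable_wrt G (xi i)) /\
    forall w x (e : R) (q : rat), (0 < e)%R -> g x w <= (ratr q)%:E ->
      exists j, g (xi (j, q) w) w <= (ratr q)%:E /\ (`|x - xi (j, q) w| < e)%R.
Proof.
move=> ng.
have H (i : ('rV[rat]_k * nat) * rat) : exists x : Omega -> 'rV[R]_k,
    measurable_wrt G x /\ forall w, (exists x, g x w <= (ratr i.2)%:E /\ rational_cball i.1 x) ->
      g (x w) w <= (ratr i.2)%:E /\ rational_cball i.1 (x w).
  have ccl : closed (@rational_cball R k i.1).
    by apply: compact_closed; [exact: norm_hausdorff|exact: rational_cball_compact].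
  have [x [Gx Hx]] := measurable_selection sG
    (closed_measurable_setI ccl (normal_sublevel sG (ratr i.2) ng)).
  exists x; split => [//|w [y [gy iy]]].
  by apply: (Hx w); exists y.
have [xi Hxi] := choice H; exists xi; split; first by move=> i; have [] := Hxi i.
move=> w x e q e0 gx; have [j xj jsub] := rational_ball_basis x e0.
have [_ /(_ w)[|? ?]] := Hxi (j, q).
  by exists x; split => //=; exact: rational_ball_cball.
by exists j; split => //; exact: jsub.
Qed.

Lemma ereal_between_rat (a b : \bar R) : a < b ->
  exists q : rat, a <= (ratr q)%:E /\ (ratr q)%:E < b.
Proof.
case: a => [r| |]; case: b => [s| |] //.
- by rewrite lte_fin => /rat_in_itvoo[q]; rewrite in_itv/= => /andP[? ?]; exists q; rewrite lee_fin lte_fin ltW.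
- have /rat_in_itvoo[q] : (r < r + 1)%R by lra.
  by rewrite in_itv/= => /andP[? ?]; exists q; rewrite lee_fin ltW // ltry.
- have /rat_in_itvoo[q] : (s - 1 < s)%R by lra.
  by rewrite in_itv/= => /andP[? ?]; exists q; rewrite lte_fin leNye.
- by exists 0%R; rewrite leNye ltry.
Qed.

(** An inequality [f' <= f] on a family that is dense in the sublevel sets of [f]
    extends to all points, [f'] being lower semicontinuous. *)
Lemma le_of_dense (f f' : 'rV[R]_k -> \bar R) (xi : ('rV[rat]_k * nat) * rat -> 'rV[R]_k) :
  closed (epigraph f') ->
  (forall x (e : R) (q : rat), (0 < e)%R -> f x <= (ratr q)%:E ->
      exists j, f (xi (j, q)) <= (ratr q)%:E /\ (`|x - xi (j, q)| < e)%R) ->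
  (forall i, f' (xi i) <= f (xi i)) -> forall x, f' x <= f x.
Proof.
move=> cf' dxi H x; rewrite leNgt; apply/negP => /ereal_between_rat[q [fq qf']].
have [e e0 sep] := epigraph_separation cf' qf'.
have [j [fxi xxi]] := dxi x e q e0 fq.
have := le_trans (H (j, q)) fxi; rewrite leNgt sep //.
by rewrite subrr normr0.
Qed.

End dense_selections.

Section convexity.
Context (R : realType) (k : nat).
Implicit Types (f : 'rV[R]_k -> \bar R).

Lemma convex_epigraphP f : convex_set (epigraph f) <->
  forall x y (a b t : R), (0 <= t <= 1)%R -> f x <= a%:E -> f y <= b%:E ->
    f (t *: x + (1 - t) *: y)%R <= (t * a + (1 - t) * b)%:E.
Proof.
split=> [cf x y a b t t01 fx fy|H].
  have := cf (x, a) (y, b) (Itv01 (proj1 (andP t01)) (proj2 (andP t01))).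
  by rewrite !inE => /(_ fx fy).
move=> [x a] [y b] t; rewrite !inE /= => fx fy.
by apply: H => //; apply/andP.
Qed.
End convexity.

Lemma rational_near_unit (R : realType) (t e : R) : (0 <= t <= 1)%R -> (0 < e)%R ->
  exists l : rat, [/\ (0 <= ratr l :> R)%R, (ratr l <= 1 :> R)%R & (`|ratr l - t| < e)%R].
Proof.
move=> /andP[t0]; rewrite le_eqVlt => /orP[/eqP ->|t1] e0.
  by exists 1%R; rewrite rmorph1 subrr normr0 ler01 lexx.
have /rat_in_itvoo[l] : (t < Num.min (t + e) 1)%R by rewrite lt_min t1 andbT; lra.
rewrite in_itv/= lt_min => /andP[tl /andP[le l1]]; exists l; split; [lra|lra|].
by rewrite ltr_norml; apply/andP; split; lra.
Qed.

(** Convexity, too, need only be tested on a dense family of selections and with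
    rational coefficients. *)
Lemma convex_of_dense (R : realType) (k : nat) (f : 'rV[R]_k -> \bar R)
    (xi : ('rV[rat]_k * nat) * rat -> 'rV[R]_k) :
  closed (epigraph f) ->
  (forall x (e : R) (q : rat), (0 < e)%R -> f x <= (ratr q)%:E ->
      exists j, f (xi (j, q)) <= (ratr q)%:E /\ (`|x - xi (j, q)| < e)%R) ->
  (forall i i' (l : rat), (0 <= ratr l :> R)%R -> (ratr l <= 1 :> R)%R ->
    f (xi i) <= (ratr i.2)%:E -> f (xi i') <= (ratr i'.2)%:E ->
    f (ratr l *: xi i + (1 - ratr l) *: xi i')%R <=
      (ratr l * ratr i.2 + (1 - ratr l) * ratr i'.2)%:E) ->
  convex_set (epigraph f).
Proof.
move=> cf dxi H; apply/convex_epigraphP => x y a b t t01 fx fy.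
rewrite leNgt; apply/negP => nf.
set z := (t *: x + (1 - t) *: y)%R; set c := (t * a + (1 - t) * b)%R.
have [r r0 sep] := epigraph_separation cf nf.
pose D := (`|x - y| + `|a - b| + 1)%R.
have D1 : (1 <= D)%R by rewrite lerDr addr_ge0.
have D0 : (0 < D)%R by lra.
have [|l [l0 l1 lt]] := rational_near_unit (e := (r / 4 / D)%R) t01.
  by rewrite !divr_gt0.
have {lt} ltD : (`|ratr l - t| * D < r / 4)%R by rewrite -ltr_pdivlMr.
have [q aq qa] : exists2 q : rat, (a < ratr q)%R & (ratr q < a + r / 4)%R.
  have /rat_in_itvoo[q] : (a < a + r / 4)%R by lra.
  by rewrite in_itv /= => /andP[? ?]; exists q.
have [q' bq qb] : exists2 q : rat, (b < ratr q)%R & (ratr q < b + r / 4)%R.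
  have /rat_in_itvoo[q'] : (b < b + r / 4)%R by lra.
  by rewrite in_itv /= => /andP[? ?]; exists q'.
have r4 : (0 < r / 4)%R by lra.
have [|i [fi xxi]] := dxi x (r / 4)%R q r4; first by apply: le_trans fx _; rewrite lee_fin ltW.
have [|i' [fi' yxi]] := dxi y (r / 4)%R q' r4; first by apply: le_trans fy _; rewrite lee_fin ltW.
have := H _ _ l l0 l1 fi fi'; rewrite leNgt => /negP; apply; apply: sep => /=; rewrite -/z -/c.
  set u := xi (i, q); set v := xi (i', q').
  have -> : (z - (ratr l *: u + (1 - ratr l) *: v) =
      ratr l *: (x - u) + (1 - ratr l) *: (y - v) - (ratr l - t) *: (x - y))%R.
    rewrite /z; apply/rowP => j; rewrite !mxE; ring.
  apply: le_lt_trans (ler_normB _ _) _; rewrite normrZ.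
  have h1 : (`|ratr l - t| * `|x - y| <= `|ratr l - t| * D)%R.
    by apply: ler_wpM2l => //; rewrite /D -addrA lerDl addr_ge0.
  have h2 : (`|ratr l *: (x - u) + (1 - ratr l) *: (y - v)| <= r / 4 + r / 4)%R.
    apply: le_trans (ler_normD _ _) _; apply: lerD; rewrite normrZ ger0_norm ?subr_ge0 //.
      by apply: le_trans (ltW xxi); rewrite ler_piMl.
    by apply: le_trans (ltW yxi); rewrite ler_piMl // lerBlDr lerDl.
  by move: ltD h1 h2; lra.
have -> : (c - (ratr l * ratr q + (1 - ratr l) * ratr q') =
    ratr l * (a - ratr q) + (1 - ratr l) * (b - ratr q') - (ratr l - t) * (a - b))%R.
  by rewrite /c; ring.
apply: le_lt_trans (ler_normB _ _) _; rewrite normrM.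
have h1 : (`|ratr l - t| * `|a - b| <= `|ratr l - t| * D)%R.
  by apply: ler_wpM2l => //; rewrite /D -addrA addrCA lerDl addr_ge0.
have h2 : (`|ratr l * (a - ratr q) + (1 - ratr l) * (b - ratr q')| <= r / 4 + r / 4)%R.
  apply: le_trans (ler_normD _ _) _; apply: lerD; rewrite normrM ger0_norm ?subr_ge0 //.
    rewrite ltr0_norm; last by lra.
    by apply: (@le_trans _ _ (- (a - ratr q))%R); [rewrite ler_piMl //; lra|lra].
  rewrite ltr0_norm; last by lra.
  by apply: (@le_trans _ _ (- (b - ratr q'))%R); [rewrite ler_piMl //; lra|lra].
by move: ltD h1 h2; lra.
Qed.

Lemma funeposneg_shift (T : Type) (R : realType) (X : T -> \bar R) (c : R) w :
  (- c)%:E <= X w -> X^\+ w + c%:E = X w + c%:E + X^\- w.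
Proof.
rewrite funeposE funenegE; case: (X w) => [r| |] //=.
  rewrite lee_fin => cr; rewrite -!EFin_max -!EFinD; congr EFin.
  by rewrite /Order.max; case: (ltP r 0)%R; case: (ltP (- r) 0)%R; lra.
by move=> _; rewrite (max_l (leey _)) (max_r (leNye _)) adde0.
Qed.

Section condexp_bounded_below.
Context d (Omega : measurableType d) (R : realType) (P : probability Omega R).
Context (G : set (set Omega)).
Hypothesis sG : sigma_algebra setT G.
Hypothesis GM : G `<=` @measurable d Omega.
Implicit Types (X U V Z C : Omega -> \bar R) (mu : Omega -> R).

(** With [U = X + mu] one has [X_+ + mu = U + X_-] ([funeposneg_shift]); take
    conditional expectations of both sides and cancel, which is possible since
    [E^G X_- <= E^G mu] is finite almost surely.  For finite subtrahend the dual
    subtraction is the ordinary one. *)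
Lemma condexp_posneg_shift mu C X U V Yp Ym :
  (forall w, 0 <= mu w)%R -> P.-integrable setT (EFin \o mu) ->
  is_condexp_ge0 P G (EFin \o mu) C ->
  measurable_fun setT X -> measurable_fun setT U -> (forall w, 0 <= U w) ->
  is_condexp_ge0 P G U V ->
  (\forall w \ae P, (- mu w)%:E <= X w /\ U w = X w + (mu w)%:E) ->
  is_condexp_ge0 P G X^\+ Yp -> is_condexp_ge0 P G X^\- Ym ->
  \forall w \ae P, (Yp w - Ym w)%dE = V w - C w /\ C w \is a fin_num.
Proof.
move=> mu0 imu cC mX mU U0 cV XU cYp cYm.
have mmu : measurable_fun setT (EFin \o mu) := measurable_int _ imu.
have emu0 w : 0 <= (EFin \o mu) w by rewrite lee_fin.
have mXp : measurable_fun setT X^\+ by exact: measurable_funepos.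
have mXm : measurable_fun setT X^\- by exact: measurable_funeneg.
have h1 := condexp_ge0D sG GM mXp (funepos_ge0 X) mmu emu0 cYp cC.
have h2 := condexp_ge0D sG GM mU U0 mXm (funeneg_ge0 X) cV cYm.
have E : \forall w \ae P, Yp w + C w = V w + Ym w.
  apply: (condexp_ge0_unique sG GM _ _ _ _ h1 h2).
  - exact: emeasurable_funD.
  - by move=> w; rewrite adde_ge0.
  - exact: emeasurable_funD.
  - by move=> w; rewrite adde_ge0.
  - apply: filterS XU => w [lX ->]; exact: funeposneg_shift.
have mY : \forall w \ae P, Ym w <= C w.
  have : \forall w \ae P, setT w -> Ym w <= C w.
    apply: (condexp_ge0_le sG GM mXm (funeneg_ge0 X) mmu emu0 cYm cC).
      exact: (sa_cst sG True).
    apply: filterS XU => w [+ _] _; rewrite funenegE /= ge_max lee_fin mu0 andbT.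
    by rewrite EFinN leeNl.
  by apply: filterS => w; exact.
have fC : \forall w \ae P, C w \is a fin_num.
  have := integrable_ae measurableT (condexp_ge0_integrable sG GM imu emu0 cC).
  by apply: filterS => w; exact.
have [Ym0 _ _] := cYm.
near=> w.
have fCw : C w \is a fin_num by near: w.
have Yml : Ym w <= C w by near: w.
have fYm : Ym w \is a fin_num.
  by rewrite ge0_fin_numE //; apply: le_lt_trans Yml _; rewrite ltey_eq fCw.
split => //.
have Ew : Yp w + C w = V w + Ym w by near: w.
rewrite /dual_adde /=.
move: Ew fCw fYm; case: (C w) => [c| |] //; case: (Ym w) => [y| |] //.
case: (Yp w) => [p| |] //; case: (V w) => [v| |] //= [] pcvy _ _.
by congr EFin; lra.
Unshelve. all: by end_near.
Qed.
End condexp_bounded_below.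

(** * Convex integrands with an integrable lower bound *)

Section regular_integrands.
Context d (Omega : measurableType d) (R : realType) (P : probability Omega R).

(** These properties hold for almost every [w] only: conditional expectations are
    determined up to null sets, and null directions are linear almost surely. *)
Definition good_at (k : nat) (f : 'rV[R]_k -> Omega -> \bar R) (mu : Omega -> R)
    (w : Omega) : Prop :=
  [/\ closed (epigraph (f^~ w)), convex_set (epigraph (f^~ w)) &
      forall x, (- mu w)%:E <= f x w].

(** Normality up to a null set.  The measurability requirement bears on all [w];
    for a complete measure it survives changes on null sets. *)
Definition regular_with (k : nat) (f : 'rV[R]_k -> Omega -> \bar R)
    (mu : Omega -> R) : Prop :=
  [/\ forall w, (0 <= mu w)%R, P.-integrable setT (EFin \o mu),
      \forall w \ae P, good_at f mu w &
      forall i, measurable_fun setT (inf_over f (rational_ball i))].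

(** Adding [c] and replacing the integrand by [0] off [A] turns a regular
    integrand into a nonnegative normal one; the same operation with
    [c = - E^G mu] undoes it after conditioning. *)
Definition shift (k : nat) (A : set Omega) (c : Omega -> R)
    (f : 'rV[R]_k -> Omega -> \bar R) (x : 'rV[R]_k) (w : Omega) : \bar R :=
  if `[< A w >] then f x w + (c w)%:E else 0.

Lemma shift_in (k : nat) A c (f : 'rV[R]_k -> Omega -> \bar R) x w : A w ->
  shift A c f x w = f x w + (c w)%:E.
Proof. by rewrite /shift => /asboolT ->. Qed.

Lemma shift_out (k : nat) A c (f : 'rV[R]_k -> Omega -> \bar R) x w : ~ A w ->
  shift A c f x w = 0.
Proof. by rewrite /shift => /asboolF ->. Qed.

Lemma epigraph_shift_closed (k : nat) (f : 'rV[R]_k -> \bar R) (c : R) :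
  closed (epigraph f) -> closed (epigraph (fun x => f x + c%:E)).
Proof.
move=> cf.
have -> : epigraph (fun x => f x + c%:E) =
    (fun p : 'rV[R]_k * R^o => (p.1, p.2 - c)%R) @^-1` epigraph f.
  by apply/seteqP; split=> -[x a] /=; rewrite /epigraph /= EFinB leeBrDr.
apply: preimage_closed cf => -[x a] _.
have c1 : (fst : 'rV[R]_k * R^o -> 'rV[R]_k) @ (x, a) --> x by exact: cvg_fst.
have c2 : (fun p : 'rV[R]_k * R^o => (p.2 - c)%R) @ (x, a) --> (a - c : R^o)%R.
  by apply: cvgB; [exact: cvg_snd|exact: cvg_cst].
exact: (@cvg_pair _ _ _ (nbhs ((x, a) : 'rV[R]_k * R^o)) (nbhs x) (nbhs (a - c : R^o)%R) _ _ _ _ _ c1 c2).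
Qed.

Lemma inf_over_shift (k : nat) A c (f : 'rV[R]_k -> Omega -> \bar R) B w :
  A w -> inf_over (shift A c f) B w = inf_over f B w + (c w)%:E.
Proof.
move=> Aw; apply/eqP; rewrite eq_le; apply/andP; split.
  rewrite -leeBlDr //; apply: le_ereal_inf_tmp => _ [x Bx <-].
  rewrite leeBlDr // -(shift_in c f x Aw); apply: ereal_inf_lbound; by exists x.
apply: le_ereal_inf_tmp => _ [x Bx <-]; rewrite shift_in // leeD2r //.
by apply: ereal_inf_lbound; exists x.
Qed.

Lemma shift_normal (G : set (set Omega)) (k : nat) A c (f : 'rV[R]_k -> Omega -> \bar R) :
  sigma_algebra setT G -> G A -> measurable_wrt G (EFin \o c) ->
  (forall w, A w -> closed (epigraph (f^~ w))) ->
  (forall i, measurable_wrt G (inf_over f (rational_ball i))) ->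
  normal_integrand G (shift A c f).
Proof.
move=> sG GA Gc cf Gf; apply: normal_of_inf_over => //.
  move=> w; have [Aw|nAw] := pselect (A w).
    rewrite (_ : (shift A c f)^~ w = fun x => f x w + (c w)%:E).
      exact/epigraph_shift_closed/cf.
    by apply/funext => x; exact: shift_in.
  rewrite (_ : (shift A c f)^~ w = cst 0).
    apply: epigraph_closed => a.
    have [a0|a0] := leP 0%R a.
      rewrite (_ : [set _ | _] = setT); first exact: closedT.
      by apply/seteqP; split=> x //= _; rewrite lee_fin.
    rewrite (_ : [set _ | _] = set0); first exact: closed0.
    by apply/seteqP; split=> x //=; rewrite lee_fin leNgt a0.
  by apply/funext => x; exact: shift_out.
move=> i; apply: measurable_wrt_lt => // a.
have -> : [set w | inf_over (shift A c f) (rational_ball i) w < a%:E] = [set w |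
    (A w /\ inf_over f (rational_ball i) w + (c w)%:E < a%:E) \/ (~ A w /\ (0 < a)%R)].
  apply/seteqP; split=> w /=.
    have [Aw|nAw] := pselect (A w); first by rewrite inf_over_shift //; left.
    move=> /inf_over_lt[x [ix]]; rewrite shift_out // lte_fin => a0; by right.
  move=> [[Aw]|[nAw a0]]; first by rewrite inf_over_shift.
  apply/inf_over_lt; exists (rational_point R i.1); rewrite shift_out // lte_fin; split => //.
  by rewrite /rational_ball /= subrr normr0 invr_gt0 ltr0n.
apply: sa_or => //; apply: sa_and => //; [|exact: sa_not|exact: sa_cst].
have GS : measurable_wrt G (fun w => inf_over f (rational_ball i) w + (c w)%:E).
  apply/(measurable_wrtE sG)/emeasurable_funD; last exact/(measurable_wrtE sG).
  by apply/(measurable_wrtE sG); exact: Gf.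
exact: (GS _ (@open_ereal_lt_ereal _ a%:E)).
Qed.

Hypothesis complete : measure_is_complete P.

Lemma ae_measurable_set (A : set Omega) : (\forall w \ae P, A w) -> measurable A.
Proof. by move=> PA; rewrite -(setCK A); apply/measurableC/complete. Qed.

Let sM : sigma_algebra setT (@measurable d Omega) := @sigma_algebra_measurable d Omega.

Section shifted.
Context (k : nat) (f : 'rV[R]_k -> Omega -> \bar R) (mu : Omega -> R).
Hypothesis rf : regular_with f mu.

Definition shifted : 'rV[R]_k -> Omega -> \bar R :=
  shift [set w | good_at f mu w] mu f.

Lemma shifted_ge0 x w : 0 <= shifted x w.
Proof.
rewrite /shifted /shift; case: asboolP => // -[_ _ /(_ x)].
by rewrite EFinN -leeBlDr // sub0e.
Qed.

Lemma shifted_normal : normal_integrand (@measurable d Omega) shifted.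
Proof.
case: rf => mu0 imu gf mf; apply: shift_normal => //.
- exact: ae_measurable_set.
- exact/measurable_ambientE/(measurable_int _ imu).
- by move=> w [].
- by move=> i; exact/measurable_ambientE.
Qed.

Lemma shiftedE : \forall w \ae P, forall x, shifted x w = f x w + (mu w)%:E.
Proof. by case: rf => _ _ gf _; apply: filterS gf => w gw x; exact: shift_in. Qed.

(** The case distinctions concern [l = 0] and [l = 1], where a product [0 * +oo]
    appears on the right. *)
Lemma shifted_convex x y (l : R) w : (0 <= l <= 1)%R ->
  shifted (l *: x + (1 - l) *: y)%R w <=
    l%:E * shifted x w + (1 - l)%:E * shifted y w.
Proof.
move=> l01; have [gw|ngw] := pselect (good_at f mu w); last first.
  by rewrite /shifted !shift_out // !mule0 adde0.
have cw : convex_set (epigraph (shifted^~ w)).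
  have [_ /convex_epigraphP cf _] := gw; apply/convex_epigraphP => u v a b t t01.
  rewrite /shifted !shift_in // => fu fv.
  have := cf u v (a - mu w)%R (b - mu w)%R t t01.
  rewrite !EFinB !leeBrDr // => /(_ fu fv).
  rewrite (_ : (t * (a - mu w) + (1 - t) * (b - mu w) =
    t * a + (1 - t) * b - mu w)%R); last by ring.
  by rewrite EFinB leeBrDr.
have /convex_epigraphP {}cw := cw.
have := shifted_ge0 x w; have := shifted_ge0 y w.
case/andP: (l01) => l0 l1.
have [->|ln0] := eqVneq l 0%R.
  by rewrite scale0r subr0 scale1r add0r mul0e add0e mul1e.
have [->|ln1] := eqVneq l 1%R.
  by rewrite subrr scale0r scale1r addr0 mul0e adde0 mul1e.
have lgt0 : (0 < l)%R by rewrite lt_def ln0.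
have llt1 : (0 < 1 - l)%R by rewrite subr_gt0 lt_def eq_sym ln1.
have := fun a b => cw x y a b l l01.
case: (shifted x w) => [a| |] //; case: (shifted y w) => [b| |] // H _ _.
- by rewrite -!EFinM -EFinD; apply: H.
- by rewrite gt0_muley ?lte_fin // addey ?leey // -EFinM.
- by rewrite gt0_muley ?lte_fin // addye ?leey // -EFinM.
- by rewrite !gt0_muley ?lte_fin // leey.
Qed.

End shifted.
End regular_integrands.

(** * Conditional expectations of regular integrands *)

Lemma integrable_fine d (Omega : measurableType d) (R : realType)
    (P : {measure set Omega -> \bar R}) (C : Omega -> \bar R) :
  P.-integrable setT C -> P.-integrable setT (EFin \o (fine \o C)).
Proof.
move=> iC; apply: (le_integrable measurableT _ _ iC).
  by apply/measurable_EFinP; apply: measurableT_comp => //; exact: measurable_int iC.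
by move=> w _ /=; case: (C w) => [r| |] //=; rewrite leey.
Qed.

Section conditional_expectation_of_integrands.
Context d (Omega : measurableType d) (R : realType) (P : probability Omega R).
Hypothesis complete : measure_is_complete P.
Context (G : set (set Omega)).
Hypothesis sG : sigma_algebra setT G.
Hypothesis GM : G `<=` @measurable d Omega.
Let sM : sigma_algebra setT (@measurable d Omega) := @sigma_algebra_measurable d Omega.

Section regular.
Context (k : nat) (f : 'rV[R]_k -> Omega -> \bar R) (mu : Omega -> R).
Hypothesis rf : regular_with P f mu.
Variable C : Omega -> \bar R.
Hypothesis cC : is_condexp_ge0 P G (EFin \o mu) C.

Let mu0 : forall w, (0 <= mu w)%R. Proof. by case: rf. Qed.
Let imu : P.-integrable setT (EFin \o mu). Proof. by case: rf. Qed.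

Lemma shifted_composite_measurable (x : Omega -> 'rV[R]_k) : measurable_wrt G x ->
  measurable_fun setT (fun w => shifted f mu (x w) w).
Proof.
move=> Gx; apply/measurable_ambientE.
apply: (normal_measurable sM (shifted_normal complete rf)).
exact: measurable_wrt_le GM Gx.
Qed.

Lemma composite_measurable (x : Omega -> 'rV[R]_k) : measurable_wrt G x ->
  measurable_fun setT (fun w => f (x w) w).
Proof.
move=> /shifted_composite_measurable mU.
apply: (ae_measurable_fun complete (f := fun w => shifted f mu (x w) w - (mu w)%:E)).
  by apply: filterS (shiftedE rf) => w H _; rewrite H addeK.
by apply: emeasurable_funB => //; exact: measurable_int imu.
Qed.

Lemma composite_shift (x : Omega -> 'rV[R]_k) : \forall w \ae P,
  (- mu w)%:E <= f (x w) w /\ shifted f mu (x w) w = f (x w) w + (mu w)%:E.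
Proof.
case: rf => _ _ gf _; near=> w; split.
  by have [] : good_at f mu w; first by near: w.
by have -> // : forall x, shifted f mu x w = f x w + (mu w)%:E by near: w; exact: shiftedE.
Unshelve. all: by end_near.
Qed.

(** Reduces conditional expectations of [f] to those of the nonnegative integrand
    [shifted f mu]. *)
Lemma is_condexp_shift (x : Omega -> 'rV[R]_k) (V Z : Omega -> \bar R) :
  measurable_wrt G x -> is_condexp_ge0 P G (fun w => shifted f mu (x w) w) V ->
  is_condexp P G (fun w => f (x w) w) Z <->
  \forall w \ae P, Z w = V w - C w /\ C w \is a fin_num.
Proof.
move=> Gx cV; have mX := composite_measurable Gx.
have mU := shifted_composite_measurable Gx.
have U0 w : 0 <= shifted f mu (x w) w by exact: shifted_ge0.
have H Yp Ym := condexp_posneg_shift sG GM mu0 imu cC mX mU U0 cV (composite_shift x)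
   (Yp := Yp) (Ym := Ym).
split.
  move=> [_ [Yp [Ym [cYp cYm ZE]]]]; have {}H := H _ _ cYp cYm.
  near=> w; have [<- ?] : (Yp w - Ym w)%dE = V w - C w /\ C w \is a fin_num by near: w.
  by split => //; near: w.
move=> ZE; split => //.
have [Yp cYp] := condexp_ge0_exists P sG GM (measurable_funepos mX) (funepos_ge0 _).
have [Ym cYm] := condexp_ge0_exists P sG GM (measurable_funeneg mX) (funeneg_ge0 _).
exists Yp, Ym; split => //; have {}H := H _ _ cYp cYm; near=> w.
have [-> _] : (Yp w - Ym w)%dE = V w - C w /\ C w \is a fin_num by near: w.
by have [] : Z w = V w - C w /\ C w \is a fin_num by near: w.
Unshelve. all: by end_near. Qed.

Lemma condexp_fin_num : \forall w \ae P, C w \is a fin_num.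
Proof.
have emu0 w : 0 <= (EFin \o mu) w by rewrite lee_fin.
have := integrable_ae measurableT (condexp_ge0_integrable sG GM imu emu0 cC).
by apply: filterS => w; exact.
Qed.

End regular.

Lemma condexp_EFin_exists (mu : Omega -> R) : (forall w, (0 <= mu w)%R) ->
  P.-integrable setT (EFin \o mu) -> exists C, is_condexp_ge0 P G (EFin \o mu) C.
Proof.
by move=> mu0 imu; apply: condexp_ge0_exists => //; exact: measurable_int imu.
Qed.

Theorem condexp_integrand_exists (k : nat) (f : 'rV[R]_k -> Omega -> \bar R) mu :
  regular_with P f mu -> exists g, is_condexp_integrand P G f g.
Proof.
move=> rf; have [mu0 imu _ _] := rf; have [C cC] := condexp_EFin_exists mu0 imu.
have [g' [ng' g'0 cg']] := condexp_normal_ge0 P sG GM (shifted_normal complete rf)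
  (shifted_ge0 f mu).
have [C0 GC _] := cC.
pose A := [set w | C w < +oo].
have GA : G A by exact: (GC _ (@open_ereal_lt_ereal _ +oo)).
have Gc : measurable_wrt G (EFin \o (fun w => (- fine (C w))%R)).
  apply/(measurable_wrtE sG)/measurable_EFinP.
  apply: measurableT_comp => //; apply: measurableT_comp => //.
  exact/(measurable_wrtE sG).
have ng := shift_normal sG GA Gc (fun w _ => ng'.1 w)
  (fun i => normal_inf_over sG ng' (@rational_ball_open R k i)).
exists (shift A (fun w => (- fine (C w))%R) g'); split => // x Gx.
(* Outside of the null set where [C] is infinite, the shift by [- C] is the exact
   inverse of the shift by [mu] under conditioning. *)
apply/(is_condexp_shift rf cC _ Gx (cg' x Gx)).
apply: filterS (condexp_fin_num rf cC) => w Cw; split => //.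
rewrite shift_in ?EFinN ?fineK //.
by rewrite /A /= ltey_eq Cw.
Qed.

(** Convexity and the lower bound [- E^G mu] hold almost surely along each
    measurable selection, hence almost surely along a countable dense family of
    selections, hence at all points. *)
Theorem condexp_integrand_regular (k : nat) (f g : 'rV[R]_k -> Omega -> \bar R) mu :
  regular_with P f mu -> is_condexp_integrand P G f g ->
  exists mu', regular_with P g mu'.
Proof.
move=> rf [ng cg]; have [mu0 imu _ _] := rf; have [C cC] := condexp_EFin_exists mu0 imu.
have [C0 GC _] := cC; have fC := condexp_fin_num rf cC.
have [xi [Gxi dxi]] := dense_selections sG ng.
have HV (x : Omega -> 'rV[R]_k) : measurable_wrt G x -> exists V,
    is_condexp_ge0 P G (fun w => shifted f mu (x w) w) V /\
    \forall w \ae P, g (x w) w = V w - C w.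
  move=> Gx.
  have [V cV] := condexp_ge0_exists P sG GM (shifted_composite_measurable rf Gx)
    (fun w => shifted_ge0 f mu (x w) w).
  exists V; split => //.
  have := (is_condexp_shift rf cC _ Gx cV).1 (cg x Gx).
  by apply: filterS => w [].
have icC : P.-integrable setT C.
  by apply: (condexp_ge0_integrable sG GM imu _ cC) => w; rewrite lee_fin.
exists (fine \o C); split.
- by move=> w; exact: fine_ge0.
- exact: integrable_fine.
- near=> w; split.
  + exact: ng.1.
  + apply: (@convex_of_dense _ _ (g^~ w) (fun i => xi i w) (ng.1 w)).
      by move=> x e q; exact: dxi.
    near: w.
    have : \forall w \ae P, forall p : ((('rV[rat]_k * nat) * rat) * (('rV[rat]_k * nat) * rat) * rat)%type,
        (0 <= (ratr p.2 : R) <= 1)%R ->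
        g (xi p.1.1 w) w <= (ratr p.1.1.2)%:E -> g (xi p.1.2 w) w <= (ratr p.1.2.2)%:E ->
        g (ratr p.2 *: xi p.1.1 w + (1 - ratr p.2) *: xi p.1.2 w)%R w <=
          (ratr p.2 * ratr p.1.1.2 + (1 - ratr p.2) * ratr p.1.2.2)%:E.
      apply: ae_forall_countable => -[[i i'] l] /=.
      have [l01|_] := boolP (0 <= (ratr l : R) <= 1)%R; last exact: nearW.
      have Gl : measurable_wrt G (fun w => ratr l *: xi i w + (1 - ratr l) *: xi i' w)%R.
        apply: (measurable_wrt_comp2 (phi := fun p => (ratr l *: p.1 + (1 - ratr l) *: p.2)%R) sG (Gxi i) (Gxi i')).
        move=> p; apply: cvgD; apply: cvgZr; [exact: cvg_fst|exact: cvg_snd].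
      have [Vl [cVl Vlg]] := HV _ Gl.
      have [V [cV Vg]] := HV _ (Gxi i).
      have [V' [cV' V'g]] := HV _ (Gxi i').
      have mU (x : Omega -> 'rV[R]_k) (Gx : measurable_wrt G x) := shifted_composite_measurable rf Gx.
      have U0 (x : Omega -> 'rV[R]_k) w : 0 <= shifted f mu (x w) w by exact: shifted_ge0.
      case/andP: (l01) => l0 l1; have l'0 : (0 <= 1 - ratr l :> R)%R by rewrite subr_ge0.
      have cZ := condexp_ge0Z sG GM l0 (mU _ (Gxi i)) (U0 _) cV.
      have cZ' := condexp_ge0Z sG GM l'0 (mU _ (Gxi i')) (U0 _) cV'.
      have cD := condexp_ge0D sG GM _ _ _ _ cZ cZ'.
      have : \forall w \ae P, setT w -> Vl w <= (ratr l)%:E * V w + (1 - ratr l)%:E * V' w.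
        (* Conditional expectation of the convexity inequality of the shifted integrand. *)
        apply: (condexp_ge0_le sG GM (mU _ Gl) (U0 _) _ _ cVl (cD _ _ _ _)).
        - by apply: emeasurable_funD; apply: measurable_funeM; exact: mU.
        - by move=> w; rewrite adde_ge0 // mule_ge0 ?lee_fin.
        - by apply: measurable_funeM; exact: mU.
        - by move=> w; rewrite mule_ge0 ?lee_fin.
        - by apply: measurable_funeM; exact: mU.
        - by move=> w; rewrite mule_ge0 ?lee_fin.
        - exact: (sa_cst sG True).
        - by apply: nearW => w _; exact: shifted_convex.
      move=> HVl; have [V0 _ _] := cV; have [V'0 _ _] := cV'.
      near=> w => _.
      have -> : g (ratr l *: xi i w + (1 - ratr l) *: xi i' w)%R w = Vl w - C w by near: w.
      have -> : g (xi i w) w = V w - C w by near: w.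
      have -> : g (xi i' w) w = V' w - C w by near: w.
      have fCw : C w \is a fin_num by near: w.
      have Vlw : setT w -> Vl w <= (ratr l)%:E * V w + (1 - ratr l)%:E * V' w by near: w.
      have {}Vlw := Vlw Logic.I.
      rewrite !leeBlDr // -(fineK fCw) -!EFinD => Vq V'q.
      apply: le_trans Vlw _.
      apply: (@le_trans _ _ ((ratr l)%:E * (ratr i.2 + fine (C w))%:E +
         (1 - ratr l)%:E * (ratr i'.2 + fine (C w))%:E)).
        by apply: leeD; apply: lee_wpmul2l; rewrite ?lee_fin.
      by rewrite -!EFinM -EFinD lee_fin le_eqVlt; apply/orP; left; apply/eqP; ring.
    apply: filterS => w H i i' l l0 l1; apply: (H (i, i', l)) => /=.
    by rewrite l0.
  + apply: (@le_of_dense _ _ (g^~ w) (cst (- fine (C w))%:E) (fun i => xi i w)).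
    * apply: epigraph_closed => a /=.
      have [h|h] := leP (- fine (C w))%:E a%:E.
        by rewrite (_ : [set _ | _] = setT); [exact: closedT|apply/seteqP; split].
      by rewrite (_ : [set _ | _] = set0); [exact: closed0|apply/seteqP; split=> x //=; rewrite leNgt h].
    * by move=> x e q; exact: dxi.
    * near: w; apply: ae_forall_countable => i.
      have [V [[V0 _ _] Vg]] := HV _ (Gxi i).
      near=> w; have -> : g (xi i w) w = V w - C w by near: w.
      have fCw : C w \is a fin_num by near: w.
      by rewrite /= EFinN fineK // -[leLHS]add0e leeD2r.
- move=> i; apply: (measurable_wrt_measurable sG GM).
  exact: normal_inf_over (@rational_ball_open R k i).
Unshelve. all: by end_near.
Qed.

Lemma is_condexp_unique (X X' Z Z' : Omega -> \bar R) :
  is_condexp P G X Z -> is_condexp P G X' Z' -> (\forall w \ae P, X w = X' w) ->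
  \forall w \ae P, Z w = Z' w.
Proof.
move=> [mX [Yp [Ym [cYp cYm ZE]]]] [mX' [Yp' [Ym' [cYp' cYm' Z'E]]]] XX'.
have Ep : \forall w \ae P, Yp w = Yp' w.
  apply: (condexp_ge0_unique sG GM _ _ _ _ cYp cYp') => //;
    [exact: measurable_funepos|exact: measurable_funepos|].
  by apply: filterS XX' => w XE; rewrite !funeposE XE.
have Em : \forall w \ae P, Ym w = Ym' w.
  apply: (condexp_ge0_unique sG GM _ _ _ _ cYm cYm') => //;
    [exact: measurable_funeneg|exact: measurable_funeneg|].
  by apply: filterS XX' => w XE; rewrite !funenegE XE.
near=> w; have -> : Z w = (Yp w - Ym w)%dE by near: w.
have -> : Yp w = Yp' w by near: w.
have -> : Ym w = Ym' w by near: w.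
by apply/esym; near: w.
Unshelve. all: by end_near.
Qed.

(** Both inequalities are tested on the selections that are dense in the
    sublevel sets of the larger side. *)
Theorem condexp_integrand_unique (k : nat) (f f' g g' : 'rV[R]_k -> Omega -> \bar R) :
  (\forall w \ae P, forall x, f x w = f' x w) ->
  is_condexp_integrand P G f g -> is_condexp_integrand P G f' g' ->
  \forall w \ae P, forall x, g x w = g' x w.
Proof.
move=> ff' [ng cg] [ng' cg'].
have [xi [Gxi dxi]] := dense_selections sG ng.
have [xi' [Gxi' dxi']] := dense_selections sG ng'.
have E (x : Omega -> 'rV[R]_k) : measurable_wrt G x -> \forall w \ae P, g (x w) w = g' (x w) w.
  move=> Gx; apply: is_condexp_unique (cg x Gx) (cg' x Gx) _.
  by apply: filterS ff' => w.
have E1 := ae_forall_countable (fun i => E _ (Gxi i)).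
have E2 := ae_forall_countable (fun i => E _ (Gxi' i)).
near=> w => x; apply/eqP; rewrite eq_le; apply/andP; split.
  apply: (@le_of_dense _ _ (g'^~ w) (g^~ w) (fun i => xi' i w) (ng.1 w)).
    by move=> y e q; exact: dxi'.
  by move=> i; have -> // : forall i, g (xi' i w) w = g' (xi' i w) w by near: w.
apply: (@le_of_dense _ _ (g^~ w) (g'^~ w) (fun i => xi i w) (ng'.1 w)).
  by move=> y e q; exact: dxi.
by move=> i; have -> // : forall i, g (xi i w) w = g' (xi i w) w by near: w.
Unshelve. all: by end_near.
Qed.

End conditional_expectation_of_integrands.

(** * Orthogonality and directions of recession *)

Section orthogonality.
Context (R : realType) (k : nat).
Implicit Types (x y u : 'rV[R]_k) (A L : set 'rV[R]_k).

Definition dot x y : R := (x *m y^T)%R ord0 ord0.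

Lemma dotE x y : dot x y = (\sum_j x ord0 j * y ord0 j)%R.
Proof. by rewrite /dot mxE; apply: eq_bigr => j _; rewrite !mxE. Qed.

Lemma dot_eq0 x y : dot x y = 0%R <-> (x *m y^T)%R = 0%R.
Proof.
rewrite /dot; split=> [xy|->]; last by rewrite mxE.
by apply/matrixP => i j; rewrite !ord1 xy mxE.
Qed.

Lemma sqnormE x : sqnorm x = dot x x.
Proof. by rewrite dotE; apply: eq_bigr => j _; rewrite expr2. Qed.

Lemma sqnorm_ge0 x : (0 <= sqnorm x)%R.
Proof. by apply: sumr_ge0 => j _; exact: sqr_ge0. Qed.

Lemma sqnorm_line x u (t : R) :
  sqnorm (x + t *: u)%R = (sqnorm x + 2 * t * dot x u + t ^+ 2 * sqnorm u)%R.
Proof.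
rewrite /sqnorm dotE !mulr_sumr -!big_split /=; apply: eq_bigr => j _.
rewrite !mxE; ring.
Qed.

(** Moving from [x] by [- s / (q + 1)] times [u], with [s] the scalar product of
    [x] and [u] and [q] the squared norm of [u], would decrease the norm unless
    [s = 0]. *)
Lemma min_sqnorm_orthogonal A L x : linear_subspace L ->
  (forall y u, A y -> L u -> A (y + u)%R) -> A x ->
  (forall y, A y -> (sqnorm x <= sqnorm y)%R) -> orthogonal_to x L.
Proof.
move=> [L0 LL] AL Ax xmin u Lu; apply/dot_eq0.
have q0 := sqnorm_ge0 u; set q := sqnorm u in q0 *; set s := dot x u.
have q1 : (0 < q + 1)%R by lra.
have := xmin (x + (- s / (q + 1)) *: u)%R (AL _ _ Ax _).
have Lt : L ((- s / (q + 1)) *: u)%R by have := LL (- s / (q + 1))%R u 0%R Lu L0; rewrite addr0.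
move=> /(_ Lt); rewrite sqnorm_line -/s -/q => h.
have {}h : (0 <= - (s ^+ 2 * (q + 2)) / (q + 1) ^+ 2)%R.
  apply: (@le_trans _ _ (2 * (- s / (q + 1)) * s + (- s / (q + 1)) ^+ 2 * q)%R); first by lra.
  rewrite le_eqVlt; apply/orP; left; apply/eqP; field; lra.
move: h; rewrite pmulr_lge0 ?invr_gt0 ?exprn_gt0 // oppr_ge0 => h.
have s2 := sqr_ge0 s; have s2q : (0 <= s ^+ 2 * q)%R by rewrite mulr_ge0.
rewrite mulrDr in h; apply/eqP; rewrite -sqrf_eq0 eq_le s2 andbT.
by move: (s ^+ 2)%R s2q h => a; lra.
Qed.

Lemma dot_continuous u : continuous (dot^~ u).
Proof.
rewrite (_ : dot^~ u = fun x => \sum_j x ord0 j * u ord0 j)%R; last first.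
  by apply/funext => x; exact: dotE.
apply: sum_continuous => j x.
have cj : {for x, continuous (fun y : 'rV[R]_k => y ord0 j)} by exact: coord_continuous.
have cu : {for x, continuous (fun y : 'rV[R]_k => u ord0 j)} by exact: cst_continuous.
exact: (continuousM cj cu).
Qed.

Lemma orthogonal_closed L : closed [set x | orthogonal_to x L].
Proof.
have -> : [set x | orthogonal_to x L] = \bigcap_(u in L) [set x | dot x u = 0%R].
  by apply/seteqP; split=> x H u Lu; apply/dot_eq0; exact: H.
apply: closed_bigI => u _.
have c0 : closed [set x : R | x = 0%R] by exact: closed_eq.
have cd : {in ~` dot^~ u @^-1` [set x : R | x = 0%R], continuous (dot^~ u)}.
  by move=> x _; exact: dot_continuous.
exact: (preimage_closed cd c0).
Qed.

End orthogonality.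

Section recession_directions.
Context (R : realType) (k : nat) (f : 'rV[R]_k -> \bar R) (M : R).
Hypothesis cf : closed (epigraph f).
Hypothesis vf : convex_set (epigraph f).
Hypothesis Mf : forall z, M%:E <= f z.

Lemma closed_epigraph_ray (u d : 'rV[R]_k) (c e : R) :
  (forall t, (0 < t <= 1)%R -> f (u + t *: d)%R <= (c + t * e)%:E) -> f u <= c%:E.
Proof.
move=> H; rewrite leNgt; apply/negP => nfu.
have [r r0 sep] := epigraph_separation cf nfu.
have D0 : (0 < `|d| + `|e| + 1)%R by rewrite ltr_wpDl ?addr_ge0.
pose t := Num.min 1%R (r / 2 / (`|d| + `|e| + 1))%R.
have t0 : (0 < t)%R by rewrite lt_min ltr01 !divr_gt0.
have tD : (t * (`|d| + `|e| + 1) <= r / 2)%R by rewrite -ler_pdivlMr // /t ge_min lexx orbT.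
have := H t; rewrite t0 {1}/t ge_min lexx => /(_ isT); rewrite leNgt => /negP; apply.
apply: sep; rewrite opprD addrA subrr sub0r normrN ?normrZ ?normrM (gtr0_norm t0).
  have : (t * `|d| <= t * (`|d| + `|e| + 1))%R by rewrite ler_pM2l // -addrA lerDl addr_ge0.
  lra.
have : (t * `|e| <= t * (`|d| + `|e| + 1))%R by rewrite ler_pM2l // -addrA addrCA lerDl addr_ge0.
lra.
Qed.

Variables (xbar : 'rV[R]_k) (beta : R).

(** The condition [recession f v <= 0], freed of the quotient and of the supremum. *)
Definition recedes (v : 'rV[R]_k) : Prop :=
  forall l : R, (0 < l)%R -> f (l *: v + xbar)%R <= beta%:E.

(** A direction of recession at one base point is one at every point: [z + v] is
    the limit as [t] tends to [0] of the convex combinations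
    [t (xbar + v / t) + (1 - t) z]. *)
Lemma recedes_le v z : recedes v -> f (z + v)%R <= f z.
Proof.
move=> rv; have := Mf z; case fz : (f z) => [c| |] // _; last exact: leey.
apply: (@closed_epigraph_ray _ (xbar - z)%R c (beta - c)%R) => t /andP[t0 t1].
have t01 : (0 <= t <= 1)%R by rewrite ltW.
have /convex_epigraphP cvx := vf.
have h1 : f (t^-1 *: v + xbar)%R <= beta%:E by apply: rv; rewrite invr_gt0.
have h2 : f z <= c%:E by rewrite fz.
have := cvx _ _ _ _ _ t01 h1 h2.
rewrite scalerDr scalerA divff ?gt_eqF // scale1r.
rewrite (_ : (v + t *: xbar + (1 - t) *: z = z + v + t *: (xbar - z))%R); last first.
  by apply/rowP => j; rewrite !mxE; ring.
by rewrite (_ : (t * beta + (1 - t) * c = c + t * (beta - c))%R) //; ring.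
Qed.

Lemma recedes_closed : closed [set v | recedes v].
Proof.
have -> : [set v | recedes v] = \bigcap_(l in [set l : R | (0 < l)%R])
    [set v | f (l *: v + xbar)%R <= beta%:E].
  by apply/seteqP; split=> v H l l0; exact: H.
apply: closed_bigI => l _.
have caff : continuous (fun v : 'rV[R]_k => l *: v + xbar)%R.
  move=> v; have c1 : {for v, continuous (fun v : 'rV[R]_k => l *: v)%R}.
    exact: scaler_continuous.
  have c2 : {for v, continuous (fun v : 'rV[R]_k => xbar)} by exact: cst_continuous.
  exact: (continuousD c1 c2).
exact: (preimage_closed (fun v _ => caff v) (epigraph_sublevel_closed cf)).
Qed.

End recession_directions.

(** * Partial minimisation of a convex function *)

Lemma norm_ball_compact (R : realType) (k : nat) (rho : R) :
  compact [set y : 'rV[R]_k | (`|y| <= rho)%R].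
Proof.
apply: bounded_closed_compact.
  exists rho; split; first by rewrite num_real.
  by move=> m rm y /= yr; exact: le_trans yr (ltW rm).
rewrite (_ : [set _ | _] = closed_ball_ Num.norm 0%R rho).
  exact: closed_closed_ball_.
by apply/seteqP; split=> y /=; rewrite /closed_ball_ /= sub0r normrN.
Qed.

Section partial_minimisation.
Context (R : realType) (a b : nat) (f : 'rV[R]_(a + b) -> \bar R) (M : R).
Hypothesis cf : closed (epigraph f).
Hypothesis vf : convex_set (epigraph f).
Hypothesis Mf : forall z, M%:E <= f z.

Definition null_space : set 'rV[R]_b :=
  [set y | recession f (row_mx 0 y) <= 0].

Hypothesis linL : linear_subspace null_space.

Lemma row_mx_right_continuous (x : 'rV[R]_a) :
  continuous (fun y : 'rV[R]_b => row_mx x y).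
Proof.
move=> y; have c : (x, z) @[z --> y] --> (x, y).
  apply: (@cvg_pair _ _ _ (nbhs y) (nbhs x) (nbhs y) _ _ _ (cst x) idfun) => //.
  exact: cvg_cst.
exact: (cvg_comp _ _ c (@row_mx_continuous R a b (x, y))).
Qed.

Lemma partial_sublevel_closed x (c : R) : closed [set y | f (row_mx x y) <= c%:E].
Proof.
exact: (preimage_closed (fun y _ => @row_mx_right_continuous x y)
  (epigraph_sublevel_closed cf)).
Qed.

Section nonempty_domain.
Variables (xbar : 'rV[R]_(a + b)) (beta : R).
Hypothesis fxbar : f xbar = beta%:E.
Hypothesis null_spaceP : forall y, null_space y <-> recedes f xbar beta (row_mx 0 y).

(** Both [u] and [- u] are directions of recession. *)
Lemma null_space_constant x y u : null_space u ->
  f (row_mx x (y + u)%R) = f (row_mx x y).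
Proof.
move=> Lu; have [L0 LL] := linL.
have le v w : null_space v -> f (row_mx x (w + v)%R) <= f (row_mx x w).
  move=> /null_spaceP rv; have := recedes_le cf vf Mf (row_mx x w) rv.
  by rewrite add_row_mx addr0.
apply/eqP; rewrite eq_le le //=.
have Lnu : null_space (- u)%R by have := LL (-1)%R u 0%R Lu L0; rewrite scaleN1r addr0.
by have := le _ (y + u)%R Lnu; rewrite addrK.
Qed.

Lemma null_space_closed : closed null_space.
Proof.
have -> : null_space = (fun y => row_mx 0%R y) @^-1` [set v | recedes f xbar beta v].
  by apply/seteqP; split=> y /null_spaceP.
have cre : closed [set v | recedes f xbar beta v] by exact: recedes_closed.
exact: (preimage_closed (fun y _ => @row_mx_right_continuous 0%R y) cre).
Qed.

(** The point of least norm of [y + null_space]. *)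
Lemma orthogonal_representative x y : exists y',
  orthogonal_to y' null_space /\ f (row_mx x y') = f (row_mx x y).
Proof.
have [L0 LL] := linL; pose A := [set z | null_space (z - y)%R].
have cA : closed A.
  apply: (@preimage_closed _ _ (fun z : 'rV[R]_b => z - y)%R null_space) null_space_closed => z _.
  have c1 : {for z, continuous (@id 'rV[R]_b)} by exact: cvg_id.
  have c2 : {for z, continuous (fun z : 'rV[R]_b => y)} by exact: cst_continuous.
  exact: (continuousB c1 c2).
have [|y' [Ay' ymin]] := closed_has_min_sqnorm cA.
  by exists y; rewrite /A /= subrr.
exists y'; split.
  apply: (min_sqnorm_orthogonal linL _ Ay' ymin) => z u Az Lu.
  rewrite /A /= -addrA (addrC u) addrA.
  by have := LL 1%R _ _ Az Lu; rewrite scale1r.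
by rewrite -(null_space_constant x y Ay') addrC subrK.
Qed.

(** The unit vectors [y] orthogonal to the null space form a compact set, and none
    of them is a direction of recession, so that [f] exceeds [beta] at
    [xbar + l (0, y)] for some [l].  If [f (x, s y')] were at most [c] with [y']
    close to [y] and [s] large, then the convex combination of [(x, s y')] and
    [xbar] with weight [l / s] would be close to [xbar + l (0, y)] and have value
    close to [beta], contradicting lower semicontinuity. *)
Lemma orthogonal_sublevel_bounded (r c : R) : exists rho : R, forall x y,
  (`|x| <= r)%R -> orthogonal_to y null_space -> f (row_mx x y) <= c%:E ->
  (`|y| <= rho)%R.
Proof.
pose S := [set y : 'rV[R]_b | (`|y| = 1)%R] `&` [set y | orthogonal_to y null_space].
have cS : compact S.
  apply: bounded_closed_compact.
    by exists 1%R; split => // m m1 y [/= -> _]; exact: ltW.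
  apply: closedI; last exact: orthogonal_closed.
  have c1 : closed [set x : R | x = 1%R] by exact: closed_eq.
  have cn : {in ~` (fun y : 'rV[R]_b => `|y|%R) @^-1` [set x : R | x = 1%R],
      continuous (fun y : 'rV[R]_b => `|y|%R)}.
    by move=> y _; exact: norm_continuous.
  exact: (preimage_closed cn c1).
have : \forall s \near +oo%R, S `<=`
    (fun y => forall x, (`|x| <= r)%R -> ~ f (row_mx x (s *: y)%R) <= c%:E).
  apply: (compact_near_coveringP S).1 => // y [/= y1 yL].
  have : ~ null_space y.
    move=> Ly; move: (yL y Ly) => /dot_eq0; rewrite -sqnormE => y0.
    suff : y = 0%R by move=> yE; move: y1; rewrite yE normr0 => /eqP; rewrite eq_sym oner_eq0.
    apply/rowP => j; rewrite mxE; apply/eqP; rewrite -sqrf_eq0 eq_le sqr_ge0 andbT -y0.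
    by rewrite /sqnorm (bigD1 j) //= lerDl sumr_ge0 // => i _; exact: sqr_ge0.
  move=> nLy.
  have [l l0 /negP] : exists2 l : R, (0 < l)%R & ~ (f (l *: row_mx 0 y + xbar)%R <= beta%:E).
    apply: contrapT => H; apply: nLy; apply/null_spaceP => l l0.
    by apply: contrapT => nf; apply: H; exists l.
  rewrite -ltNge => fl.
  have [e e0 sep] := epigraph_separation cf fl.
  pose D := (r + `|xbar| + `|c - beta| + 1)%R.
  exists ([set y' | `|y - y'| < e / 2 / l]%R,
      [set s | 0 < s /\ l / s <= 1 /\ l / s * D < e / 2]%R).
    split => /=; first by apply/near_norm; exists (e / 2 / l)%R => //; rewrite !divr_gt0.
    have e2 : (0 < e / 2)%R by rewrite divr_gt0.
    exists (Num.max l (l * `|D| / (e / 2)))%R; split; first by rewrite num_real.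
    move=> s; rewrite gt_max ltr_pdivrMr // => /andP[ls lDs].
    have s0 : (0 < s)%R by lra.
    split => //; split; first by rewrite ler_pdivrMr // mul1r ltW.
    rewrite mulrAC ltr_pdivrMr // mulrC; apply: le_lt_trans (_ : _ <= l * `|D|)%R _.
      by rewrite mulrC ler_pM2l // ler_norm.
    by rewrite (mulrC (e / 2)%R).
  move=> [y' s] /= [yy' [s0 [ls1 lsD]]] x xr fxs.
  have ls0 : (0 < l / s)%R by rewrite divr_gt0.
  pose z := ((l / s) *: row_mx x (s *: y') + (1 - l / s) *: xbar)%R.
  have /convex_epigraphP cvx := vf.
  have l01 : (0 <= l / s <= 1)%R by rewrite ltW.
  have fb : f xbar <= beta%:E by rewrite fxbar.
  have := cvx _ _ _ _ _ l01 fxs fb; rewrite -/z leNgt => /negP; apply.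
  have D1 : (r + `|xbar| <= D)%R by rewrite /D -addrA lerDl addr_ge0.
  have D2 : (`|c - beta| <= D)%R.
    have r0 : (0 <= r)%R by apply: le_trans xr.
    by have := normr_ge0 xbar; rewrite /D; lra.
  apply: sep.
    have -> : (l *: row_mx 0 y + xbar - z =
        l *: row_mx 0 (y - y') - (l / s) *: (row_mx x 0 - xbar))%R.
      rewrite /z; apply/rowP => j; rewrite !mxE; case: (fintype.split j) => i; rewrite !mxE; field; lra.
    apply: le_lt_trans (ler_normB _ _) _; rewrite (normrZ l) (normrZ (l / s)%R).
    have h1 : (`|l| * `|row_mx (0 : 'rV[R]_a) (y - y')| < e / 2)%R.
      rewrite gtr0_norm // -ltr_pdivlMl // [ltRHS]mulrC.
      by apply/norm_row_mx_lt; rewrite ?normr0 !divr_gt0.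
    have h2 : (`|row_mx x (0 : 'rV[R]_b) - xbar| <= D)%R.
      apply: le_trans (ler_normB _ _) (le_trans _ D1); rewrite lerD2r.
      apply: le_trans xr; apply/ler_addgt0Pr => t t0; apply/ltW/norm_row_mx_lt.
        by rewrite ltr_wpDl.
      by rewrite normr0 ltrDl ltr_wpDl.
    have h3 : (`|l / s| * `|row_mx x (0 : 'rV[R]_b) - xbar| <= l / s * D)%R.
      by rewrite gtr0_norm // ler_pM2l.
    apply: (@lt_le_trans _ _ (e / 2 + e / 2)%R); last by lra.
    by apply: ltrD => //; exact: le_lt_trans lsD.
  have -> : (beta - (l / s * c + (1 - l / s) * beta) = - (l / s * (c - beta)))%R by ring.
  rewrite normrN normrM gtr0_norm //; apply: le_lt_trans (_ : _ <= l / s * D)%R _.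
    by rewrite ler_pM2l.
  by apply: lt_trans lsD _; lra.
move=> [r0 [_ Hr]].
exists (Num.max 0 (r0 + 1))%R => x y xr yL fxy; rewrite leNgt; apply/negP.
rewrite gt_max => /andP[y0 yr].
have y1 : (r0 < `|y|)%R by lra.
apply: (Hr _ y1 (`|y|^-1 *: y)%R _ x xr).
  split => /=.
    by rewrite normrZ normfV normr_id mulVf // gt_eqF.
  by move=> u Lu; rewrite -scalemxAl yL // scaler0.
by rewrite scalerA divff ?gt_eqF // scale1r.
Qed.

Lemma proper_partial_minimum_attained x : exists y, forall y', f (row_mx x y) <= f (row_mx x y').
Proof.
have [[y0 fy0]|nf] := pselect (exists y, f (row_mx x y) < +oo); last first.
  exists 0%R => y'; rewrite leNgt; apply/negP => H; apply: nf; exists y'.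
  by apply: lt_le_trans H _; exact: leey.
have fin y : f (row_mx x y) < +oo -> exists c : R, f (row_mx x y) = c%:E.
  by have := Mf (row_mx x y); case: (f _) => [c| |] // _ _; exists c.
have [c0 fc0] := fin y0 fy0.
have [rho Hrho] := orthogonal_sublevel_bounded `|x|%R c0.
pose K := [set y : 'rV[R]_b | (`|y| <= rho)%R].
have cK : compact K by exact: norm_ball_compact.
(* The levels at most [c0] that are reached form a chain of compact sublevel sets
   once the variable is restricted to [K]. *)
pose J := [set c : R | (c <= c0)%R /\ exists y, f (row_mx x y) <= c%:E].
have hit c : J c -> exists y, f (row_mx x y) <= c%:E /\ K y.
  move=> [cc0 [y fy]]; have [y' [y'L fy']] := orthogonal_representative x y.
  exists y'; rewrite fy'; split => //; apply: (Hrho x) => //.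
  by rewrite fy'; apply: le_trans fy _; rewrite lee_fin.
have Jc0 : J c0 by split => //; exists y0; rewrite fc0.
have [||||y [_ yJ]] := @compact_chain _ _ J (fun c => [set y | f (row_mx x y) <= c%:E]) K cK.
- by have [y [_ Ky]] := hit c0 Jc0; exists y.
- move=> c _; exact: partial_sublevel_closed.
- by move=> c /hit.
- by move=> c c' _ _; have [h|/ltW h] := leP c c'; [left|right] => y /= fy;
    apply: le_trans fy _; rewrite lee_fin.
exists y => y'; rewrite leNgt; apply/negP => fyy'.
have [c' fc'] := fin y' (lt_le_trans fyy' (leey _)).
have [h|h] := leP c' c0.
  suff /yJ : J c' by rewrite /= -fc' leNgt fyy'.
  by split => //; exists y'; rewrite fc'.
have /= := yJ c0 Jc0; rewrite leNgt; apply/negP/negPn.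
by apply: lt_trans fyy'; rewrite fc' lte_fin.
Qed.

Lemma proper_partial_sublevel_projection_closed (c : R) :
  closed [set x | exists y, f (row_mx x y) <= c%:E].
Proof.
move=> x clx.
have [rho Hrho] := orthogonal_sublevel_bounded (`|x| + 1)%R c.
pose K := [set y : 'rV[R]_b | (`|y| <= rho)%R].
have cK : compact K by exact: norm_ball_compact.
apply: contrapT => nx.
have near1 : \forall x' \near x, K `<=` (fun y => ~ f (row_mx x' y) <= c%:E).
  apply: ((compact_near_coveringP K).1 cK _ (nbhs x)
      (fun x' y => ~ f (row_mx x' y) <= c%:E)) => y Ky.
  have : nbhs (row_mx x y) (~` [set z | f z <= c%:E]).
    apply: open_nbhs_nbhs; split; first by rewrite openC; exact: epigraph_sublevel_closed cf.
    by move=> fy; apply: nx; exists y.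
  move=> /(@row_mx_continuous R a b (x, y))[[V1 V2] /= [V1x V2y] sub].
  exists (V2, V1) => //= -[y' x'] /= [? ?].
  exact: (sub (x', y')).
have near2 : \forall x' \near x, (`|x'| <= `|x| + 1)%R.
  apply/near_norm; exists 1%R => // x' /= xx'.
  rewrite -(subKr x x'); apply: le_trans (ler_normB _ _) _.
  by rewrite lerD2l ltW.
have [x' [[y fy] [H1 H2]]] := clx _ (filterI near1 near2).
(* The minimising variable can be taken orthogonal to the null space, hence in
   the compact ball [K], uniformly in [x']. *)
have [y' [y'L fy']] := orthogonal_representative x' y.
apply: (H1 y'); last by rewrite fy'.
by apply: Hrho H2 y'L _; rewrite fy'.
Qed.

End nonempty_domain.

Lemma recession_le0 (beta l : R) (x : \bar R) : (0 < l)%R ->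
  (x - beta%:E) * (l^-1)%:E <= 0 <-> x <= beta%:E.
Proof.
move=> l0; have li : (0 < l^-1)%R by rewrite invr_gt0.
case: x => [r| |] /=.
- by rewrite -EFinB -EFinM !lee_fin pmulr_lle0 // subr_le0.
- by rewrite addye // mulyr gtr0_sg // mul1e !leye_eq.
- by rewrite addNye mulNyr gtr0_sg // mul1e !leNye.
Qed.

Lemma null_space_recedes : (exists z, f z < +oo) -> exists xbar beta,
  f xbar = beta%:E /\
  forall y, null_space y <-> recedes f xbar beta (row_mx 0%R y).
Proof.
move=> [z fz]; have dom : effective_domain f !=set0 by exists z.
pose xbar := xget 0%R (effective_domain f).
have fx : f xbar < +oo by rewrite /xbar; exact: (xgetPex 0%R dom).
have [beta fb] : exists beta : R, f xbar = beta%:E.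
  by have := Mf xbar; case: (f xbar) fx => [beta| |] // _ _; exists beta.
exists xbar, beta; split => // y; rewrite /null_space /= /recession (asboolT dom) -/xbar fb.
split=> [H l l0|H].
  apply/(recession_le0 beta _ l0); apply: le_trans H; apply: ereal_sup_ubound.
  by exists l.
apply: ge_ereal_sup => _ [l /= l0 <-]; apply/(recession_le0 beta _ l0).
exact: H.
Qed.

Lemma partial_minimum_attained x : exists y, forall y', f (row_mx x y) <= f (row_mx x y').
Proof.
have [dom|ndom] := pselect (exists z, f z < +oo).
  have [xbar [beta [fb nP]]] := null_space_recedes dom.
  exact: (proper_partial_minimum_attained fb nP x).
exists 0%R => y'; rewrite leNgt; apply/negP => H; apply: ndom; exists (row_mx x y').
by apply: lt_le_trans H _; exact: leey.
Qed.

Lemma null_space_invariant x y u : null_space u ->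
  f (row_mx x (y + u)%R) = f (row_mx x y).
Proof.
move=> Lu; have [dom|ndom] := pselect (exists z, f z < +oo).
  have [xbar [beta [fb nP]]] := null_space_recedes dom.
  exact: (null_space_constant nP).
have fy z : f z = +oo.
  by apply/eqP; rewrite eq_le leey /= leNgt; apply/negP => H; apply: ndom; exists z.
by rewrite !fy.
Qed.

(** For [a = dims n t] and [b = n t] this is, by conversion, the value of
    [inf_last] at a fixed [w]. *)
Definition partial_minimum (x : 'rV[R]_a) : \bar R :=
  ereal_inf (range (fun y : 'rV[R]_b => f (row_mx x y))).

Lemma partial_minimum_le x y : partial_minimum x <= f (row_mx x y).
Proof. by apply: ereal_inf_lbound; exists y. Qed.

Lemma partial_minimumE x : exists y, partial_minimum x = f (row_mx x y).
Proof.
have [y ymin] := partial_minimum_attained x; exists y.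
apply/eqP; rewrite eq_le partial_minimum_le /=.
by apply: le_ereal_inf_tmp => _ [y' _ <-].
Qed.

Lemma partial_minimum_ge x : M%:E <= partial_minimum x.
Proof. by apply: le_ereal_inf_tmp => _ [y' _ <-]. Qed.

Lemma partial_minimum_epigraph_closed : closed (epigraph partial_minimum).
Proof.
apply: epigraph_closed => c.
have -> : [set x | partial_minimum x <= c%:E] = [set x | exists y, f (row_mx x y) <= c%:E].
  apply/seteqP; split=> x /=; first by have [y ->] := partial_minimumE x; exists y.
  by move=> [y]; exact: le_trans (partial_minimum_le x y).
have [dom|ndom] := pselect (exists z, f z < +oo).
  have [xbar [beta [fb nP]]] := null_space_recedes dom.
  exact: (proper_partial_sublevel_projection_closed fb nP).
rewrite (_ : [set _ | _] = set0); first exact: closed0.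
apply/seteqP; split=> x //= [y fy]; apply: ndom; exists (row_mx x y).
exact: le_lt_trans fy (ltry _).
Qed.

Lemma partial_minimum_epigraph_convex : convex_set (epigraph partial_minimum).
Proof.
apply/convex_epigraphP => x x' c c' t t01.
have [y ->] := partial_minimumE x; have [y' ->] := partial_minimumE x' => fy fy'.
apply: le_trans (partial_minimum_le _ (t *: y + (1 - t) *: y')%R) _.
have /convex_epigraphP cvx := vf.
by rewrite -add_row_mx -!scale_row_mx; exact: cvx.
Qed.

End partial_minimisation.

(** * Extended expectations *)

Section extended_expectation.
Context d (Omega : measurableType d) (R : realType) (P : probability Omega R).
Implicit Types (X Y U : Omega -> \bar R) (mu : Omega -> R).

Lemma ge0_integrable_lty X : measurable_fun setT X -> (forall w, 0 <= X w) ->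
  P.-integrable setT X <-> \int[P]_w X w < +oo.
Proof.
move=> mX X0; rewrite -(eq_integral _ _ (fun w _ => gee0_abs (X0 w))).
by split=> [/integrableP[]//|h]; apply/integrableP.
Qed.

Lemma extended_expectation_le X Y : measurable_fun setT X -> measurable_fun setT Y ->
  (\forall w \ae P, X w <= Y w) -> extended_expectation P X <= extended_expectation P Y.
Proof.
move=> mX mY XY; rewrite /extended_expectation.
case: (asboolP (P.-integrable setT Y^\+)) => iY; last exact: leey.
have lp : \int[P]_w X^\+ w <= \int[P]_w Y^\+ w.
  apply: ae_ge0_le_integral => //; [exact: measurable_funepos|exact: measurable_funepos|].
  apply: filterS XY => w XYw _; rewrite !funeposE ge_max !le_max XYw lexx orbT.
  by rewrite orTb.
have ln : \int[P]_w Y^\- w <= \int[P]_w X^\- w.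
  apply: ae_ge0_le_integral => //; [exact: measurable_funeneg|exact: measurable_funeneg|].
  apply: filterS XY => w XYw _; rewrite !funenegE ge_max !le_max leeN2 XYw lexx orbT.
  by rewrite orTb.
have fY : \int[P]_w Y^\+ w < +oo.
  by apply/ge0_integrable_lty => //; exact: measurable_funepos.
rewrite asboolT; last first.
  by apply/ge0_integrable_lty => //; [exact: measurable_funepos|exact: le_lt_trans lp fY].
by rewrite integralE [leRHS]integralE; apply: leeB.
Qed.

Lemma extended_expectation_ae X Y : measurable_fun setT X -> measurable_fun setT Y ->
  (\forall w \ae P, X w = Y w) -> extended_expectation P X = extended_expectation P Y.
Proof.
move=> mX mY XY; apply/eqP; rewrite eq_le.
by apply/andP; split; apply: extended_expectation_le => //; apply: filterS XY => w ->.
Qed.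

(** Expectations of functions bounded below are computed without infinite
    differences by adding the bound. *)
Lemma extended_expectation_shift mu X U :
  (forall w, (0 <= mu w)%R) -> P.-integrable setT (EFin \o mu) ->
  measurable_fun setT X -> measurable_fun setT U -> (forall w, 0 <= U w) ->
  (\forall w \ae P, U w = X w + (mu w)%:E) ->
  extended_expectation P X = \int[P]_w U w - \int[P]_w (mu w)%:E.
Proof.
move=> mu0 imu mX mU U0 UX.
have mmu : measurable_fun setT (EFin \o mu) := measurable_int _ imu.
have mp : measurable_fun setT X^\+ by exact: measurable_funepos.
have mn : measurable_fun setT X^\- by exact: measurable_funeneg.
have lb : \forall w \ae P, (- mu w)%:E <= X w.
  apply: filterS UX => w UE; have := U0 w; rewrite UE.
  by rewrite EFinN -leeBlDr // sub0e.
have E : \int[P]_w X^\+ w + \int[P]_w (mu w)%:E = \int[P]_w U w + \int[P]_w X^\- w.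
  rewrite -!ge0_integralD //; last by move=> w _; rewrite lee_fin.
  apply: ge0_ae_eq_integral => //.
  - exact: emeasurable_funD.
  - exact: emeasurable_funD.
  - by move=> w _; rewrite adde_ge0 ?lee_fin.
  - by move=> w _; rewrite adde_ge0.
  - near=> w => _; have -> : U w = X w + (mu w)%:E by near: w.
    by apply: funeposneg_shift; near: w.
have fmu : \int[P]_w (mu w)%:E \is a fin_num by exact: integrable_fin_num.
have n0 : 0 <= \int[P]_w X^\- w by exact: integral_ge0.
have fn : \int[P]_w X^\- w \is a fin_num.
  rewrite ge0_fin_numE //; apply: (@le_lt_trans _ _ (\int[P]_w (mu w)%:E)).
    apply: ae_ge0_le_integral => //; first by move=> w _; rewrite lee_fin.
    apply: filterS lb => w + _; rewrite funenegE ge_max lee_fin mu0 andbT.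
    by rewrite EFinN leeNl.
  by rewrite ltey_eq fmu.
have -> : extended_expectation P X = \int[P]_w X^\+ w - \int[P]_w X^\- w.
  rewrite /extended_expectation; case: asboolP => iX; first exact: integralE.
  have -> : \int[P]_w X^\+ w = +oo.
    apply/eqP; rewrite -leye_eq leNgt; apply/negP => H; apply: iX.
    exact/(ge0_integrable_lty mp (funepos_ge0 X)).
  by move: fn; case: (\int[P]_w X^\- w) => [r| |].
have : 0 <= \int[P]_w X^\+ w by exact: integral_ge0.
have : 0 <= \int[P]_w U w by exact: integral_ge0.
move: E fmu fn; case: (\int[P]_w (mu w)%:E) => [c| |] //; case: (\int[P]_w X^\- w) => [y| |] //.
case: (\int[P]_w X^\+ w) => [p| |] //; case: (\int[P]_w U w) => [v| |] //= [] pcvy _ _ _ _.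
by congr EFin; lra.
Unshelve. all: by end_near.
Qed.

Lemma extended_expectation_eq_ae X Y : measurable_fun setT X -> measurable_fun setT Y ->
  (\forall w \ae P, X w <= Y w) -> extended_expectation P X = extended_expectation P Y ->
  extended_expectation P Y \is a fin_num -> \forall w \ae P, X w = Y w.
Proof.
move=> mX mY XY XYE fY.
have int Z : measurable_fun setT Z -> extended_expectation P Z \is a fin_num ->
    P.-integrable setT Z /\ extended_expectation P Z = \int[P]_w Z w.
  move=> mZ; rewrite /extended_expectation; case: asboolP => // iZ; rewrite integralE => fZ.
  have mp : measurable_fun setT Z^\+ by exact: measurable_funepos.
  have mn : measurable_fun setT Z^\- by exact: measurable_funeneg.
  have fp : \int[P]_w Z^\+ w \is a fin_num by exact: integrable_fin_num.
  have fn : \int[P]_w Z^\- w \is a fin_num.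
    by move: fZ fp; case: (\int[P]_w Z^\+ w) => [r| |] //; case: (\int[P]_w Z^\- w) => [s| |].
  split => //; apply/integrableP; split => //.
  have -> : \int[P]_w `|Z w| = \int[P]_w (Z^\+ w + Z^\- w).
    by apply: eq_integral => w _; rewrite -[LHS]/((abse \o Z) w) fune_abse.
  by rewrite ge0_integralD // ltey_eq fin_numD fp fn.
have [iY EY] := int Y mY fY.
have [|iX EX] := int X mX; first by rewrite XYE.
have iD : \int[P]_w (Y w - X w) = 0.
  by rewrite integralB // -EY -EX XYE subee.
have mD : measurable_fun setT (fun w => Y w - X w) by exact: emeasurable_funB.
have /(ae_eq_integral_abs _ measurableT mD).1 : \int[P]_w `|Y w - X w| = 0.
  rewrite -iD; apply: ae_eq_integral => //; first exact: measurableT_comp.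
  have fX := integrable_ae measurableT iX.
  near=> w => _; rewrite gee0_abs // sube_ge0; first by near: w.
  by have -> // : X w \is a fin_num; near: w; apply: filterS fX => w; exact.
move=> D0.
have fX := integrable_ae measurableT iX; have fY' := integrable_ae measurableT iY.
near=> w.
have fXw : X w \is a fin_num by near: w; apply: filterS fX => w; exact.
have fYw : Y w \is a fin_num by near: w; apply: filterS fY' => w; exact.
have : Y w - X w = 0 by near: w; apply: filterS D0 => w; exact.
move: fXw fYw; case: (X w) => [r| |] //; case: (Y w) => [s| |] // _ _ [] rs.
by congr EFin; lra.
Unshelve. all: by end_near.
Qed.

Hypothesis complete : measure_is_complete P.

Lemma regular_expectation_gtNy (k : nat) (f : 'rV[R]_k -> Omega -> \bar R) mu
    (x : Omega -> 'rV[R]_k) : regular_with P f mu -> measurable_wrt (@measurable d Omega) x ->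
  - (\int[P]_w (mu w)%:E) <= extended_expectation P (fun w => f (x w) w).
Proof.
move=> rf Gx; have [mu0 imu _ _] := rf.
have sM := @sigma_algebra_measurable d Omega.
have mU := shifted_composite_measurable complete (@subset_refl _ _) rf Gx.
have mX := composite_measurable complete (@subset_refl _ _) rf Gx.
rewrite (extended_expectation_shift mu0 imu mX mU (fun w => shifted_ge0 f mu (x w) w)).
  by rewrite -[leLHS]add0e leeD2r //; apply: integral_ge0 => w _; exact: shifted_ge0.
by apply: filterS (composite_shift rf x) => w [].
Qed.

Lemma expectation_condexp_integrand (G : set (set Omega)) (k : nat)
    (f g : 'rV[R]_k -> Omega -> \bar R) mu (x : Omega -> 'rV[R]_k) :
  sigma_algebra setT G -> G `<=` @measurable d Omega ->
  regular_with P f mu -> is_condexp_integrand P G f g -> measurable_wrt G x ->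
  extended_expectation P (fun w => g (x w) w) = extended_expectation P (fun w => f (x w) w).
Proof.
move=> sG GM rf [ng cg] Gx; have [mu0 imu _ _] := rf.
have [C cC] := condexp_EFin_exists sG GM mu0 imu.
have mU := shifted_composite_measurable complete GM rf Gx.
have U0 w : 0 <= shifted f mu (x w) w by exact: shifted_ge0.
have mX := composite_measurable complete GM rf Gx.
have [V cV] := condexp_ge0_exists P sG GM mU U0.
have VC := (is_condexp_shift complete sG GM rf cC _ Gx cV).1 (cg x Gx).
rewrite [RHS](extended_expectation_shift mu0 imu mX mU U0); last first.
  by apply: filterS (composite_shift rf x) => w [].
have [V0 GV VE] := cV; have [C0 GC CE] := cC.
have mV := measurable_wrt_measurable sG GM GV.
have icC : P.-integrable setT C.
  by apply: (condexp_ge0_integrable sG GM imu _ cC) => w; rewrite lee_fin.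
have ifC := integrable_fine icC.
have Gg := measurable_wrt_measurable sG GM (normal_measurable sG ng Gx).
rewrite (extended_expectation_shift (fun w => fine_ge0 (C0 w)) ifC Gg mV V0); last first.
  by apply: filterS VC => w [-> fC]; rewrite fineK // subeK.
have GT : G setT by exact: (sa_cst sG True).
rewrite VE //; congr (_ - _); rewrite -(CE setT GT).
apply: ae_eq_integral => //.
- exact: measurable_int ifC.
- exact: measurable_int icC.
- by apply: filterS VC => w [_ fC] _; rewrite fineK.
Qed.

End extended_expectation.

(** * The recursion and its optimal processes *)

Section partial_minimum_of_integrand.
Context d (Omega : measurableType d) (R : realType) (P : probability Omega R).
Context (a b : nat) (f : 'rV[R]_(a + b) -> Omega -> \bar R) (mu : Omega -> R).

Lemma lsubmx_open (U : set 'rV[R]_a) : open U -> open [set z : 'rV[R]_(a + b) | U (lsubmx z)].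
Proof.
move=> oU; rewrite openE => z /= Uz.
have /near_norm[e e0 sub] : nbhs (lsubmx z) U by exact: open_nbhs_nbhs.
apply/near_norm; exists e => // z' /= zz'; apply: sub => /=.
have /norm_row_mx_lt : (`|row_mx (lsubmx (z - z')) (rsubmx (z - z'))| < e)%R.
  by rewrite hsubmxK.
by move=> /(_ e0)[]; rewrite linearB.
Qed.

(** The infimum over [x] in a ball of the partial minimum is the infimum of [f]
    over an open cylinder; it is measurable for every [w], while closedness needs
    the linearity of the null space. *)
Lemma partial_minimum_regular : regular_with P f mu ->
  normal_integrand (@measurable d Omega) f ->
  (\forall w \ae P, linear_subspace (null_space (f^~ w))) ->
  regular_with P (fun x w => partial_minimum (f^~ w) x) mu.
Proof.
move=> [mu0 imu gf _] nf lf; split => //.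
  near=> w; have [cf vf Mf] : good_at f mu w by near: w.
  have Lw : linear_subspace (null_space (f^~ w)) by near: w.
  split.
  - exact: (partial_minimum_epigraph_closed cf vf Mf Lw).
  - exact: (partial_minimum_epigraph_convex cf vf Mf Lw).
  - by move=> x; exact: (partial_minimum_ge Mf).
move=> i; apply/measurable_ambientE.
rewrite (_ : inf_over _ _ = inf_over f [set z | rational_ball i (lsubmx z)]).
  apply: (normal_inf_over (sigma_algebra_measurable _) nf).
  by apply: lsubmx_open; exact: rational_ball_open.
apply/funext => w; apply/eqP; rewrite eq_le; apply/andP; split.
  apply: le_ereal_inf_tmp => _ [z iz <-].
  apply: (@le_trans _ _ (partial_minimum (f^~ w) (lsubmx z))).
    by apply: ereal_inf_lbound; exists (lsubmx z).
  by rewrite -[X in _ <= f X w]hsubmxK; exact: partial_minimum_le.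
apply: le_ereal_inf_tmp => _ [x ix <-]; apply: le_ereal_inf_tmp => _ [y _ <-].
by apply: ereal_inf_lbound; exists (row_mx x y) => //=; rewrite row_mxKl.
Unshelve. all: by end_near.
Qed.

Lemma partial_minimum_attained_ae : regular_with P f mu ->
  (\forall w \ae P, linear_subspace (null_space (f^~ w))) ->
  \forall w \ae P, forall x, argmin (fun y => f (row_mx x y) w) !=set0 /\
    forall y u, argmin (fun y => f (row_mx x y) w) y -> null_space (f^~ w) u ->
      argmin (fun y => f (row_mx x y) w) (y + u)%R.
Proof.
move=> [mu0 imu gf _] lf; near=> w => x.
have [cf vf Mf] : good_at f mu w by near: w.
have Lw : linear_subspace (null_space (f^~ w)) by near: w.
split; first by have [y ymin] := partial_minimum_attained cf vf Mf Lw x; exists y.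
move=> y u my Lu z; have := null_space_invariant cf vf Mf Lw x y Lu => /= ->.
exact: my.
Unshelve. all: by end_near.
Qed.

End partial_minimum_of_integrand.

Section stages.
Context d (Omega : measurableType d) (R : realType) (P : probability Omega R).
Context (T : nat) (F : nat -> set (set Omega)) (n : nat -> nat).
Context (h : 'rV[R]_(dims n T.+1) -> Omega -> \bar R).
Hypothesis F_filtration : is_filtration T F.
Hypothesis complete : measure_is_complete P.
Hypothesis h_normal : normal_integrand (@measurable d Omega) h.
Hypothesis h_convex : convex_integrand h.
Hypothesis h_bounded : integrable_lower_bound P h.
Hypothesis N_linear : linear_valued_along_recursion P F h.
Implicit Types (H : integrand_family Omega R n) (x : process Omega R n).

Let sF t : (t <= T)%N -> sigma_algebra setT (F t).
Proof. by case: F_filtration => + _ _; apply. Qed.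

Let FM t : (t <= T)%N -> F t `<=` @measurable d Omega.
Proof. by case: F_filtration => _ + _; apply. Qed.

Lemma cost_regular : exists mu, regular_with P h mu.
Proof.
have [m [im mh]] := h_bounded; exists (fun w => `|fine (m w)|%R); split => //.
- apply: (le_integrable measurableT _ _ im).
    apply/measurable_EFinP; apply: measurableT_comp => //.
    by apply: measurableT_comp => //; exact: measurable_int im.
  by move=> w _ /=; case: (m w) => [r| |] //=; rewrite ?normr_id ?normr0 ?leey.
- have fm := integrable_ae measurableT im.
  near=> w; split; [exact: h_normal.1|exact: h_convex|move=> z].
  have fmw : m w \is a fin_num by near: w; apply: filterS fm => w; exact.
  apply: le_trans (mh z w); rewrite -[leRHS](fineK fmw) lee_fin.
  by rewrite lerNl; apply: le_trans (ler_norm _) _; rewrite normrN.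
- move=> i; apply/measurable_ambientE.
  exact: (normal_inf_over (sigma_algebra_measurable _) h_normal (@rational_ball_open _ _ i)).
Unshelve. all: by end_near.
Qed.

Lemma recursion_from s t H : (s <= t)%N -> recursion_down_to P F h s H ->
  recursion_down_to P F h t H.
Proof. by move=> st [HT Hs]; split => // r tr; apply: Hs; exact: leq_trans tr. Qed.

Lemma stage_normal t H : (t <= T)%N -> recursion_down_to P F h t H ->
  normal_integrand (F t) (H t).
Proof.
rewrite leq_eqVlt => /orP[/eqP ->|tT] [HT Hs]; first by case: HT.
by have [] := Hs t (leqnn t) tT.
Qed.

Lemma normal_le (G : set (set Omega)) (k : nat) (g : 'rV[R]_k -> Omega -> \bar R) :
  G `<=` @measurable d Omega -> normal_integrand G g ->
  normal_integrand (@measurable d Omega) g.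
Proof. by move=> GM [cg Gg]; split => // U oU; apply: GM; exact: Gg. Qed.

Lemma stage_linear t H : (t <= T)%N -> recursion_down_to P F h t H ->
  \forall w \ae P, linear_subspace (null_space ((H t)^~ w)).
Proof. by move=> tT Ht; exact: (N_linear tT Ht). Qed.

Lemma inf_last_regular_of t H mu : (t <= T)%N -> recursion_down_to P F h t H ->
  regular_with P (H t) mu -> regular_with P (inf_last (H t)) mu.
Proof.
move=> tT Ht rH; apply: partial_minimum_regular => //.
  exact: normal_le (FM tT) (stage_normal tT Ht).
exact: stage_linear.
Qed.

Lemma stage_regular t H : (t <= T)%N -> recursion_down_to P F h t H ->
  exists mu, regular_with P (H t) mu.
Proof.
move: {2}(T - t)%N (erefl (T - t)%N) => k; elim: k t => [|k IH] t tk tT Ht.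
  have tE : t = T by apply/eqP; rewrite eqn_leq tT -subn_eq0 tk.
  move: Ht; rewrite tE => -[HT _]; have [mu rh] := cost_regular.
  exact: (condexp_integrand_regular complete (sF (leqnn T)) (FM (leqnn T)) rh HT).
have tT' : (t < T)%N by rewrite -subn_gt0 tk.
have Ht1 := recursion_from (leqnSn t) Ht.
have [|mu rH] := IH t.+1 _ tT' Ht1; first by rewrite subnS tk.
have [_ /(_ t (leqnn t) tT') HtE] := Ht.
apply: (condexp_integrand_regular complete (sF tT) (FM tT) _ HtE).
exact: inf_last_regular_of rH.
Qed.

Lemma inf_last_regular t H : (t <= T)%N -> recursion_down_to P F h t H ->
  exists mu, regular_with P (inf_last (H t)) mu.
Proof.
by move=> tT Ht; have [mu rH] := stage_regular tT Ht; exists mu; exact: inf_last_regular_of.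
Qed.

Lemma stage_argmin_ae t H : (t <= T)%N -> recursion_down_to P F h t H ->
  \forall w \ae P, forall z : 'rV[R]_(dims n t),
    argmin (fun y => H t (append z y) w) !=set0 /\
    forall y u, argmin (fun y => H t (append z y) w) y -> null_directions H t w u ->
      argmin (fun y => H t (append z y) w) (y + u)%R.
Proof.
move=> tT Ht; have [mu rH] := stage_regular tT Ht.
exact: partial_minimum_attained_ae rH (stage_linear tT Ht).
Qed.

(** The recursion is built from [T] downwards, one component of a dependent family
    at a time. *)
Definition override t (g : 'rV[R]_(dims n t.+1) -> Omega -> \bar R) H :
    integrand_family Omega R n :=
  fun s => match t =P s with
    | ReflectT e => eq_rect t (fun s => 'rV[R]_(dims n s.+1) -> Omega -> \bar R) g s e
    | ReflectF _ => H s
    end.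

Lemma override_eq t g H : @override t g H t = g.
Proof. by rewrite /override; case: eqP => // e; rewrite (eq_irrelevance e erefl). Qed.

Lemma override_neq t s g H : t != s -> @override t g H s = H s.
Proof. by rewrite /override; case: eqP. Qed.

Lemma recursion_exists t : (t <= T)%N -> exists H, recursion_down_to P F h t H.
Proof.
move: {2}(T - t)%N (erefl (T - t)%N) => k; elim: k t => [|k IH] t tk tT.
  have tE : t = T by apply/eqP; rewrite eqn_leq tT -subn_eq0 tk.
  have [mu rh] := cost_regular.
  have [g cg] := condexp_integrand_exists complete (sF (leqnn T)) (FM (leqnn T)) rh.
  exists (@override T g (fun _ _ _ => 0)); split; first by rewrite override_eq.
  by move=> s; rewrite tE => /leq_ltn_trans /[apply]; rewrite ltnn.
have tT' : (t < T)%N by rewrite -subn_gt0 tk.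
have [|H Ht1] := IH t.+1 _ tT'; first by rewrite subnS tk.
have [mu rH] := inf_last_regular tT' Ht1.
have [g cg] := condexp_integrand_exists complete (sF tT) (FM tT) rH.
exists (@override t g H); case: Ht1 => HT Hs; split.
  by rewrite override_neq // neq_ltn tT'.
move=> s; rewrite leq_eqVlt => /orP[/eqP <-|ts] sT.
  by rewrite override_eq override_neq // neq_ltn ltnSn.
by rewrite !override_neq ?neq_ltn ?ts ?(ltnW ts) //; [exact: Hs|rewrite (ltn_trans ts)].
Qed.

Lemma recursion_unique H H' :
  recursion_down_to P F h 0 H -> recursion_down_to P F h 0 H' ->
  forall t, (t <= T)%N -> \forall w \ae P, forall z, H t z w = H' t z w.
Proof.
move=> [HT Hs] [HT' Hs'] t.
move: {2}(T - t)%N (erefl (T - t)%N) => k; elim: k t => [|k IH] t tk tT.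
  have -> : t = T by apply/eqP; rewrite eqn_leq tT -subn_eq0 tk.
  apply: (condexp_integrand_unique (sF (leqnn T)) (FM (leqnn T)) _ HT HT').
  exact: nearW.
have tT' : (t < T)%N by rewrite -subn_gt0 tk.
apply: (condexp_integrand_unique (sF tT) (FM tT) _ (Hs t _ tT') (Hs' t _ tT')) => //.
have := IH t.+1 _ tT'; rewrite subnS tk => /(_ erefl); apply: filterS => w HH' x.
by congr ereal_inf; apply/seteqP; split=> _ [y _ <-]; exists y; rewrite ?HH'.
Qed.

Section expectations.
Variable H : integrand_family Omega R n.
Arguments H : clear implicits.
Hypothesis HR : recursion_down_to P F h 0 H.

Let Hfrom t : recursion_down_to P F h t H.
Proof. exact: recursion_from (leq0n t) HR. Qed.

Lemma before_measurable x t (G : set (set Omega)) : sigma_algebra setT G ->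
  (forall s, (s < t)%N -> measurable_wrt G (x s)) -> measurable_wrt G (before x t).
Proof.
move=> sG; elim: t => [|t IH] Gx; first by move=> U oU; exact: (sa_cst sG (U 0%R)).
apply: (measurable_wrt_comp2 (phi := fun p => append p.1 p.2) sG).
- by apply: IH => s st; apply: Gx; exact: ltnW.
- exact: Gx.
- exact: row_mx_continuous.
Qed.

Lemma adapted_before x t s : adapted T F x -> (s <= T)%N -> (t <= s.+1)%N ->
  measurable_wrt (F s) (before x t).
Proof.
move=> ax sT ts; apply: before_measurable; first exact: sF.
move=> r rt; have rs : (r <= s)%N by rewrite -ltnS (leq_trans rt).
apply: (@measurable_wrt_le _ _ (F r)); last by apply: ax; exact: leq_trans sT.
by case: F_filtration => _ _; apply.
Qed.

Lemma stage_measurable x t : adapted T F x -> (t <= T)%N ->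
  measurable_fun setT (fun w => H t (before x t.+1 w) w).
Proof.
move=> ax tT; apply: (measurable_wrt_measurable (sF tT) (FM tT)).
apply: (normal_measurable (sF tT) (stage_normal tT (Hfrom t))).
exact: adapted_before.
Qed.

Lemma inf_last_measurable x t : adapted T F x -> (t < T)%N ->
  measurable_fun setT (fun w => inf_last (H t.+1) (before x t.+1 w) w).
Proof.
move=> ax tT; have [mu rH] := inf_last_regular tT (Hfrom t.+1).
apply: (composite_measurable complete (FM tT) rH).
exact: adapted_before.
Qed.

Lemma stage_objective_terminal x : adapted T F x ->
  stage_objective P H T x = objective P h x.
Proof.
move=> ax; have [mu rh] := cost_regular; have [HT _] := HR.
apply: (expectation_condexp_integrand complete (sF (leqnn T)) (FM (leqnn T)) rh HT).
exact: adapted_before.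
Qed.

Lemma stage_objective_inf_last x t : adapted T F x -> (t < T)%N ->
  stage_objective P H t x =
  extended_expectation P (fun w => inf_last (H t.+1) (before x t.+1 w) w).
Proof.
move=> ax tT; have [mu rH] := inf_last_regular tT (Hfrom t.+1).
have [_ /(_ t (leq0n t) tT) Ht] := HR.
apply: (expectation_condexp_integrand complete (sF (ltnW tT)) (FM (ltnW tT)) rH Ht).
by apply: adapted_before => //; exact: ltnW.
Qed.

Lemma inf_last_before x t w :
  inf_last (H t.+1) (before x t.+1 w) w <= H t.+1 (before x t.+2 w) w.
Proof. by apply: ereal_inf_lbound; exists (x t.+1 w). Qed.

Lemma stage_objective_leS x t : adapted T F x -> (t < T)%N ->
  stage_objective P H t x <= stage_objective P H t.+1 x.
Proof.
move=> ax tT; rewrite stage_objective_inf_last //.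
apply: extended_expectation_le; [exact: inf_last_measurable|exact: stage_measurable|].
by apply: nearW => w; exact: inf_last_before.
Qed.

Lemma stage_objective_le x s t : adapted T F x -> (s <= t)%N -> (t <= T)%N ->
  stage_objective P H s x <= stage_objective P H t x.
Proof.
move=> ax; elim: t => [|t IH]; first by rewrite leqn0 => /eqP ->.
rewrite leq_eqVlt => /orP[/eqP -> //|st] tT.
by apply: le_trans (IH st (ltnW tT)) _; exact: stage_objective_leS.
Qed.

Definition argmin_at x t := \forall w \ae P,
  argmin (fun y => H t (append (before x t w) y) w) (x t w).

Lemma inf_last_argmin x t w :
  argmin (fun y => H t.+1 (append (before x t.+1 w) y) w) (x t.+1 w) ->
  inf_last (H t.+1) (before x t.+1 w) w = H t.+1 (before x t.+2 w) w.
Proof.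
move=> mx; apply/eqP; rewrite eq_le inf_last_before /=.
by apply: le_ereal_inf_tmp => _ [y _ <-]; exact: mx.
Qed.

Lemma stage_objective_argmin x t : adapted T F x -> (t < T)%N -> argmin_at x t.+1 ->
  stage_objective P H t x = stage_objective P H t.+1 x.
Proof.
move=> ax tT mx; rewrite stage_objective_inf_last //.
apply: extended_expectation_ae; [exact: inf_last_measurable|exact: stage_measurable|].
by apply: filterS mx => w; exact: inf_last_argmin.
Qed.

Lemma stage_objective_argmin_from x t : adapted T F x -> (t <= T)%N ->
  (forall s, (t < s)%N -> (s <= T)%N -> argmin_at x s) ->
  stage_objective P H t x = objective P h x.
Proof.
move=> ax tT mx; rewrite -stage_objective_terminal //.
move: {2}(T - t)%N (erefl (T - t)%N) => k; elim: k t tT mx => [|k IH] t tT mx tk.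
  by have -> : t = T by apply/eqP; rewrite eqn_leq tT -subn_eq0 tk.
have tT' : (t < T)%N by rewrite -subn_gt0 tk.
rewrite stage_objective_argmin //; last exact: mx.
apply: IH => //; last by rewrite subnS tk.
by move=> s ts; apply: mx; exact: ltnW.
Qed.

Lemma optimal_value_le x : adapted T F x -> optimal_value P F h <= objective P h x.
Proof. by move=> ax; apply: ereal_inf_lbound; exists x. Qed.

Lemma optimal_value_gtNy : -oo < optimal_value P F h.
Proof.
have [mu rh] := cost_regular; have [_ imu _ _] := rh.
apply: (@lt_le_trans _ _ (- (\int[P]_w (mu w)%:E))).
  have := integrable_fin_num measurableT imu.
  by case: (integral _ _ _) => [r| |] // _; rewrite -EFinN ltNyr.
apply: le_ereal_inf_tmp => _ [x ax <-].
apply: (regular_expectation_gtNy complete rh).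
exact: measurable_wrt_le (FM (leqnn T)) (adapted_before ax _ _).
Qed.

Lemma stagewise_argmin_optimal x : adapted T F x -> stagewise_argmin P T H x ->
  optimal P F h x.
Proof.
move=> ax mx; split => //; apply/eqP; rewrite eq_le optimal_value_le // andbT.
apply: le_ereal_inf_tmp => _ [x' ax' <-].
rewrite -(stage_objective_argmin_from ax (leq0n T)) //; last by move=> s _; exact: mx.
rewrite -(stage_objective_terminal ax').
apply: le_trans (stage_objective_le ax' (leq0n T) (leqnn T)).
apply: extended_expectation_le; [exact: stage_measurable|exact: stage_measurable|].
by have := mx 0%N (leq0n T); apply: filterS => w; exact.
Qed.

Lemma optimal_stage_objective x : adapted T F x -> 
  (forall x', adapted T F x' -> forall t, (t <= T)%N ->
    optimal_value P F h <= stage_objective P H t x') ->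
  optimal P F h x <->
  forall t, (t <= T)%N -> stage_objective P H t x = optimal_value P F h.
Proof.
move=> ax lb; split=> [[_ ox] t tT|ox].
  apply/eqP; rewrite eq_le lb // andbT -ox -stage_objective_terminal //.
  exact: stage_objective_le.
by split => //; rewrite -stage_objective_terminal // ox.
Qed.

(** Finite expectations that agree force the pointwise inequalities behind
    [E h_t(x^t) <= E h_{t+1}(x^{t+1})] to be equalities; at time [0] the comparison is
    with a process whose first component is a minimiser. *)
Lemma optimal_stagewise_argmin x : adapted T F x -> optimal_value P F h < +oo ->
  (forall t, (t <= T)%N -> stage_objective P H t x = optimal_value P F h) ->
  (forall x', adapted T F x' -> optimal_value P F h <= stage_objective P H 0 x') ->
  (exists2 x', adapted T F x' & argmin_at x' 0 /\
    stage_objective P H 0 x' = optimal_value P F h) ->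
  stagewise_argmin P T H x.
Proof.
move=> ax finopt ox lb [x' ax' [mx' ox']] t tT.
have fopt : optimal_value P F h \is a fin_num.
  by rewrite fin_numElt optimal_value_gtNy.
case: t tT => [|t] tT.
  have E : \forall w \ae P, H 0%N (before x' 1 w) w = H 0%N (before x 1 w) w.
    apply: extended_expectation_eq_ae.
    - exact: (stage_measurable ax' (leq0n T)).
    - exact: (stage_measurable ax (leq0n T)).
    - by apply: filterS mx' => w; exact.
    - by rewrite -/(stage_objective P H 0 x') -/(stage_objective P H 0 x) ox' ox.
    - by rewrite -/(stage_objective P H 0 x) ox.
  near=> w => y; have <- : H 0%N (before x' 1 w) w = H 0%N (before x 1 w) w by near: w.
  have mw : argmin (fun y => H 0%N (append (before x' 0 w) y) w) (x' 0%N w) by near: w.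
  exact: mw.
have E : \forall w \ae P,
    inf_last (H t.+1) (before x t.+1 w) w = H t.+1 (before x t.+2 w) w.
  apply: extended_expectation_eq_ae.
  - exact: inf_last_measurable.
  - exact: stage_measurable.
  - by apply: nearW => w; exact: inf_last_before.
  - rewrite -stage_objective_inf_last // -/(stage_objective P H t.+1 x).
    by rewrite !ox // ltnW.
  - by rewrite -/(stage_objective P H t.+1 x) ox.
apply: filterS E => w Ew y; rewrite -[leLHS]Ew.
by apply: ereal_inf_lbound; exists y.
Unshelve. all: by end_near.
Qed.

Lemma stage_selection t (z : Omega -> 'rV[R]_(dims n t)) :
  exists y : Omega -> 'rV[R]_(n t), (t <= T)%N -> measurable_wrt (F t) z ->
    measurable_wrt (F t) y /\
    forall w, argmin (fun y => H t (append (z w) y) w) !=set0 ->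
      argmin (fun y => H t (append (z w) y) w) (y w) /\
      forall y', argmin (fun y => H t (append (z w) y) w) y' ->
        (sqnorm (y w) <= sqnorm y')%R.
Proof.
have [tT|_] := leqP t T; last by exists (fun=> 0%R).
have [Gz|nGz] := pselect (measurable_wrt (F t) z); last by exists (fun=> 0%R).
have nz := normal_partial (sF tT) (stage_normal tT (Hfrom t)) Gz.
by have [y Hy] := min_norm_argmin_selection (sF tT) nz; exists y.
Qed.

Definition stage_select t (z : Omega -> 'rV[R]_(dims n t)) : Omega -> 'rV[R]_(n t) :=
  sval (cid (stage_selection z)).

(** Keeps the components of [x] before time [c] and continues by the selected
    minimisers of least norm.  The history is built first, because the selection
    at time [t] depends on it as a whole function of [w]. *)
Fixpoint greedy_before x (c t : nat) : Omega -> 'rV[R]_(dims n t) :=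
  if t is t'.+1 then fun w => append (greedy_before x c t' w)
    ((if (t' < c)%N then x t' else stage_select (greedy_before x c t')) w)
  else fun=> 0%R.

Definition greedy x c : process Omega R n := fun t =>
  if (t < c)%N then x t else stage_select (greedy_before x c t).

Lemma before_greedy x c t w : before (greedy x c) t w = greedy_before x c t w.
Proof. by elim: t => [//|t IH] /=; rewrite IH. Qed.

Lemma before_greedy_lt x c t w : (t <= c)%N -> before (greedy x c) t w = before x t w.
Proof. by elim: t => [//|t IH] tc /=; rewrite /greedy tc IH // ltnW. Qed.

Lemma greedy_before_measurable x c t : (forall s, (s < c)%N -> (s <= T)%N -> measurable_wrt (F s) (x s)) ->
  (t <= T)%N -> measurable_wrt (F t) (greedy_before x c t) /\
    measurable_wrt (F t) (greedy x c t).
Proof.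
move=> ax.
have key s : (s <= T)%N -> measurable_wrt (F s) (greedy_before x c s) ->
    measurable_wrt (F s) (greedy x c s).
  move=> sT Gs; rewrite /greedy; case: ifP => sc; first exact: ax.
  by rewrite /stage_select; case: cid => y /= /(_ sT Gs)[].
elim: t => [|t IH] tT.
  have G0 : measurable_wrt (F 0%N) (greedy_before x c 0).
    by move=> U oU; exact: (sa_cst (sF (leq0n T)) (U 0%R)).
  by split => //; exact: key.
have [Gt Gxt] := IH (ltnW tT).
have FF : F t `<=` F t.+1 by case: F_filtration => _ _; apply.
have G1 : measurable_wrt (F t.+1) (greedy_before x c t.+1).
  apply: (measurable_wrt_comp2 (phi := fun p => append p.1 p.2) (sF tT)).
  - exact: measurable_wrt_le FF Gt.
  - exact: measurable_wrt_le FF Gxt.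
  - exact: row_mx_continuous.
by split => //; exact: key.
Qed.

Lemma greedy_adapted x c : (forall s, (s < c)%N -> (s <= T)%N -> measurable_wrt (F s) (x s)) ->
  adapted T F (greedy x c).
Proof. by move=> ax t tT; have [] := greedy_before_measurable ax tT. Qed.

Lemma greedy_argmin x c t : (forall s, (s < c)%N -> (s <= T)%N -> measurable_wrt (F s) (x s)) ->
  (t <= T)%N -> (c <= t)%N -> argmin_at (greedy x c) t /\
  \forall w \ae P, orthogonal_to (greedy x c t w) (null_directions H t w).
Proof.
move=> ax tT ct; have [Gb _] := greedy_before_measurable ax tT.
have gE : greedy x c t = stage_select (greedy_before x c t).
  by rewrite /greedy ltnNge ct.
have := svalP (cid (stage_selection (greedy_before x c t))).
rewrite -/(stage_select _) -gE => /(_ tT Gb)[_ sel].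
have att := stage_argmin_ae tT (Hfrom t).
split.
  apply: filterS att => w /(_ (greedy_before x c t w))[m0 _].
  by rewrite before_greedy; have [] := sel w m0.
have lin := stage_linear tT (Hfrom t).
near=> w.
have [m0 mL] : argmin (fun y => H t (append (greedy_before x c t w) y) w) !=set0 /\
    forall y u, argmin (fun y => H t (append (greedy_before x c t w) y) w) y ->
      null_directions H t w u ->
      argmin (fun y => H t (append (greedy_before x c t w) y) w) (y + u)%R.
  by move: (greedy_before x c t w); near: w; exact: att.
have Lw : linear_subspace (null_directions H t w) by near: w.
have [mx minx] := sel w m0.
exact: min_sqnorm_orthogonal Lw mL mx minx.
Unshelve. all: by end_near.
Qed.

(** The process that agrees with [x] up to time [t] and is greedy afterwards has
    cost [E h_t(x^t)]. *)
Lemma stage_objective_ge_optimal x t : adapted T F x -> (t <= T)%N ->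
  optimal_value P F h <= stage_objective P H t x.
Proof.
move=> ax tT.
have ax' : forall s, (s < t.+1)%N -> (s <= T)%N -> measurable_wrt (F s) (x s) by move=> s _; exact: ax.
have ag := greedy_adapted ax'.
have -> : stage_objective P H t x = stage_objective P H t (greedy x t.+1).
  by rewrite /stage_objective; congr extended_expectation; apply/funext => w; rewrite before_greedy_lt.
rewrite (stage_objective_argmin_from ag tT); first exact: optimal_value_le.
by move=> s ts sT; have [] := greedy_argmin ax' sT ts.
Qed.

End expectations.
End stages.

Theorem theorem3 (R : realType) (d : measure_display)
    (Omega : measurableType d) (P : probability Omega R)
    (T : nat) (F : nat -> set (set Omega)) (n : nat -> nat)
    (h : 'rV[R]_(dims n T.+1) -> Omega -> \bar R)
    (F_filtration : is_filtration T F)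
    (complete : measure_is_complete P)
    (F_complete : forall t, (t <= T)%N -> complete_wrt P (F t))
    (h_normal : normal_integrand (@measurable d Omega) h)
    (h_convex : convex_integrand h)
    (h_bounded : integrable_lower_bound P h)
    (N_linear : linear_valued_along_recursion P F h) :
  (exists H : integrand_family Omega R n, recursion_down_to P F h 0 H) /\
  (forall H H' : integrand_family Omega R n,
    recursion_down_to P F h 0 H -> recursion_down_to P F h 0 H' ->
    forall t, (t <= T)%N ->
      \forall w \ae P, forall x : 'rV[R]_(dims n t.+1), H t x w = H' t x w) /\
  (forall H : integrand_family Omega R n, recursion_down_to P F h 0 H ->
    (forall x : process Omega R n, adapted T F x ->
      forall t, (t <= T)%N ->
        optimal_value P F h <= stage_objective P H t x) /\
    (forall x : process Omega R n, adapted T F x ->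
      (optimal P F h x <->
        forall t, (t <= T)%N ->
          stage_objective P H t x = optimal_value P F h) /\
      (stagewise_argmin P T H x -> optimal P F h x) /\
      (optimal_value P F h < +oo ->
        optimal P F h x -> stagewise_argmin P T H x)) /\
    (exists x : process Omega R n,
      [/\ optimal P F h x,
          stagewise_argmin P T H x &
          forall t, (t <= T)%N ->
            \forall w \ae P, orthogonal_to (x t w) (null_directions H t w)])).
Proof.
have ex := recursion_exists F_filtration complete h_normal h_convex h_bounded N_linear (leq0n T).
split; first exact: ex.
split.
  move=> H H' HR HR' t tT; exact: (recursion_unique F_filtration HR HR').
move=> H HR.
have lb x t : adapted T F x -> (t <= T)%N ->
    optimal_value P F h <= stage_objective P H t x.
  exact: (stage_objective_ge_optimal F_filtration complete h_normal h_convex h_bounded N_linear HR).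
have vac (x : process Omega R n) s : (s < 0)%N -> (s <= T)%N -> measurable_wrt (F s) (x s) by [].
pose x0 : process Omega R n := fun _ _ => 0%R.
pose xs := greedy F_filtration HR x0 0.
have axs : adapted T F xs by exact: greedy_adapted.
have gm t : (t <= T)%N -> argmin_at P H xs t /\
    \forall w \ae P, orthogonal_to (xs t w) (null_directions H t w).
  move=> tT.
  exact: (greedy_argmin F_filtration complete h_normal h_convex h_bounded N_linear HR (vac x0) tT (leq0n t)).
have amxs : stagewise_argmin P T H xs by move=> t tT; have [] := gm t tT.
have sao x : adapted T F x -> stagewise_argmin P T H x -> optimal P F h x.
  exact: (stagewise_argmin_optimal F_filtration complete h_normal h_convex h_bounded N_linear HR).
have oxs := sao xs axs amxs.
have oso x : adapted T F x -> optimal P F h x <->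
    forall t, (t <= T)%N -> stage_objective P H t x = optimal_value P F h.
  move=> ax.
  by apply: (optimal_stage_objective F_filtration complete h_normal h_convex h_bounded N_linear HR ax) => x' ax' t tT; exact: lb.
split; first by move=> x ax t tT; exact: lb.
split.
  move=> x ax; split; first exact: oso.
  split; first exact: sao.
  move=> fin /(oso x ax) ox.
  apply: (optimal_stagewise_argmin F_filtration complete h_normal h_convex h_bounded N_linear HR ax fin ox).
    by move=> x' ax'; exact: lb.
  exists xs => //; split; first by have [] := gm 0%N (leq0n T).
  exact: ((oso xs axs).1 oxs 0%N (leq0n T)).
exists xs; split => //.
by move=> t tT; have [] := gm t tT.
Qed.
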